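(* Let $s,t>0$ and $x,y\ge0$. Let $(n_K)_{K}$ and $(m_K)_{K}$ be sequences of non-negative integers such that $$\frac{n_K}{K}\to x,\qquad \frac{m_K}{K}\to y\qquad\text{as }K\to\infty.$$ Let $(n_K(r),m_K(r))_{r\ge0}$ be the Markov chain with generator $\mathcal L$ started from $(n_K,m_K)$. Then, as $K\to\infty$, the processes $\big(n_K(r)/K,\;m_K(r)/K\big)_{r\ge0}$ converge in distribution (weakly on the Skorokhod path space) to the continuous process with generator $L_{s,t}$ started from $(x,y)$.
   Context: $\mathbb N=\{0,1,2,\dots\}$; $B(s,t)=\Gamma(s)\Gamma(t)/\Gamma(s+t)$; time is denoted by $r$. $\mathcal L$ is the generator of the continuous-time Markov chain on $\mathbb N^2$ given by $$\mathcal Lf(n,m)=\sum_{k=0}^n\sum_{l=0}^mr_{s,t}(n,m;k,l)\big(f(n-k+l,\;m-l+k)-f(n,m)\big),$$ $$r_{s,t}(n,m;k,l)=\frac{n!\,m!}{B(s,t)^2}\,\frac{\Gamma(k+s)\,\Gamma(m-l+t)\,\Gamma(n-k+t)\,\Gamma(l+s)}{\Gamma(s+t+n)\,\Gamma(s+t+m)\,(n-k)!\,k!\,(m-l)!\,l!}.$$ $L_{s,t}$ is the generator of the Markov jump process on $[0,\infty)^2$ given by $$L_{s,t}f(x,y)=\int_0^1\int_0^1\big(f(x(1-u)+yv,\;y(1-v)+xu)-f(x,y)\big)\,\phi_{s,t}(u,v)\,du\,dv,$$ $$\phi_{s,t}(u,v)=\frac{1}{B(s,t)^2}\,u^{s-1}(1-u)^{t-1}v^{s-1}(1-v)^{t-1}.$$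 *)

(* Defs.v *)
From HB Require Import structures.
From mathcomp Require Import all_boot all_order all_algebra.
From mathcomp Require Import all_classical all_reals all_analysis.

Set Implicit Arguments.
Unset Strict Implicit.
Unset Printing Implicit Defensive.

Import Order.TTheory GRing.Theory Num.Theory.
Import numFieldNormedType.Exports.

Local Open Scope classical_set_scope.
Local Open Scope ring_scope.

(** * Gamma and Beta functions *)

Definition Gamma {R : realType} (a : R) : R :=
  \int[lebesgue_measure]_(z in `]0, +oo[) (z `^ (a - 1) * expR (- z)).

Definition Beta {R : realType} (s t : R) : R :=
  Gamma s * Gamma t / Gamma (s + t).

(** * The two generators *)

Definition rate {R : realType} (s t : R) (n m k l : nat) : R :=
  n`!%:R * m`!%:R / Beta s t ^+ 2
  * (Gamma (k%:R + s) * Gamma ((m - l)%:R + t)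
     * Gamma ((n - k)%:R + t) * Gamma (l%:R + s)
     / (Gamma (s + t + n%:R) * Gamma (s + t + m%:R)
        * (n - k)`!%:R * k`!%:R * (m - l)`!%:R * l`!%:R)).

Definition chain_gen {R : realType} (s t : R) (f : nat * nat -> R)
    (p : nat * nat) : R :=
  let: (n, m) := p in
  \sum_(k < n.+1) \sum_(l < m.+1)
    rate s t n m k l * (f ((n - k + l)%N, (m - l + k)%N) - f (n, m)).

Definition phi {R : realType} (s t u v : R) : R :=
  (Beta s t ^+ 2)^-1
  * (u `^ (s - 1) * (1 - u) `^ (t - 1) * v `^ (s - 1) * (1 - v) `^ (t - 1)).

Definition jump_gen {R : realType} (s t : R) (f : R * R -> R) (p : R * R) : R :=
  let: (x, y) := p in
  \int[lebesgue_measure]_(v in `[0, 1]) \int[lebesgue_measure]_(u in `[0, 1])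
    ((f (x * (1 - u) + y * v, y * (1 - v) + x * u) - f (x, y)) * phi s t u v).

Definition quadrant (R : realType) : set (R * R) :=
  [set p | 0 <= p.1 /\ 0 <= p.2].

(** * Markov processes with a given generator *)

(* The state space is the measurable subset [E] of [S]; what the kernels [Q t]
   do at points outside [E], or for [t < 0], is irrelevant. *)
Definition transition_semigroup {R : realType} {d} {S : measurableType d}
    (E : set S) (Q : R -> R.-pker S ~> S) : Prop :=
  [/\ forall (t : R) x, 0 <= t -> E x -> Q t x E = 1%E,
      forall x A, E x -> measurable A -> Q 0 x A = \d_x A
    & forall (a b : R) x A, 0 <= a -> 0 <= b -> E x -> measurable A ->
        Q (a + b) x A = (\int[Q a x]_y Q b y A)%E].

(* [A] is the strong (sup-norm) generator of [Q] on the bounded measurable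
   functions, all of which are in its domain: the operators of interest
   are bounded. *)
Definition has_generator {R : realType} {d} {S : measurableType d}
    (E : set S) (Q : R -> R.-pker S ~> S) (A : (S -> R) -> S -> R) : Prop :=
  forall f : S -> R, measurable_fun setT f ->
    (exists M : R, forall x, `|f x| <= M) ->
    forall e : R, 0 < e -> \forall t \near (0 : R)^'+, forall x, E x ->
      `| (\int[Q t x]_y f y - f x) / t - A f x | <= e.

Definition past {R : realType} {d d'} {Om : measurableType d}
    {S : measurableType d'} (X : R -> Om -> S) (a : R) : set (set Om) :=
  <<s [set H | exists (u : R) B,
         [/\ 0 <= u, u <= a, measurable B & H = X u @^-1` B] ] >>.

(* The last clause is P(X_(a + b) \in B | past at a) = Q_b (X_a, B) a.s.,
   with the conditional probability unfolded. *)
Definition markov_process {R : realType} {d d'} {Om : measurableType d}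
    {S : measurableType d'} (E : set S) (Q : R -> R.-pker S ~> S)
    (P : probability Om R) (X : R -> Om -> S) : Prop :=
  [/\ forall t : R, 0 <= t -> measurable_fun setT (X t),
      forall (t : R) w, 0 <= t -> E (X t w)
    & forall (a b : R) B H, 0 <= a -> 0 <= b -> measurable B -> past X a H ->
        P (H `&` X (a + b) @^-1` B) = (\int[P]_(w in H) Q b (X a w) B)%E].

Definition markov_with_generator {R : realType} {d d'} {Om : measurableType d}
    {S : measurableType d'} (E : set S) (A : (S -> R) -> S -> R)
    (P : probability Om R) (X : R -> Om -> S) (x0 : S) : Prop :=
  (exists Q : R -> R.-pker S ~> S,
     [/\ transition_semigroup E Q, has_generator E Q A
       & markov_process E Q P X])
  /\ {ae P, forall w, X 0 w = x0}.

(** * Skorokhod space *)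

(* Functions on [0, +oo[ are encoded as functions on R that are constant on
   ]-oo, 0]. *)
Definition cadlag {R : realType} {V : topologicalType} (x : R -> V) : Prop :=
  [/\ forall t : R, t < 0 -> x t = x 0,
      forall t : R, 0 <= t -> x u @[u --> t^'+] --> x t
    & forall t : R, 0 < t -> exists l : V, x u @[u --> t^'-] --> l].

Record cadlag_path (R : realType) (V : topologicalType) := CadlagPath {
  path_fun :> R -> V ;
  path_cadlag : cadlag path_fun }.

HB.instance Definition _ (R : realType) (V : topologicalType) :=
  gen_eqMixin (cadlag_path R V).
HB.instance Definition _ (R : realType) (V : topologicalType) :=
  gen_choiceMixin (cadlag_path R V).

Definition time_change {R : realType} (lam : R -> R) : Prop :=
  {in `[0, +oo[ &, {homo lam : a b / a < b}}
  /\ lam @` `[0, +oo[ = `[0, +oo[%classic.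

Definition skorokhod_nbhd {R : realType} {V : pseudoMetricType R} (T e : R)
    (x : cadlag_path R V) : set (cadlag_path R V) :=
  [set y | exists lam : R -> R,
     [/\ time_change lam,
         forall t : R, 0 <= t -> `|lam t - t| < e
       & forall t : R, 0 <= t -> t <= T -> ball (x t) e (y (lam t))] ].

(* For a sequence, being eventually in [skorokhod_nbhd T e x] for all [T] and
   all [e > 0] is the usual J1 convergence to [x] on D([0, +oo[, V) (Ethier and
   Kurtz, Proposition 3.5.3; Jacod and Shiryaev, Theorem VI.1.14).  The J1
   topology being metrizable, these sets form a base of its neighbourhoods
   of [x], and its open sets are the following. *)
Definition skorokhod_open {R : realType} {V : pseudoMetricType R}
    (U : set (cadlag_path R V)) : Prop :=
  forall x, U x -> exists T e : R, 0 < e /\ skorokhod_nbhd T e x `<=` U.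

Section skorokhod_topology.
Context {R : realType} {V : pseudoMetricType R}.

Lemma skorokhod_nbhdS (T T' e e' : R) (x : cadlag_path R V) :
  T <= T' -> e' <= e -> skorokhod_nbhd T' e' x `<=` skorokhod_nbhd T e x.
Proof.
move=> TT' ee' y [lam [tc lam_id lam_y]]; exists lam; split => //.
- by move=> t t0; apply: lt_le_trans ee'; exact: lam_id.
- move=> t t0 tT; apply: le_ball ee' _ _; apply: lam_y => //.
  exact: le_trans tT TT'.
Qed.

Lemma skorokhod_openT : skorokhod_open [set: cadlag_path R V].
Proof. by move=> x _; exists 0, 1; split. Qed.

Lemma skorokhod_openI : setI_closed (@skorokhod_open R V).
Proof.
move=> A B oA oB x [/oA[T [e [e0 TeA]]] /oB[T' [e' [e'0 TeB]]]].
exists (Num.max T T'), (Num.min e e'); split; first by rewrite lt_min e0 e'0.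
move=> y xy; split.
- by apply: TeA; apply: skorokhod_nbhdS xy; rewrite ?le_max ?ge_min lexx.
- by apply: TeB; apply: skorokhod_nbhdS xy; rewrite ?le_max ?ge_min lexx orbT.
Qed.

Lemma skorokhod_open_bigU (I : Type) (f : I -> set (cadlag_path R V)) :
  (forall i, skorokhod_open (f i)) -> skorokhod_open (\bigcup_i f i).
Proof.
move=> of_ x [i _ /of_[T [e [e0 Tef]]]]; exists T, e; split => // y xy.
by exists i => //; exact: Tef.
Qed.

HB.instance Definition _ := isOpenTopological.Build (cadlag_path R V)
  skorokhod_openT skorokhod_openI skorokhod_open_bigU.

End skorokhod_topology.

(* Each [X] may live on its own probability space.  When [D] is a Skorokhod
   space and the one-time marginals of [X] are measurable, [F \o X] is
   measurable for every continuous [F], because the Borel sigma-algebra of the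
   J1 topology is generated by the evaluations. *)
Definition cvg_in_distribution {R : realType} {D : topologicalType}
    (dK : nat -> measure_display) (OmK : forall K, measurableType (dK K))
    (PK : forall K, probability (OmK K) R) (XK : forall K, OmK K -> D)
    (d : measure_display) (Om : measurableType d) (P : probability Om R)
    (X : Om -> D) : Prop :=
  forall F : D -> R, continuous F -> (exists M : R, forall x, `|F x| <= M) ->
    'E_(PK K)[F \o XK K]%E @[K --> \oo] --> 'E_P[F \o X]%E.

(** * Rescaled chain *)

Definition scale_state {R : realType} (K : nat) (p : nat * nat) : R * R :=
  (p.1%:R / K%:R, p.2%:R / K%:R).

Lemma continuous_scale_state {R : realType} (K : nat) :
  continuous (@scale_state R K).
Proof.
move=> [n m] A nA; exists ([set n], [set m]) => /=.
  by split; exact: discrete_set1.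
by move=> [a b] /= [-> ->]; exact: nbhs_singleton nA.
Qed.

Lemma cadlag_comp {R : realType} {V W : topologicalType} (g : V -> W)
  (x : R -> V) : continuous g -> cadlag x -> cadlag (g \o x).
Proof.
move=> cg [x0 xr xl]; split => [t t0|t t0|t t0] /=.
- by rewrite x0.
- exact: (cvg_comp _ _ (xr t t0) (cg (x t))).
- by have [l xtl] := xl t t0; exists (g l); exact: (cvg_comp _ _ xtl (cg l)).
Qed.

Definition rescale {R : realType} (K : nat) (x : cadlag_path R (nat * nat)%type) :
    cadlag_path R (R * R)%type :=
  CadlagPath (cadlag_comp (@continuous_scale_state R K) (path_cadlag x)).

(* Main.v *)
(* Both generators are bounded (the jump rate is 1), so the semigroups are given
   by their Taylor series; Chebyshev's inequality for the binomial splittings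
   turns the chain generator into the jump generator in the limit, whence
   convergence of the finite-dimensional distributions.  For a continuous
   bounded F >= 0 on the path space, let H be the combination, over a partition
   of unity of the positions at the times k/(i+1), of the infima of F near the
   corresponding step paths.  The expectation of H depends only on
   finite-dimensional distributions.  A path changing at most once in each time
   cell is Skorokhod-close to its step path, so F >= H for the chain outside an
   event of probability O(1/i), uniformly in K, while for the limit process F is
   an iterated lower limit of H.  Fatou's lemma gives liminf E F(X^K) >= E F(Z);
   applying this to F + M and M - F proves the convergence. *)
Require Import Defs.
From HB Require Import structures.
From mathcomp Require Import all_boot all_order all_algebra.
From mathcomp Require Import all_classical all_reals all_analysis.
From mathcomp Require Import measurable_realfun ring lra.

Set Implicit Arguments.
Unset Strict Implicit.
Unset Printing Implicit Defensive.

Import Order.TTheory GRing.Theory Num.Theory.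
Import numFieldNormedType.Exports.

Local Open Scope classical_set_scope.
Local Open Scope ring_scope.

(** * Gamma and Beta integrals *)

(** [F] is continuous but not uniformly so, and the step approximations of a cadlag path converge at
    no fixed rate. Hence [F] cannot be replaced by a function of finitely many positions with a
    two-sided error that is uniform over paths. Infima of [F] over Skorokhod neighbourhoods keep a
    one-sided inequality, which is all that Fatou needs; no tightness or identification of limit
    points enters. The indices [j] (precision and time horizon) and [i] (time mesh and bound on the
    positions) are fixed through the limit process before [K] tends to infinity, so the error for
    the chain must be uniform in [K]. It is, because the bound 2 on the generators does not depend
    on [K]: two changes in a cell of length [h] have probability at most [4 * h ^+ 2]. The path
    space carries no sigma-algebra, so the measurability of [F] along a process must be proved as
    well; the same iterated lower limit provides it. *)

Section lebesgue_affine.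
Context {R : realType}.
Local Notation mu := (@lebesgue_measure R).

Lemma lebesgue_measure_ocitv (a b : R) :
  mu `]a, b]%classic = (if a < b then (b - a)%:E else 0%E).
Proof.
by rewrite lebesgue_measure_itv/= lte_fin EFinB.
Qed.

(** The pushforward by a translation gives half-open intervals their length, so it is Lebesgue
    measure by uniqueness. The scaling lemma below argues in the same way. *)
Lemma ge0_integral_shift (c : R) (f : R -> \bar R) :
  measurable_fun setT f -> (forall x, 0 <= f x)%E ->
  (\int[mu]_x f (x + c)%R = \int[mu]_x f x)%E.
Proof.
move=> mf f0.
have mshift : measurable_fun setT
    (fun x : measurableTypeR R => (x + c)%R : measurableTypeR R).
  exact: measurable_funD.
pose g : {mfun measurableTypeR R >-> measurableTypeR R} :=
  HB.pack (fun x : measurableTypeR R => (x + c)%R : measurableTypeR R)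
    (isMeasurableFun.Build _ _ _ _ _ mshift).
transitivity (\int[pushforward mu g]_x f x)%E.
  by rewrite ge0_integral_pushforward// preimage_setT.
apply: eq_measure_integral => A mA _.
apply/esym/lebesgue_measure_unique => // X [[a b] _ <-] /=.
rewrite /pushforward lebesgue_measure_ocitv.
have -> : g @^-1` `]a, b] = `]a - c, b - c]%classic.
  by apply/seteqP; split=> x /=; rewrite !in_itv/= ltrBlDr lerBrDr.
rewrite lebesgue_measure_ocitv ltrD2r; congr (if _ then _%:E else _).
by ring.
Qed.

Lemma ge0_integral_scale (c : R) (f : R -> \bar R) : 0 < c ->
  measurable_fun setT f -> (forall x, 0 <= f x)%E ->
  (\int[mu]_x f x = c%:E * \int[mu]_x f (c * x)%R)%E.
Proof.
move=> c0 mf f0.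
have mscl : measurable_fun setT
    (fun x : measurableTypeR R => (c * x)%R : measurableTypeR R).
  exact: measurable_funM.
have c0' : 0 <= c by exact: ltW.
pose nu : {measure set (measurableTypeR R) -> \bar R} :=
  measure_function_pushforward__canonical__measure_function_Measure mu mscl.
transitivity (\int[mscale (NngNum c0') nu]_x f x)%E.
  apply: eq_measure_integral => A mA _.
  apply: lebesgue_measure_unique => // X [[a b] _ <-] /=.
  rewrite /mscale/= /pushforward lebesgue_measure_ocitv.
  have -> : (fun x : R => c * x) @^-1` `]a, b] = `]a / c, b / c]%classic.
    apply/seteqP; split=> x /=; rewrite !in_itv/=;
    by rewrite ltr_pdivrMr// ler_pdivlMr// [c * x]mulrC.
  rewrite lebesgue_measure_ocitv ltr_pM2r ?invr_gt0//.
  case: ifP => _; last by rewrite mule0.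
  rewrite -EFinM; congr EFin; field; exact: lt0r_neq0.
rewrite ge0_integral_mscale//; congr (_ * _)%E.
by rewrite ge0_integral_pushforward// preimage_setT.
Qed.

End lebesgue_affine.

Section gamma_beta.
Context {R : realType}.
Local Notation mu := (@lebesgue_measure R).

(* Extending [x `^ (a - 1)] by 0 lets the Beta integral be a convolution over
   the whole line. *)
Definition pospow (a x : R) : R := if 0 < x then x `^ (a - 1) else 0.

Lemma pospow_ge0 a x : 0 <= pospow a x.
Proof. by rewrite /pospow; case: ifP => // _; exact: powR_ge0. Qed.

Lemma measurable_pospow a : measurable_fun setT (pospow a).
Proof.
rewrite (_ : pospow a = (fun x => x `^ (a - 1)) \_ `]0, +oo[).
  by apply/(measurable_restrictT _ _).1 => //; exact: measurable_funTS.
apply/funext => x; rewrite /pospow patchE; case: ifPn => x0.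
  by rewrite mem_set//= in_itv/= x0.
by rewrite memNset//= in_itv/= andbT; exact/negP.
Qed.

Lemma measurable_epospow a : measurable_fun setT (fun x : R => (pospow a x)%:E).
Proof. by apply/measurable_EFinP; exact: measurable_pospow. Qed.

Lemma pospowM a x c : 0 < c -> pospow a (c * x) = c `^ (a - 1) * pospow a x.
Proof.
move=> c0; rewrite /pospow pmulr_rgt0//; case: ifPn => x0; last by rewrite mulr0.
by rewrite powRM// ltW.
Qed.

Definition egamma (a : R) : \bar R := \int[mu]_x (pospow a x * expR (- x))%:E.
Definition ebeta (s t : R) : \bar R :=
  \int[mu]_x (pospow s x * pospow t (1 - x))%:E.

Lemma egamma_ge0 a : (0 <= egamma a)%E.
Proof.
by apply: integral_ge0 => x _; rewrite lee_fin mulr_ge0 ?pospow_ge0 ?expR_ge0.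
Qed.

Lemma ebeta_ge0 s t : (0 <= ebeta s t)%E.
Proof.
by apply: integral_ge0 => x _; rewrite lee_fin mulr_ge0 ?pospow_ge0.
Qed.

(** For [0 < w], substituting [w * x] for [x] extracts [w] from the measure and [w ^ (s - 1)],
    [w ^ (t - 1)] from the powers. For [w <= 0] the two factors are never positive together. *)
Lemma pospow_convolution s t w :
  (\int[mu]_x (pospow s x * pospow t (w - x))%:E
   = (pospow (s + t) w)%:E * ebeta s t)%E.
Proof.
have [w0|w0] := ltP 0 w; last first.
  rewrite [X in (_ = X%:E * _)%E](_ : _ = 0) ?mul0e; last first.
    by rewrite /pospow ltNge w0.
  apply: integral0_eq => x _; congr EFin; rewrite /pospow subr_gt0.
  case: ltP => x0; last by rewrite mul0r.
  by rewrite ltNge (le_trans w0 (ltW x0))/= mulr0.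
have mst : measurable_fun setT (fun x => (pospow s x * pospow t (w - x))%:E).
  apply/measurable_EFinP/measurable_funM; first exact: measurable_pospow.
  by apply: measurableT_comp; [exact: measurable_pospow|exact: measurable_funB].
have st0 x : (0 <= (pospow s x * pospow t (w - x))%:E)%E.
  by rewrite lee_fin mulr_ge0 ?pospow_ge0.
rewrite (ge0_integral_scale w0 mst st0).
under eq_integral => x _.
  rewrite pospowM// (_ : w - w * x = w * (1 - x)); last by ring.
  rewrite pospowM// mulrACA EFinM; over.
rewrite ge0_integralZl//; last 3 first.
- apply/measurable_EFinP/measurable_funM; first exact: measurable_pospow.
  by apply: measurableT_comp; [exact: measurable_pospow|exact: measurable_funB].
- by move=> x _; rewrite lee_fin mulr_ge0 ?pospow_ge0.
- by rewrite lee_fin mulr_ge0 ?powR_ge0.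
rewrite muleA -EFinM; congr (_%:E * _)%E.
rewrite /pospow w0 mulrA.
rewrite -[X in X * _ * _](@powRr1 _ w) ?(ltW w0)//.
have wn0 (p q : R) : (p + q == 0) ==> (w != 0) by rewrite (gt_eqF w0) implybT.
by rewrite -!powRD ?wn0//; congr (_ `^ _); ring.
Qed.

(** Substituting [w = x + y] and exchanging the integrals by Tonelli leaves a convolution inside.
    Extended reals spare any integrability condition; finiteness of [ebeta] is read off
    afterwards. *)
Lemma egammaM s t : (egamma s * egamma t = egamma (s + t) * ebeta s t)%E.
Proof.
pose f (z : R * R) : \bar R := (pospow s z.1 * pospow t (z.2 - z.1) * expR (- z.2))%:E.
have mf : measurable_fun setT f.
  apply/measurable_EFinP/measurable_funM; last first.
    by apply: measurableT_comp => //; exact: measurableT_comp.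
  apply: measurable_funM.
    by apply: measurableT_comp => //; exact: measurable_pospow.
  apply: measurableT_comp; first exact: measurable_pospow.
  exact: measurable_funB.
have f0 z : (0 <= f z)%E.
  by rewrite lee_fin !mulr_ge0 ?pospow_ge0 ?expR_ge0.
have mg a : measurable_fun setT (fun x : R => (pospow a x * expR (- x))%:E).
  apply/measurable_EFinP/measurable_funM; first exact: measurable_pospow.
  exact: measurableT_comp.
have g0 a (x : R) : (0 <= (pospow a x * expR (- x))%:E)%E.
  by rewrite lee_fin !mulr_ge0 ?pospow_ge0 ?expR_ge0.
transitivity (\int[mu]_x \int[mu]_w f (x, w))%E.
  rewrite /egamma -ge0_integralZr//; [|exact: mg|exact: integral_ge0].
  apply: eq_integral => x _; rewrite -ge0_integralZl//; last exact: mg.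
  rewrite -(ge0_integral_shift (- x) (f := fun y =>
    (pospow s x * expR (- x))%:E * (pospow t y * expR (- y))%:E)%E)//.
  - apply: eq_integral => w _; rewrite /f/= -EFinM; congr EFin.
    rewrite mulrACA -expRD; congr (_ * expR _); ring.
  - apply: emeasurable_funM => //; exact: mg.
  - by move=> y; rewrite mule_ge0.
transitivity (\int[mu]_w \int[mu]_x f (x, w))%E.
  exact: (@fubini_tonelli _ _ _ _ R mu mu f mf f0).
rewrite /egamma -ge0_integralZr//;
  [|exact: mg|exact: ebeta_ge0].
apply: eq_integral => w _.
rewrite /f/=; under eq_integral do rewrite EFinM.
rewrite ge0_integralZr//; last 2 first.
- apply/measurable_EFinP/measurable_funM; first exact: measurable_pospow.
  by apply: measurableT_comp; [exact: measurable_pospow|exact: measurable_funB].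
- by move=> x _; rewrite lee_fin mulr_ge0 ?pospow_ge0.
by rewrite pospow_convolution EFinM muleAC.
Qed.

(** The integrand may blow up at 0, so the interval is exhausted from the right; the antiderivative
    [x ^ a / a] bounds every piece by [a^-1]. *)
Lemma pospow_integral01_lty (a : R) : 0 < a ->
  (\int[mu]_(x in `]0%R, 1%R]) (pospow a x)%:E < +oo)%E.
Proof.
move=> a0.
pose F (n : nat) : set R := `[(n.+1%:R)^-1, 1]%classic.
have FU : \bigcup_n F n = `]0, 1]%classic.
  apply/seteqP; split => [x [n _]|x]; rewrite /F/= ?in_itv/=.
    by move=> /andP[nx ->]; rewrite andbT (lt_le_trans _ nx)// invr_gt0.
  move=> /andP[x0 x1].
  exists (Num.truncn x^-1) => //=; rewrite in_itv/= x1 andbT.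
  by rewrite invf_ple ?posrE// ltW// truncnS_gt.
have : (\int[mu]_(x in F n) (pospow a x)%:E @[n --> \oo] -->
        \int[mu]_(x in `]0%R, 1%R]) (pospow a x)%:E)%E.
  rewrite -FU; apply: ge0_nondecreasing_set_cvg_integral => //.
  - move=> m n mn; apply/subsetPset => x; rewrite /F /= !in_itv/=.
    move=> /andP[mx ->]; rewrite andbT (le_trans _ mx)//.
    by rewrite lef_pV2 ?posrE// ler_nat.
  - by move=> n; exact: measurable_itv.
  - by move=> n; apply: measurable_funTS; exact: measurable_epospow.
  - by move=> n x _; rewrite lee_fin pospow_ge0.
move=> cvgF; apply: (@le_lt_trans _ _ (a^-1)%:E); last exact: ltry.
apply: (cvge_le _ cvgF); apply: nearW => n.
(* [F 0] is the single point 1, a degenerate interval for the fundamental theorem of calculus. *)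
case: n => [|n].
  rewrite /F invr1 set_itv1 integral_set1 lee_fin invr_ge0; exact: ltW.
have n1 : (n.+2%:R)^-1 < 1 :> R by rewrite invf_lt1// ltr1n.
have n0 (x : R) : (n.+2%:R)^-1 <= x -> 0 < x :> R.
  by move=> /(lt_le_trans _); apply; rewrite invr_gt0.
have -> : (\int[mu]_(x in F n.+1) (pospow a x)%:E =
           \int[mu]_(x in F n.+1) (x `^ (a - 1))%:E)%E.
  apply: eq_integral => x; rewrite inE /F/= in_itv/= => /andP[/n0 x0 _].
  by rewrite /pospow x0.
have dF (x : R) : 0 < x -> is_derive x 1 (fun x : R => x `^ a / a) (x `^ (a - 1)).
  move=> x0.
  have -> : x `^ (a - 1) = (a * x `^ (a - 1)) / a.
    by rewrite mulrAC divff ?mul1r// gt_eqF.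
  rewrite (_ : (fun x : R => x `^ a / a) = (a^-1 \*: (fun x : R => x `^ a))); last first.
    by apply/funext => y /=; rewrite /GRing.scale/= mulrC.
  rewrite mulrC.
  apply: is_deriveZ; exact: is_derive1_powR.
have cF (p x : R) : 0 < x -> {for x, continuous (fun y : R => y `^ p)}.
  move=> x0; apply: differentiable_continuous; apply/derivable1_diffP.
  by apply: derivable_powR; rewrite in_itv/= x0.
rewrite (@continuous_FTC2 _ _ (fun x => x `^ a / a))//; last 3 first.
- apply: continuous_in_subspaceT => x; rewrite inE/= in_itv/= => /andP[/n0 x0 _].
  exact: cF.
- have cFa (x : R) : 0 < x -> {for x, continuous (fun x : R => x `^ a / a)}.
    move=> x0; apply: cvgM; [exact: cF|exact: cvg_cst].
  split.
  + by move=> x; rewrite in_itv/= => /andP[/ltW/n0 /dF[]].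
  + by apply: cvg_at_right_filter; apply: cFa; exact: n0.
  + by apply: cvg_at_left_filter; apply: cFa.
- move=> x; rewrite in_itv/= => /andP[/ltW/n0 x0 _].
  by rewrite derive1E; have [] := dF x x0.
rewrite -EFinB lee_fin powR1 div1r lerBlDr lerDl.
by rewrite divr_ge0 ?powR_ge0// ltW.
Qed.

(** Half of the exponent is spent on the power, through one term of the series of [expR (2^-1 * x)];
    the other half remains integrable. *)
Lemma pospow_le_exp (a : R) : exists2 C : R, 0 <= C &
  forall x, 1 <= x -> pospow a x * expR (- x) <= C * expR (- (2^-1 * x)).
Proof.
pose N := Num.truncn (a - 1).
exists (N.+1`!%:R * 2 ^+ N.+1); first by rewrite mulr_ge0 ?exprn_ge0.
move=> x x1.
have x0 : 0 < x by exact: lt_le_trans x1.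
have -> : expR (- x) = expR (- (2^-1 * x)) * expR (- (2^-1 * x)).
  by rewrite -expRD; congr expR; field.
rewrite mulrA ler_wpM2r ?expR_ge0// expRN ler_pdivrMr ?expR_gt0//.
have : pospow a x <= x ^+ N.+1.
  rewrite /pospow x0 -powR_mulrn ?(ltW x0)// ler_powR//.
  exact/ltW/truncnS_gt.
move=> /le_trans; apply.
have := @expR_ge1Dxn R (2^-1 * x) N.
have -> : (2^-1 * x) ^+ N.+1 / N.+1`!%:R = x ^+ N.+1 / (N.+1`!%:R * 2 ^+ N.+1).
  by rewrite exprMn exprVn invfM; ring.
move=> /(_ _)/(le_trans _) h.
rewrite mulrC -ler_pdivrMr ?mulr_gt0 ?exprn_gt0// ?ltr0n ?fact_gt0//.
by apply: h; [rewrite lerDr|rewrite mulr_ge0 ?invr_ge0// ltW].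
Qed.

Lemma egamma_lty (a : R) : 0 < a -> (egamma a < +oo)%E.
Proof.
move=> a0.
have mg : measurable_fun setT (fun x : R => (pospow a x * expR (- x))%:E).
  apply/measurable_EFinP/measurable_funM; first exact: measurable_pospow.
  exact: measurableT_comp.
have g0 (x : R) : (0 <= (pospow a x * expR (- x))%:E)%E.
  by rewrite lee_fin !mulr_ge0 ?pospow_ge0 ?expR_ge0.
have [C C0 hC] := pospow_le_exp a.
pose h1 : R -> \bar R := (fun x => (pospow a x)%:E) \_ `]0, 1].
(* The factor 2 undoes the prefactor of the exponential density of rate 1/2, whose total mass is
   known. *)
pose h2 (x : R) : \bar R := ((C * 2)%:E * (exponential_pdf 2^-1 x)%:E)%E.
have mh1 : measurable_fun setT h1.
  apply/(measurable_restrictT _ _).1 => //.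
  by apply: measurable_funTS; exact: measurable_epospow.
have mh2 : measurable_fun setT h2.
  by apply/emeasurable_funM => //; apply/measurable_EFinP; exact: measurable_exponential_pdf.
have h10 x : (0 <= h1 x)%E by apply: erestrict_ge0 => y _; rewrite lee_fin pospow_ge0.
have h20 x : (0 <= h2 x)%E.
  by rewrite /h2 -EFinM lee_fin !mulr_ge0 ?exponential_pdf_ge0 ?invr_ge0.
apply: (@le_lt_trans _ _ (\int[mu]_x (h1 x + h2 x))%E).
  rewrite /egamma; apply: ge0_le_integral => //.
    exact: emeasurable_funD.
  move=> x _; have [x0|x0] := leP x 0.
    rewrite {1}/pospow ltNge x0/= mul0r adde_ge0//.
  have [x1|x1] := leP x 1.
    rewrite -[leLHS]adde0 leeD// /h1 patchE mem_set/= ?in_itv/= ?x0//.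
    rewrite lee_fin ler_piMr ?pospow_ge0// -expR0 ler_expR lerNl oppr0; exact: ltW.
  rewrite -[leLHS]add0e leeD// /h2 -EFinM lee_fin (le_trans (hC _ (ltW x1)))//.
  rewrite exponential_pdfE ?(ltW x0)// mulNr.
  by rewrite mulrA mulfK.
rewrite ge0_integralD//.
rewrite lte_add_pinfty//.
  rewrite /h1 -integral_mkcond.
  exact: pospow_integral01_lty.
rewrite /h2 ge0_integralZl//.
- rewrite integral_exponential_pdf ?invr_gt0// mule1; exact: ltry.
- by apply/measurable_EFinP; exact: measurable_exponential_pdf.
- by move=> x _; rewrite lee_fin exponential_pdf_ge0 ?invr_ge0.
- by rewrite lee_fin mulr_ge0.
Qed.

Lemma egamma_gt0 (a : R) : (0 < egamma a)%E.
Proof.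
have mg : measurable_fun setT (fun x : R => (pospow a x * expR (- x))%:E).
  apply/measurable_EFinP/measurable_funM; first exact: measurable_pospow.
  exact: measurableT_comp.
have g0 (x : R) : (0 <= (pospow a x * expR (- x))%:E)%E.
  by rewrite lee_fin !mulr_ge0 ?pospow_ge0 ?expR_ge0.
(* On [[1, 2]] the power is monotone, in a direction given by the sign of [a - 1], so its least
   value is taken at an endpoint. *)
pose c : R := Num.min 1 (2 `^ (a - 1)) * expR (- 2).
have c0 : 0 < c by rewrite mulr_gt0 ?expR_gt0// lt_min ltr01 powR_gt0.
apply: (@lt_le_trans _ _ (\int[mu]_(x in `[1%R, 2%R]) c%:E)%E).
  rewrite integral_cst//.
  rewrite [X in (_ * X)%E]lebesgue_measure_itv/= lte_fin ltr1n -EFinB.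
  by rewrite -EFinM lte_fin mulr_gt0// subr_gt0 ltr1n.
apply: (@le_trans _ _ (\int[mu]_(x in `[1%R, 2%R]) (pospow a x * expR (- x))%:E)%E).
  apply: ge0_le_integral => //.
  - by move=> x _; rewrite lee_fin ltW.
  - by apply: measurable_funTS; exact: mg.
  - move=> x /=; rewrite in_itv/= => /andP[x1 x2].
    have x0 : 0 < x by exact: lt_le_trans x1.
    rewrite lee_fin ler_pM ?expR_ge0//.
    + rewrite /pospow x0 ge_min; apply/orP.
      have [a1|a1] := leP 1 a.
        left; have := @ler_powR R x x1 0 (a - 1); rewrite powRr0; apply.
        by rewrite subr_ge0.
      have e (z : R) : z `^ (a - 1) = (z `^ (1 - a))^-1.
        by rewrite -powRN opprB.
      right; rewrite !e lef_pV2 ?posrE ?powR_gt0//.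
      by rewrite ge0_ler_powR ?nnegrE ?ler0n ?(ltW x0)// subr_ge0 ltW.
    + by rewrite ler_expR lerN2.
by apply: ge0_subset_integral => //; exact: measurable_itv.
Qed.

Lemma GammaE (a : R) : Gamma a = fine (egamma a).
Proof.
rewrite /Gamma /Rintegral integral_mkcond /egamma; congr fine.
apply: eq_integral => x _; rewrite patchE /pospow.
case: ifPn => [|/negP]; rewrite inE/= in_itv/= andbT.
  by move=> ->.
by case: ltP => // _ _; rewrite mul0r.
Qed.

Lemma Gamma_gt0 (a : R) : 0 < a -> 0 < Gamma a.
Proof. by move=> a0; rewrite GammaE fine_gt0// egamma_gt0 egamma_lty. Qed.

Lemma EFin_Gamma (a : R) : 0 < a -> (Gamma a)%:E = egamma a.
Proof.
by move=> a0; rewrite GammaE fineK// ge0_fin_numE ?egamma_ge0 ?egamma_lty.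
Qed.

(** Since all three Gamma values are positive and finite, [egammaM] excludes an infinite Beta
    integral and determines the finite one. *)
Lemma ebetaE (s t : R) : 0 < s -> 0 < t -> ebeta s t = (Beta s t)%:E.
Proof.
move=> s0 t0; have st0 : 0 < s + t by exact: addr_gt0.
have := egammaM s t; rewrite -!EFin_Gamma// -EFinM.
have := ebeta_ge0 s t; case: (ebeta s t) => [b _|_|//].
- rewrite -EFinM => -[h]; congr EFin; rewrite /Beta h mulrAC divff ?mul1r//.
  by rewrite gt_eqF// Gamma_gt0.
- by rewrite gt0_muley// lte_fin Gamma_gt0.
Qed.

Lemma Beta_gt0 (s t : R) : 0 < s -> 0 < t -> 0 < Beta s t.
Proof.
by move=> s0 t0; rewrite /Beta divr_gt0 ?mulr_gt0 ?Gamma_gt0 ?addr_gt0.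
Qed.

End gamma_beta.

(** * The jump generator *)

Section jump_kernel.
Context {R : realType}.
Variables (s t : R).
Hypotheses (s0 : 0 < s) (t0 : 0 < t).
Local Notation mu := (@lebesgue_measure R).
Local Notation mu2 := (mu \x mu)%E.

Definition beta_density (u : R) : R := pospow s u * pospow t (1 - u) / Beta s t.

Definition split_density (z : R * R) : R := beta_density z.1 * beta_density z.2.

(** The density vanishes outside this open set, so bounds and limits of integrands are asked for
    here only. *)
Definition unit_square (z : R * R) : Prop := 0 < z.1 < 1 /\ 0 < z.2 < 1.

Lemma beta_density_ge0 u : 0 <= beta_density u.
Proof.
by apply: divr_ge0; [rewrite mulr_ge0 ?pospow_ge0|rewrite ltW ?Beta_gt0].
Qed.

Lemma beta_density_out u : ~~ (0 < u < 1) -> beta_density u = 0.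
Proof.
rewrite /beta_density /pospow subr_gt0.
by case: ltP => // _; case: ltP => //= _; rewrite ?(mul0r, mulr0).
Qed.

Lemma measurable_beta_density : measurable_fun setT beta_density.
Proof.
apply: measurable_funM => //; apply: measurable_funM; first exact: measurable_pospow.
by apply: measurableT_comp; [exact: measurable_pospow|exact: measurable_funB].
Qed.

Lemma split_density_ge0 z : 0 <= split_density z.
Proof. by rewrite mulr_ge0 ?beta_density_ge0. Qed.

Lemma split_density_out z : ~ unit_square z -> split_density z = 0.
Proof.
rewrite /unit_square /split_density => zout.
have [z1|z1] := boolP (0 < z.1 < 1); last by rewrite beta_density_out// mul0r.
have [z2|z2] := boolP (0 < z.2 < 1); last by rewrite [X in _ * X]beta_density_out// mulr0.
by case: zout.
Qed.

Lemma measurable_split_density : measurable_fun setT split_density.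
Proof.
by apply: measurable_funM; apply: measurableT_comp => //; exact: measurable_beta_density.
Qed.

Lemma ge0_integral_beta_prod (f g : R -> R) :
  measurable_fun setT f -> measurable_fun setT g ->
  (forall x, 0 <= f x) -> (forall x, 0 <= g x) ->
  (\int[mu2]_z (f z.1 * g z.2)%:E =
   (\int[mu]_x (f x)%:E) * \int[mu]_x (g x)%:E)%E.
Proof.
move=> mf mg f0 g0.
have mfg : measurable_fun setT (fun z : R * R => (f z.1 * g z.2)%:E).
  by apply/measurable_EFinP/measurable_funM; exact: measurableT_comp.
have fg0 (z : R * R) : (0 <= (f z.1 * g z.2)%:E)%E by rewrite lee_fin mulr_ge0.
have mf' : measurable_fun setT (fun x => (f x)%:E) by apply/measurable_EFinP.
have mg' : measurable_fun setT (fun x => (g x)%:E) by apply/measurable_EFinP.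
transitivity (\int[mu]_x \int[mu]_y (f x * g y)%:E)%E.
  exact: (@fubini_tonelli1 _ _ _ _ R mu mu _ mfg fg0).
rewrite -ge0_integralZr//; last 2 first.
- by move=> x _; rewrite lee_fin.
- by apply: integral_ge0 => x _; rewrite lee_fin.
apply: eq_integral => x _.
rewrite -ge0_integralZl// ?lee_fin//; move=> y _; by rewrite lee_fin.
Qed.

Lemma integral_beta_density : (\int[mu]_u (beta_density u)%:E = 1)%E.
Proof.
rewrite /beta_density.
have mst : measurable_fun setT (fun x : R => (pospow s x * pospow t (1 - x))%:E).
  apply/measurable_EFinP/measurable_funM; first exact: measurable_pospow.
  by apply: measurableT_comp; [exact: measurable_pospow|exact: measurable_funB].
under eq_integral do rewrite EFinM.
rewrite ge0_integralZr//; last 2 first.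
- by move=> x _; rewrite lee_fin mulr_ge0 ?pospow_ge0.
- by rewrite lee_fin invr_ge0 ltW// Beta_gt0.
rewrite -/(ebeta s t) ebetaE// -EFinM mulfV// gt_eqF// Beta_gt0//.
Qed.

Lemma integral_split_density : (\int[mu2]_z (split_density z)%:E = 1)%E.
Proof.
rewrite ge0_integral_beta_prod; [|exact: measurable_beta_density..
  |exact: beta_density_ge0|exact: beta_density_ge0].
by rewrite integral_beta_density mule1.
Qed.

(* Expectation over two independent Beta(s, t) fractions. *)
Definition split_mean (f : R * R -> R) : R :=
  \int[mu2]_z (f z * split_density z).

Lemma integrable_split_density : mu2.-integrable setT (EFin \o split_density).
Proof.
apply/integrableP; split.
  by apply/measurable_EFinP; exact: measurable_split_density.
under eq_integral do rewrite gee0_abs ?lee_fin ?split_density_ge0//.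
by rewrite integral_split_density ltry.
Qed.

Lemma integrable_split (f : R * R -> R) (M : R) : measurable_fun setT f ->
  (forall z, unit_square z -> `|f z| <= M) ->
  mu2.-integrable setT (EFin \o (fun z => f z * split_density z)).
Proof.
move=> mf fM.
have := @integrableZl _ _ _ mu2 setT measurableT M _ integrable_split_density.
apply: le_integrable => //.
  by apply/measurable_EFinP/measurable_funM => //; exact: measurable_split_density.
move=> z _ /=; rewrite lee_fin (normrM (f z)) (normrM M).
have [/fM fzM|/split_density_out->] := pselect (unit_square z);
  last by rewrite normr0 !mulr0.
by rewrite ler_wpM2r// (le_trans fzM)// ler_norm.
Qed.

Lemma split_mean_cst (c : R) : split_mean (fun=> c) = c.
Proof.
rewrite /split_mean RintegralZl//; last exact: integrable_split_density.
by rewrite /Rintegral integral_split_density mulr1.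
Qed.

Lemma split_meanB (f g : R * R -> R) (M : R) :
  measurable_fun setT f -> measurable_fun setT g ->
  (forall z, unit_square z -> `|f z| <= M) ->
  (forall z, unit_square z -> `|g z| <= M) ->
  split_mean (fun z => f z - g z) = split_mean f - split_mean g.
Proof.
move=> mf mg fM gM; rewrite /split_mean -RintegralB//.
- by apply: eq_Rintegral => z _; rewrite mulrBl.
- exact: integrable_split fM.
- exact: integrable_split gM.
Qed.

Lemma split_mean_le (f : R * R -> R) (M : R) : measurable_fun setT f ->
  (forall z, unit_square z -> `|f z| <= M) -> `|split_mean f| <= M.
Proof.
move=> mf fM.
have intf := integrable_split mf fM.
rewrite (le_trans (le_normr_Rintegral _ intf))//.
rewrite -[leRHS]split_mean_cst; apply: le_Rintegral => //.
- by move/integrable_norm : intf; apply.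
- by have := @integrableZl _ _ _ mu2 setT measurableT M _ integrable_split_density.
- move=> z _ /=; rewrite (normrM (f z)) (ger0_norm (split_density_ge0 z)).
  have [/fM fzM|/split_density_out->] := pselect (unit_square z); last by rewrite !mulr0.
  by rewrite ler_wpM2r ?split_density_ge0.
Qed.

Lemma cvg_split_mean (f_ : nat -> R * R -> R) (f : R * R -> R) (M : R) :
  (forall n, measurable_fun setT (f_ n)) -> measurable_fun setT f ->
  (forall n z, unit_square z -> `|f_ n z| <= M) ->
  (forall z, unit_square z -> f_ n z @[n --> \oo] --> f z) ->
  split_mean (f_ n) @[n --> \oo] --> split_mean f.
Proof.
move=> mf_ mf fM ff.
have ifn n := integrable_split (mf_ n) (fM n).
have mw (g : R * R -> R) : measurable_fun setT g ->
    measurable_fun setT (fun z : R * R => (g z * split_density z)%:E).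
  by move=> mg; apply/measurable_EFinP/measurable_funM => //; exact: measurable_split_density.
have [|||||ifl _ cvgf] := @dominated_convergence _ _ _ mu2 setT measurableT
  (fun n z => (f_ n z * split_density z)%:E) (fun z => (f z * split_density z)%:E)
  (fun z => (M * split_density z)%:E).
- by move=> n; exact: mw.
- exact: mw.
- apply: aeW => z _; apply: cvg_EFin; first by apply: nearW.
  have [/ff fz|/split_density_out zout] := pselect (unit_square z).
    exact: (cvgM fz (cvg_cst _)).
  under eq_fun do rewrite /= zout mulr0.
  by rewrite zout mulr0; exact: cvg_cst.
- exact: (@integrableZl _ _ _ mu2 setT measurableT M _ integrable_split_density).
- apply: aeW => z n _ /=.
  rewrite lee_fin (normrM (f_ n z)) (ger0_norm (split_density_ge0 z)).
  have [/fM fzM|/split_density_out->] := pselect (unit_square z); last by rewrite !mulr0.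
  by rewrite ler_wpM2r ?split_density_ge0.
apply: fine_cvg; rewrite fineK//; exact: integrable_fin_num.
Qed.

Definition split_map (p z : R * R) : R * R :=
  (p.1 * (1 - z.1) + p.2 * z.2, p.2 * (1 - z.2) + p.1 * z.1).

Lemma measurable_split_map :
  measurable_fun setT (fun q : (R * R) * (R * R) => split_map q.1 q.2).
Proof.
apply/measurable_fun_pairP; split => /=.
  by apply: measurable_funD; apply: measurable_funM;
    do ?[apply: measurable_funB => //]; do 2 apply: measurableT_comp => //.
by apply: measurable_funD; apply: measurable_funM;
  do ?[apply: measurable_funB => //]; do 2 apply: measurableT_comp => //.
Qed.

Lemma phi_split_density (u v : R) : 0 < u < 1 -> 0 < v < 1 ->
  phi s t u v = split_density (u, v).
Proof.
move=> /andP[u0 u1] /andP[v0 v1].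
rewrite /phi /split_density /beta_density /pospow/= !subr_gt0 u0 u1 v0 v1.
by rewrite expr2 invfM; ring.
Qed.

(** The endpoints are negligible but must be treated apart: [phi] and [split_density] can differ
    there, as 0 to the power 0 is 1 whereas [pospow] vanishes at 0. *)
Lemma integral_itv01_eq (G H : R -> \bar R) : measurable_fun setT H ->
  (forall u, 0 < u < 1 -> G u = H u) -> (forall u, ~~ (0 < u < 1) -> H u = 0%E) ->
  (\int[mu]_(u in `[0%R, 1%R]) G u = \int[mu]_u H u)%E.
Proof.
move=> mH GH H0.
have mG : measurable_fun (`]0%R, 1%R[%classic : set R) G.
  apply: (@eq_measurable_fun _ _ _ _ _ H); last exact: measurable_funTS.
  by move=> u; rewrite inE/= in_itv/= => /GH.
rewrite integral_itv_bndoo//.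
rewrite [RHS](_ : _ = (\int[mu]_u (H \_ `]0%R, 1%R[) u)%E); last first.
  apply: eq_integral => u _; rewrite patchE; case: ifPn => // /negP.
  by rewrite inE/= in_itv/= => /negP /H0.
rewrite -integral_mkcond; apply: eq_integral => u.
by rewrite inE/= in_itv/= => /GH.
Qed.

Lemma measurable_split_comp (f : R * R -> R) (p : R * R) :
  measurable_fun setT f ->
  measurable_fun setT (fun z : R * R => f (split_map p z) - f p).
Proof.
move=> mf; apply: measurable_funB => //; apply: measurableT_comp => //.
exact: (measurableT_comp measurable_split_map (pair1_measurable p)).
Qed.

(** Fubini for a bounded function against a product density. *)
Lemma jump_genE (f : R * R -> R) (M : R) (p : R * R) : measurable_fun setT f ->
  (forall q, `|f q| <= M) ->
  jump_gen s t f p = split_mean (fun z => f (split_map p z) - f p).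
Proof.
move=> mf fM.
set F := fun z => f (split_map p z) - f p.
have mF : measurable_fun setT F by exact: measurable_split_comp.
pose FW (z : R * R) : \bar R := (F z * split_density z)%:E.
have mFW : measurable_fun setT FW.
  by apply/measurable_EFinP/measurable_funM => //; exact: measurable_split_density.
have iFW : mu2.-integrable setT FW.
  apply: (@integrable_split F (M + M)) => // z _.
  by rewrite (le_trans (ler_normB _ _))// lerD.
have inner (v : R) : 0 < v < 1 ->
   \int[mu]_(u in `[0, 1]) (F (u, v) * phi s t u v) = fine (\int[mu]_u FW (u, v))%E.
  move=> v01; congr fine; apply: integral_itv01_eq.
  - exact: (measurableT_comp mFW (pair2_measurable v)).
  - by move=> u u01; rewrite /FW phi_split_density.
  - by move=> u u01; rewrite /FW split_density_out ?mulr0// => -[/= uu]; rewrite uu in u01.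
have ibd : mu.-integrable setT (EFin \o beta_density).
  apply/integrableP; split.
    by apply/measurable_EFinP; exact: measurable_beta_density.
  under eq_integral do rewrite gee0_abs ?lee_fin ?beta_density_ge0//.
  by rewrite integral_beta_density ltry.
(* The real-valued inner integral applies [fine] before the outer integration; it loses nothing only
   because every section is integrable, not merely almost every one. *)
have fFG (v : R) : (\int[mu]_u FW (u, v))%E \is a fin_num.
  apply: integrable_fin_num => //.
  have := @integrableZl _ _ _ mu setT measurableT ((M + M) * beta_density v) _ ibd.
  apply: le_integrable => //.
    exact: (measurableT_comp mFW (pair2_measurable v)).
  move=> u _ /=; rewrite lee_fin /split_density/=.
  rewrite (normrM (F (u, v))) (normrM _ (beta_density v)).
  rewrite (normrM _ (beta_density u)) (normrM _ (beta_density v)).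
  rewrite mulrA mulrAC ler_wpM2r// ler_wpM2r//.
  rewrite (le_trans _ (ler_norm _))// (le_trans (ler_normB _ _))// lerD//.
rewrite /split_mean /Rintegral -(@integral21_prod_meas1 _ _ _ _ R mu mu FW iFW).
have mFG : measurable_fun setT (fun v : R => \int[mu]_u FW (u, v))%E.
  exact: (@measurable_fubini_G _ _ _ _ R mu mu FW iFW).
transitivity (fine (\int[mu]_(v in `[0%R, 1%R])
    (\int[mu]_(u in `[0, 1]) (F (u, v) * phi s t u v))%:E)%E).
  by rewrite /jump_gen /F; clear; case: p.
congr fine; apply: integral_itv01_eq => //.
- by move=> v v01; rewrite inner// fineK.
- move=> v v01; apply: integral0_eq => u _.
  by rewrite /FW split_density_out ?mulr0// => -[/= _ vv]; rewrite vv in v01.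
Qed.

Lemma measurable_jump_gen (f : R * R -> R) (M : R) : measurable_fun setT f ->
  (forall q, `|f q| <= M) -> measurable_fun setT (jump_gen s t f).
Proof.
move=> mf fM.
rewrite (_ : jump_gen s t f = (fun p => split_mean (fun z => f (split_map p z) - f p)));
  last by apply/funext => p; exact: jump_genE fM.
(* Adding [M + M] makes the integrand nonnegative, so that Tonelli gives measurability in the
   parameter; the constant is subtracted again at the end. *)
pose h (q : (R * R) * (R * R)) : \bar R :=
  ((f (split_map q.1 q.2) - f q.1 + (M + M)) * split_density q.2)%:E.
have mh : measurable_fun setT h.
  apply/measurable_EFinP/measurable_funM; last first.
    by apply: measurableT_comp => //; exact: measurable_split_density.
  apply: measurable_funD => //; apply: measurable_funB; last exact: measurableT_comp.
  by apply: measurableT_comp => //; exact: measurable_split_map.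
have h0 q : (0 <= h q)%E.
  rewrite lee_fin mulr_ge0 ?split_density_ge0// -lerBlDr sub0r.
  have : `|f (split_map q.1 q.2) - f q.1| <= M + M.
    by rewrite (le_trans (ler_normB _ _))// lerD.
  by rewrite ler_norml => /andP[].
have mF : measurable_fun setT (fun p => \int[mu2]_z h (p, z))%E.
  rewrite (_ : (fun p => _) = (fun p => \int[mu]_a \int[mu]_b h (p, (a, b)))%E); last first.
    apply/funext => p; apply: (@fubini_tonelli1 _ _ _ _ R mu mu (fun z => h (p, z))) => //.
    exact: (measurableT_comp mh (pair1_measurable p)).
  pose h' (q : ((R * R) * R) * R) := h (q.1.1, (q.1.2, q.2)).
  have mh' : measurable_fun setT h'.
    apply: measurableT_comp => //; apply: measurable_fun_pair.
      exact: (measurableT_comp measurable_fst measurable_fst).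
    apply: measurable_fun_pair => //.
    exact: (measurableT_comp measurable_snd measurable_fst).
  have mF' := @measurable_fun_fubini_tonelli_F _ _ _ _ R mu h' mh' (fun q => h0 _).
  have f0 q : (0 <= fubini_F mu h' q)%E.
    by apply: integral_ge0 => z _; exact: h0.
  exact: (@measurable_fun_fubini_tonelli_F _ _ _ _ R mu _ mF' f0).
have -> : (fun p => split_mean (fun z => f (split_map p z) - f p)) =
    (fun p => fine (\int[mu2]_z h (p, z))%E - (M + M)).
  apply/funext => p.
  have mfp := measurable_split_comp p mf.
  have fpM z : `|f (split_map p z) - f p| <= M + M.
    by rewrite (le_trans (ler_normB _ _))// lerD.
  have -> : fine (\int[mu2]_z h (p, z))%E =
      split_mean (fun z => (f (split_map p z) - f p) - (- (M + M))).
    by rewrite /split_mean /Rintegral /h/= opprK.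
  rewrite (@split_meanB (fun z => f (split_map p z) - f p) (fun=> - (M + M)) (M + M))//; last first.
    move=> z _; rewrite normrN ger0_norm// addr_ge0//;
    exact: le_trans (fM (0, 0)).
  by rewrite split_mean_cst opprK addrK.
apply: measurable_funB => //; apply: measurableT_comp => //.
Qed.

Lemma jump_gen_le (f : R * R -> R) (M : R) p : measurable_fun setT f ->
  (forall q, `|f q| <= M) -> `|jump_gen s t f p| <= 2 * M.
Proof.
move=> mf fM; rewrite (jump_genE _ mf fM); apply: split_mean_le.
  exact: measurable_split_comp.
by move=> z _; rewrite (le_trans (ler_normB _ _))// mulr2n mulrDl mul1r lerD.
Qed.

End jump_kernel.

(** * From the chain generator to the jump generator *)

Section binomial_weights.
Context {R : realType}.
Implicit Types (u : R) (n k : nat).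

Definition binw n u k : R := 'C(n, k)%:R * u ^+ k * (1 - u) ^+ (n - k).

Lemma binw_ge0 n u k : 0 <= u <= 1 -> 0 <= binw n u k.
Proof.
by move=> /andP[u0 u1]; rewrite /binw !mulr_ge0 ?exprn_ge0 ?subr_ge0.
Qed.

(** Pascal's rule: conditioning on the outcome of one of the [n.+1] trials. Moments then follow by
    induction on [n]. *)
Lemma binw_sumS n u (G : nat -> R) :
  \sum_(k < n.+2) binw n.+1 u k * G k =
  (1 - u) * (\sum_(k < n.+1) binw n u k * G k) +
  u * (\sum_(k < n.+1) binw n u k * G k.+1).
Proof.
have binwS k : (k <= n)%N ->
    binw n.+1 u k.+1 = (1 - u) * binw n u k.+1 + u * binw n u k.
  move=> kn; rewrite /binw binS natrD subSS exprS.
  move: kn; rewrite leq_eqVlt => /predU1P[->|kn].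
    by rewrite bin_small// !subnn expr0; ring.
  by rewrite -(subnSK kn) exprS; ring.
rewrite big_ord_recl [binw _ _ _](_ : _ = (1 - u) * binw n u 0); last first.
  by rewrite /binw !bin0 !subn0 expr0 exprS; ring.
have -> : \sum_(i < n.+1) binw n.+1 u (lift ord0 i) * G (lift ord0 i) =
    \sum_(i < n.+1) ((1 - u) * (binw n u i.+1 * G i.+1) +
                     u * (binw n u i * G i.+1)).
  by apply: eq_bigr => i _; rewrite lift0 binwS; [ring|rewrite -ltnS].
rewrite big_split/= -!mulr_sumr addrA; congr (_ + _).
rewrite -mulrA -mulrDr; congr (_ * _).
transitivity (\sum_(k < n.+2) binw n u k * G k).
  by rewrite [RHS]big_ord_recl.
by rewrite big_ord_recr/= [X in _ + X * _](_ : _ = 0) ?mul0r ?addr0// /binw bin_small// !mul0r.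
Qed.

Lemma binw_sum1 n u : \sum_(k < n.+1) binw n u k = 1.
Proof.
elim: n => [|n IH].
  by rewrite big_ord_recl big_ord0 /binw bin0 subnn !expr0 !mulr1 addr0.
have := binw_sumS n u (fun=> 1); rewrite -!mulr_suml !mulr1 => ->.
by rewrite IH; ring.
Qed.

(** The centre [c] is arbitrary because a success in the conditioned trial moves it to [c - 1] in
    the induction. *)
Lemma binw_variance n u (c : R) :
  \sum_(k < n.+1) binw n u k * (k%:R - c) ^+ 2 =
  (n%:R * u - c) ^+ 2 + n%:R * u * (1 - u).
Proof.
elim: n c => [|n IH] c.
  by rewrite big_ord1 /binw/= bin0 subnn !expr0; ring.
rewrite (binw_sumS n u (fun k => (k%:R - c) ^+ 2)) IH.
have -> : \sum_(k < n.+1) binw n u k * (k.+1%:R - c) ^+ 2 =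
    \sum_(k < n.+1) binw n u k * (k%:R - (c - 1)) ^+ 2.
  by apply: eq_bigr => k _; congr (_ * _ ^+ 2); rewrite -[k.+1]addn1 natrD; ring.
by rewrite IH -[n.+1]addn1 natrD; ring.
Qed.

Lemma measurable_binw n k : measurable_fun setT (fun u => binw n u k).
Proof.
rewrite /binw; apply: measurable_funM; first exact: measurable_funM.
by apply: measurable_funX; exact: measurable_funB.
Qed.

Lemma binw_le1 n u k : (k <= n)%N -> 0 <= u <= 1 -> binw n u k <= 1.
Proof.
move=> kn u01; rewrite -(binw_sum1 n u) (bigD1 (Ordinal (kn : k < n.+1)%N))//= lerDl.
by apply: sumr_ge0 => i _; exact: binw_ge0.
Qed.

End binomial_weights.

(** * The chain as a Beta mixture of binomial splittings *)

Section chain_kernel.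
Context {R : realType}.
Variables (s t : R).
Hypotheses (s0 : 0 < s) (t0 : 0 < t).
Local Notation mu := (@lebesgue_measure R).
Local Notation mu2 := (mu \x mu)%E.
Local Notation bdens := (beta_density s t).
Local Notation smean := (split_mean s t).

Lemma pospow_expr (a : R) (k : nat) (u : R) :
  u ^+ k * pospow a u = pospow (k%:R + a) u.
Proof.
rewrite /pospow; case: ltP => u0; last by rewrite mulr0.
rewrite -powR_mulrn ?(ltW u0)// -powRD ?(gt_eqF u0) ?implybT//.
by rewrite addrA.
Qed.

(** Beta-binomial conjugacy: the binomial weight shifts the parameters [s], [t] of the Beta
    integrand by [k] and [n - k]. *)
Lemma integral_binw n k : (k <= n)%N ->
  (\int[mu]_u (binw n u k * bdens u)%:E =
   ('C(n, k)%:R * Beta (k%:R + s) ((n - k)%:R + t) / Beta s t)%:E)%E.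
Proof.
move=> kn.
rewrite mulrAC EFinM -ebetaE ?ltr_wpDl//.
rewrite -ge0_integralZl//; first last.
- by rewrite lee_fin divr_ge0// ltW// Beta_gt0.
- by move=> x _; rewrite lee_fin mulr_ge0 ?pospow_ge0.
- apply/measurable_EFinP/measurable_funM; first exact: measurable_pospow.
  by apply: measurableT_comp; [exact: measurable_pospow|exact: measurable_funB].
apply: eq_integral => u _; rewrite -EFinM -!pospow_expr /binw /beta_density.
by congr EFin; ring.
Qed.

(** The rate is a product of one factor in [n], [k] and one in [m], [l]. The variables stand for
    factorials and Gamma values, in the order in which [rate] lists them. *)
Lemma rate_factor (N M B g1 g2 g3 g4 h1 h2 a b c d : R) :
  N * M / B ^+ 2 * (g1 * g2 * g3 * g4 / (h1 * h2 * a * b * c * d)) =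
  N / (b * a) * (g1 * g3 / h1) / B * (M / (d * c) * (g4 * g2 / h2) / B).
Proof. rewrite expr2 !invfM; ring. Qed.

(* The rate is a Beta-mixture of binomial splittings; this is what couples the
   two models. *)
Lemma rateE n m k l : (k <= n)%N -> (l <= m)%N ->
  rate s t n m k l = smean (fun z => binw n z.1 k * binw m z.2 l).
Proof.
move=> kn lm.
pose P n k (u : R) := binw n u k * bdens u.
have P0 n' k' u : 0 <= P n' k' u.
  rewrite /P; have [/andP[u0 u1]|/beta_density_out->] := boolP (0 < u < 1); last by rewrite mulr0.
  by rewrite mulr_ge0 ?beta_density_ge0// binw_ge0// !ltW.
have mP n' k' : measurable_fun setT (P n' k').
  by apply: measurable_funM; [exact: measurable_binw|exact: measurable_beta_density].
have -> : smean (fun z => binw n z.1 k * binw m z.2 l) =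
    fine (\int[mu2]_z (P n k z.1 * P m l z.2)%:E)%E.
  congr fine; apply: eq_integral => z _; congr EFin; rewrite /P /split_density; ring.
rewrite ge0_integral_beta_prod// /P !integral_binw//= /rate.
have e (n' k' : nat) : (k' <= n')%N -> k'%:R + s + ((n' - k')%:R + t) = s + t + n'%:R :> R.
  by move=> kn'; rewrite natrB//; ring.
rewrite /Beta !e//.
have binE (n' k' : nat) : (k' <= n')%N ->
    'C(n', k')%:R = n'`!%:R / (k'`!%:R * (n' - k')`!%:R) :> R.
  move=> kn'; rewrite -(bin_fact kn') -natrM natrM mulfK//.
rewrite !binE//.
exact: rate_factor.
Qed.

Lemma split_mean_sum (I : Type) (r : seq I) (f : I -> R * R -> R) (M : R) :
  (forall i, measurable_fun setT (f i)) ->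
  (forall i z, unit_square z -> `|f i z| <= M) ->
  smean (fun z => \sum_(i <- r) f i z) = \sum_(i <- r) smean (f i).
Proof.
move=> mf fM.
have intf i := integrable_split s0 t0 (mf i) (fM i).
apply: EFin_inj; rewrite -sumEFin.
transitivity (\int[mu2]_z \sum_(i <- r) (f i z * split_density s t z)%:E)%E.
  rewrite /split_mean /Rintegral fineK.
    by apply: eq_integral => z _; rewrite mulr_suml sumEFin.
  apply: integrable_fin_num => //.
  apply: (@integrable_split _ s t s0 t0 (fun z => \sum_(i <- r) f i z) (\sum_(i <- r) M)).
    exact: measurable_sum.
  by move=> z uz; rewrite (le_trans (ler_norm_sum _ _ _))//; apply: ler_sum => i _; exact: fM.
rewrite (@integral_sum _ _ _ mu2 setT measurableT _
  (fun i z => (f i z * split_density s t z)%:E) intf); apply: eq_bigr => i _.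
by rewrite /split_mean /Rintegral fineK//; exact: integrable_fin_num (intf i).
Qed.

Lemma split_meanZr (f : R * R -> R) (M c : R) : measurable_fun setT f ->
  (forall z, unit_square z -> `|f z| <= M) ->
  smean (fun z => f z * c) = smean f * c.
Proof.
move=> mf fM; rewrite /split_mean -RintegralZr//; last exact: integrable_split fM.
by apply: eq_Rintegral => z _; rewrite mulrAC.
Qed.

(** Mean increment of [g] when the two coordinates split binomially with given fractions [z];
    averaging over [z] yields [chain_gen]. *)
Definition split_sum (g : nat * nat -> R) (n m : nat) (z : R * R) : R :=
  \sum_(p : 'I_n.+1 * 'I_m.+1) binw n z.1 p.1 * binw m z.2 p.2 *
    (g ((n - p.1 + p.2)%N, (m - p.2 + p.1)%N) - g (n, m)).

Lemma binw2_le1 n m k l (z : R * R) : (k <= n)%N -> (l <= m)%N ->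
  unit_square z -> `|binw n z.1 k * binw m z.2 l| <= 1.
Proof.
move=> kn lm [/andP[u0 u1] /andP[v0 v1]].
have u01 : 0 <= z.1 <= 1 by rewrite !ltW.
have v01 : 0 <= z.2 <= 1 by rewrite !ltW.
rewrite ger0_norm; last by apply: mulr_ge0; exact: binw_ge0.
by apply: mulr_ile1; [exact: binw_ge0..|exact: binw_le1|exact: binw_le1].
Qed.

Lemma measurable_binw2 n m k l :
  measurable_fun setT (fun z : R * R => binw n z.1 k * binw m z.2 l).
Proof.
apply: measurable_funM.
  exact: (measurableT_comp (measurable_binw n k) measurable_fst).
exact: (measurableT_comp (measurable_binw m l) measurable_snd).
Qed.

Lemma measurable_split_sum g n m : measurable_fun setT (split_sum g n m).
Proof.
apply: measurable_sum => p; apply: measurable_funM => //; exact: measurable_binw2.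
Qed.

Lemma chain_genE (g : nat * nat -> R) (M : R) n m : (forall q, `|g q| <= M) ->
  chain_gen s t g (n, m) = smean (split_sum g n m).
Proof.
move=> gM; rewrite /chain_gen pair_bigA/=.
rewrite /split_sum (@split_mean_sum _ _ _ (M + M)).
- apply: eq_bigr => -[k l] _ /=.
  have kn : (k <= n)%N by rewrite -ltnS.
  have lm : (l <= m)%N by rewrite -ltnS.
  rewrite rateE//; rewrite (@split_meanZr _ 1)//; first exact: measurable_binw2.
  by move=> z; exact: binw2_le1.
- by move=> p; apply: measurable_funM => //; exact: measurable_binw2.
- move=> -[k l] z uz /=; rewrite normrM -[leRHS]mul1r ler_pM//.
    by apply: binw2_le1 => //; rewrite -ltnS.
  by rewrite (le_trans (ler_normB _ _))// lerD.
Qed.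

Lemma binw2_sum1 n m (z : R * R) :
  \sum_(p : 'I_n.+1 * 'I_m.+1) binw n z.1 p.1 * binw m z.2 p.2 = 1.
Proof.
rewrite -(pair_bigA _ (fun k l => binw n z.1 (k : 'I__) * binw m z.2 (l : 'I__)))/=.
under eq_bigr do rewrite -mulr_sumr binw_sum1 mulr1.
exact: binw_sum1.
Qed.

Lemma binw2_ge0 n m k l (z : R * R) : unit_square z ->
  0 <= binw n z.1 k * binw m z.2 l.
Proof.
move=> [/andP[u0 u1] /andP[v0 v1]].
by rewrite mulr_ge0// binw_ge0// !ltW.
Qed.

Lemma split_sum_le (g : nat * nat -> R) (M : R) n m z : (forall q, `|g q| <= M) ->
  unit_square z -> `|split_sum g n m z| <= 2 * M.
Proof.
move=> gM uz; rewrite /split_sum (le_trans (ler_norm_sum _ _ _))//.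
rewrite -[leRHS]mul1r -{1}(binw2_sum1 n m z) mulr_suml; apply: ler_sum => p _.
rewrite normrM (ger0_norm (binw2_ge0 _ _ _ _ uz)) ler_wpM2l ?binw2_ge0//.
by rewrite (le_trans (ler_normB _ _))// mulr2n mulrDl mul1r lerD.
Qed.

Lemma chain_gen_le (g : nat * nat -> R) (M : R) p : (forall q, `|g q| <= M) ->
  `|chain_gen s t g p| <= 2 * M.
Proof.
case: p => n m gM; rewrite (chain_genE _ _ gM); apply: split_mean_le => //.
  exact: measurable_split_sum.
by move=> z; exact: split_sum_le.
Qed.

(* Chebyshev: the last term bounds the probability that the binomial splitting
   misses its mean by [d / 2] in the scale [K]. *)
Lemma split_sum_near (g : nat * nat -> R) (M e d c c' x y : R) (K n m : nat)
    (z : R * R) : (0 < K)%N -> 0 < d -> 0 <= e -> (forall q, `|g q| <= M) ->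
  `|c'| <= M -> unit_square z ->
  (forall q : nat * nat, `|q.1%:R / K%:R - (split_map (x, y) z).1| < d ->
     `|q.2%:R / K%:R - (split_map (x, y) z).2| < d -> `|g q - c'| <= e) ->
  `|n%:R / K%:R - x| <= d / 4 -> `|m%:R / K%:R - y| <= d / 4 ->
  `|split_sum g n m z - (c' - c)| <=
    e + `|g (n, m) - c| + 16 * M / d ^+ 2 * ((n%:R + m%:R) / K%:R ^+ 2).
Proof.
move=> K0 d0 e0 gM cM uz gnear xK yK.
have K0' : 0 < K%:R :> R by rewrite ltr0n.
have M0 : 0 <= M by rewrite (le_trans _ cM).
have Cd0 : 0 <= 16 * M / d ^+ 2.
  by apply: divr_ge0; [rewrite mulr_ge0|exact: sqr_ge0].
have -> : split_sum g n m z - (c' - c) =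
    (\sum_(p : 'I_n.+1 * 'I_m.+1) binw n z.1 p.1 * binw m z.2 p.2 *
      (g ((n - p.1 + p.2)%N, (m - p.2 + p.1)%N) - c')) - (g (n, m) - c).
  rewrite -{1}[c' - c]mul1r -(binw2_sum1 n m z) mulr_suml.
  rewrite -[X in _ = _ - X]mul1r -(binw2_sum1 n m z) mulr_suml -!sumrB.
  by apply: eq_bigr => p _; ring.
rewrite (le_trans (ler_normB _ _))// addrAC lerD2r.
rewrite (le_trans (ler_norm_sum _ _ _))//.
(* The sum of the two binomial variances, hence at most [n + m]. *)
pose V : R := \sum_(p : 'I_n.+1 * 'I_m.+1) binw n z.1 p.1 * binw m z.2 p.2 *
   ((p.1%:R - n%:R * z.1) ^+ 2 + (p.2%:R - m%:R * z.2) ^+ 2).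
have VE : V = n%:R * z.1 * (1 - z.1) + m%:R * z.2 * (1 - z.2).
  rewrite /V -(pair_bigA _ (fun k l => binw n z.1 (k : 'I__) * binw m z.2 (l : 'I__) *
    ((k%:R - n%:R * z.1) ^+ 2 + (l%:R - m%:R * z.2) ^+ 2)))/=.
  transitivity (\sum_(k < n.+1) (binw n z.1 k * (k%:R - n%:R * z.1) ^+ 2 +
      binw n z.1 k * (m%:R * z.2 * (1 - z.2)))).
    apply: eq_bigr => k _.
    have := binw_variance m z.2 (m%:R * z.2); rewrite subrr expr0n/= add0r => <-.
    rewrite mulr_sumr -[X in _ = X + _]mulr1 -(binw_sum1 m z.2) mulr_sumr -big_split/=.
    by apply: eq_bigr => l _; ring.
  rewrite big_split/= binw_variance subrr expr0n/= add0r -mulr_suml binw_sum1.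
  by rewrite mul1r.
have V1 : V <= n%:R + m%:R.
  rewrite VE; case: uz => /andP[/ltW u0 /ltW u1] /andP[/ltW v0 /ltW v1].
  by rewrite lerD// -mulrA ler_piMr// mulr_ile1// ?subr_ge0// gerBl.
apply: (@le_trans _ _ (e + 16 * M / d ^+ 2 * (V / K%:R ^+ 2))); last first.
  rewrite lerD2l ler_wpM2l//.
  by rewrite ler_wpM2r// invr_ge0 sqr_ge0.
pose S (p : 'I_n.+1 * 'I_m.+1) : R :=
  (p.1%:R - n%:R * z.1) ^+ 2 + (p.2%:R - m%:R * z.2) ^+ 2.
have -> : e + 16 * M / d ^+ 2 * (V / K%:R ^+ 2) =
    \sum_(p : 'I_n.+1 * 'I_m.+1) binw n z.1 p.1 * binw m z.2 p.2 *
      (e + 16 * M / d ^+ 2 * (S p / K%:R ^+ 2)).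
  rewrite -{1}[e]mul1r -(binw2_sum1 n m z) /V !mulr_suml mulr_sumr -big_split/=.
  by apply: eq_bigr => p _; rewrite /S; ring.
apply: ler_sum => -[k l] _ /=.
rewrite normrM (ger0_norm (binw2_ge0 _ _ _ _ uz)) ler_wpM2l ?binw2_ge0//.
have kn : (k <= n)%N by rewrite -ltnS.
have lm : (l <= m)%N by rewrite -ltnS.
set q : nat * nat := (_, _).
have S0 : 0 <= 16 * M / d ^+ 2 * (S (k, l) / K%:R ^+ 2).
  apply: mulr_ge0 => //; apply: divr_ge0; last exact: sqr_ge0.
  by apply: addr_ge0; exact: sqr_ge0.
pose a : R := (k%:R - n%:R * z.1) / K%:R.
pose b : R := (l%:R - m%:R * z.2) / K%:R.
have SE : S (k, l) / K%:R ^+ 2 = a ^+ 2 + b ^+ 2.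
  by rewrite /S /a /b /= !exprMn exprVn mulrDl.
pose dx := n%:R / K%:R - x; pose dy := m%:R / K%:R - y.
have q1E : q.1%:R / K%:R - (split_map (x, y) z).1 =
    - a + b + dx * (1 - z.1) + dy * z.2.
  rewrite /q /split_map /a /b /dx /dy/= natrD natrB//; ring.
have q2E : q.2%:R / K%:R - (split_map (x, y) z).2 =
    a - b + dy * (1 - z.2) + dx * z.1.
  rewrite /q /split_map /a /b /dx /dy/= natrD natrB//; ring.
case: (uz) => /andP[/ltW u0 /ltW u1] /andP[/ltW v0 /ltW v1].
have bnd (w d' : R) : 0 <= w -> w <= 1 -> `|d'| <= d / 4 -> `|d' * w| <= d / 4.
  move=> w0 w1 dd; rewrite normrM (ger0_norm w0) -[leRHS]mulr1 ler_pM//.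
(* Deviations adding up to less than [d / 2], with two errors of at most [d / 4] in the starting
   point, keep the new state within [d] of its limit, where [g] is controlled. Otherwise the crude
   bound [2 * M] is charged to the variance. *)
have [ab|ab] := ltP (`|a| + `|b|) (d / 2).
  rewrite (le_trans (gnear q _ _)) ?lerDl//.
  - rewrite q1E (le_lt_trans (ler_normD _ _))//.
    rewrite (le_lt_trans (lerD (ler_normD _ _) (lexx _)))//.
    have := bnd (1 - z.1) dx; have := bnd z.2 dy; rewrite subr_ge0 gerBl.
    move=> /(_ v0 v1 yK) h1 /(_ u1 u0 xK) h2.
    have := ler_normD (- a) b; rewrite normrN; lra.
  - rewrite q2E (le_lt_trans (ler_normD _ _))//.
    rewrite (le_lt_trans (lerD (ler_normD _ _) (lexx _)))//.
    have := bnd (1 - z.2) dy; have := bnd z.1 dx; rewrite subr_ge0 gerBl.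
    move=> /(_ u0 u1 xK) h1 /(_ v1 v0 yK) h2.
    have := ler_normB a b; lra.
rewrite (le_trans (ler_normB _ _))//.
apply: (@le_trans _ _ (2 * M)); first by rewrite mulr2n mulrDl mul1r lerD.
rewrite -[leLHS]add0r lerD// SE mulrAC ler_pdivlMr ?exprn_gt0//.
(* The square of a sum is at most twice the sum of the squares, and the sum is at least [d / 2].
   With the bound [2 * M] this is the origin of the constant 16. *)
have : d ^+ 2 <= 8 * (a ^+ 2 + b ^+ 2).
  rewrite -(real_normK (num_real a)) -(real_normK (num_real b)).
  have := sqr_ge0 (`|a| - `|b|); have := normr_ge0 a; have := normr_ge0 b.
  move: ab d0; move: `|a| `|b| => a' b'; nra.
move=> /(ler_wpM2l M0); lra.
Qed.

(* Convergence of [g_ K] to [g] along all states whose rescaling converges. *)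
Definition cont_cvg (g_ : nat -> nat * nat -> R) (g : R * R -> R) : Prop :=
  forall p, quadrant p -> forall e : R, 0 < e -> exists (d : R) (K0 : nat),
    0 < d /\ forall K q, (K0 <= K)%N ->
      `|q.1%:R / K%:R - p.1| < d -> `|q.2%:R / K%:R - p.2| < d ->
      `|g_ K q - g p| <= e.

Lemma split_map_quadrant (p z : R * R) : quadrant p -> unit_square z -> quadrant (split_map p z).
Proof.
move=> [x0 y0] [/andP[/ltW u0 /ltW u1] /andP[/ltW v0 /ltW v1]].
by split; rewrite /= addr_ge0// mulr_ge0// subr_ge0.
Qed.

(** Dominated convergence speaks of sequences, so a failure at [p] is first turned into a sequence
    of scales and states whose rescalings tend to [p]. The pointwise limit of the integrands is
    [split_sum_near]. *)
Lemma chain_gen_cvg (g_ : nat -> nat * nat -> R) (g : R * R -> R) (M : R) :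
  (forall K q, `|g_ K q| <= M) -> measurable_fun setT g -> (forall p, `|g p| <= M) ->
  cont_cvg g_ g ->
  cont_cvg (fun K => chain_gen s t (g_ K)) (jump_gen s t g).
Proof.
move=> g_M mg gM gg p qp e e0; apply: contrapT => bad.
have {}bad (j : nat) : exists Kq : nat * (nat * nat), [/\ (j.+1 <= Kq.1)%N,
    `|Kq.2.1%:R / Kq.1%:R - p.1| < j.+1%:R^-1,
    `|Kq.2.2%:R / Kq.1%:R - p.2| < j.+1%:R^-1 &
    e < `|chain_gen s t (g_ Kq.1) Kq.2 - jump_gen s t g p| ].
  apply: contrapT => nobad; apply: bad; exists j.+1%:R^-1, j.+1; split.
    by rewrite invr_gt0.
  move=> K q jK q1 q2; rewrite leNgt; apply/negP => eq; apply: nobad.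
  by exists (K, q).
have [Kq Kqbad] := choice bad.
have cvgs : chain_gen s t (g_ (Kq j).1) (Kq j).2 @[j --> \oo] --> jump_gen s t g p.
  rewrite (jump_genE s0 t0 _ mg gM).
  have -> : (fun j => chain_gen s t (g_ (Kq j).1) (Kq j).2) =
      (fun j => smean (split_sum (g_ (Kq j).1) (Kq j).2.1 (Kq j).2.2)).
    apply/funext => j; case: (Kq j) => K [n m] /=; exact: chain_genE (g_M K).
  apply: (@cvg_split_mean _ _ _ s0 t0 _ _ (2 * M)).
  - by move=> j; exact: measurable_split_sum.
  - exact: measurable_split_comp.
  - by move=> j z uz; apply: split_sum_le => // q; exact: g_M.
  move=> z uz; apply/cvgrPdist_le => h h0.
  have h40 : 0 < h / 4 by rewrite divr_gt0.
  have [d [K0 [d0 dK0]]] := gg _ (split_map_quadrant qp uz) _ h40.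
  have [d1 [K1 [d10 d1K1]]] := gg _ qp _ h40.
  have M0 : 0 <= M by rewrite (le_trans _ (gM p)).
  (* Of the two factors [K%:R^-1] in the Chebyshev term, one turns [n + m] into positions within 1
     of those of [p], whence the 2; the other tends to 0. *)
  pose C := 16 * M / d ^+ 2 * (p.1 + p.2 + 2).
  have C0 : 0 <= C.
    case: (qp) => p10 p20.
    apply: mulr_ge0; last by rewrite !addr_ge0.
    by apply: divr_ge0; [rewrite mulr_ge0|exact: sqr_ge0].
  have d40 : 0 < d / 4 by rewrite divr_gt0.
  have hC0 : 0 < h / 4 / (C + 1) by rewrite divr_gt0// ltr_wpDl.
  near=> j.
  have [jK q1 q2 _] := Kqbad j.
  have j1 : j.+1%:R^-1 <= 1 :> R by rewrite invf_le1// ler1n.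
  have jd : j.+1%:R^-1 < d / 4.
    by near: j; exact: (near_infty_natSinv_lt (PosNum d40)).
  have jd1 : j.+1%:R^-1 < d1.
    by near: j; exact: (near_infty_natSinv_lt (PosNum d10)).
  have jC : j.+1%:R^-1 < h / 4 / (C + 1).
    by near: j; exact: (near_infty_natSinv_lt (PosNum hC0)).
  have jK0 : (K0 <= j.+1)%N by near: j; exists K0 => // i /= /leqW.
  have jK1 : (K1 <= j.+1)%N by near: j; exists K1 => // i /= /leqW.
  set K := (Kq j).1 in jK q1 q2 *; move: (Kq j).2 q1 q2 => [n m] /= q1 q2.
  have K0' : 0 < K%:R :> R by rewrite ltr0n (leq_trans _ jK).
  have gK : `|g_ K (n, m) - g p| <= h / 4.
    apply: d1K1; first exact: leq_trans jK.
      exact: lt_trans jd1.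
    exact: lt_trans jd1.
  rewrite distrC (le_trans (@split_sum_near _ M (h / 4) d (g p) _ p.1 p.2 K n m z _ _ _ _ _ uz _ _ _))//.
  - by rewrite (leq_trans _ jK).
  - exact: ltW.
  - move=> q q1' q2'; apply: dK0; first exact: leq_trans jK.
      by move: q1'; case: (p).
    by move: q2'; case: (p).
  - by rewrite ltW// (lt_trans q1).
  - by rewrite ltW// (lt_trans q2).
  suff : 16 * M / d ^+ 2 * ((n%:R + m%:R) / K%:R ^+ 2) <= h / 4.
    move: gK; case: (p) => x y /=; lra.
  have -> : 16 * M / d ^+ 2 * ((n%:R + m%:R) / K%:R ^+ 2) =
      16 * M / d ^+ 2 * (n%:R / K%:R + m%:R / K%:R) * K%:R^-1.
    by rewrite [K%:R ^+ 2]expr2 [(K%:R * _)^-1]invfM; ring.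
  have Kj : K%:R^-1 <= j.+1%:R^-1 :> R.
    by rewrite lef_pV2 ?posrE// ler_nat.
  apply: (@le_trans _ _ (C * j.+1%:R^-1)).
    apply: ler_pM => //.
    - apply: mulr_ge0; last by rewrite addr_ge0.
      by apply: divr_ge0; [rewrite mulr_ge0|exact: sqr_ge0].
    - rewrite /C ler_wpM2l//.
        by apply: divr_ge0; [rewrite mulr_ge0|exact: sqr_ge0].
      move: q1 q2 j1; rewrite !ltr_norml => /andP[_ + ] /andP[_ +].
      move: (n%:R / K%:R) (m%:R / K%:R) (j.+1%:R^-1 : R) => a b r; lra.
  apply: (@le_trans _ _ ((C + 1) * j.+1%:R^-1)).
    by rewrite ler_wpM2r ?invr_ge0// lerDl.
  by rewrite mulrC -ler_pdivlMr ?ltW// ltr_wpDl.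
have [j _ /(_ j (leqnn j))] := (cvgrPdist_lt _ _).1 cvgs _ e0.
have [_ _ _ /lt_trans je] := Kqbad j.
by rewrite distrC => /je; rewrite ltxx.
Unshelve. all: by end_near. Qed.

End chain_kernel.

(** * Semigroups with a bounded generator *)

Section bounded_measurable.
Context {R : realType}.

Definition bmeas {d} {S : measurableType d} (f : S -> R) (M : R) : Prop :=
  measurable_fun setT f /\ forall x, `|f x| <= M.

Lemma bmeas_indic {d} {S : measurableType d} (B : set S) : measurable B ->
  bmeas (\1_B : S -> R) 1.
Proof.
by move=> mB; split => // x; rewrite indicE; case: (_ \in _); rewrite ?normr1 ?normr0.
Qed.

Lemma bmeas_cst {d} {S : measurableType d} (c : R) :
  @bmeas d S (fun=> c) `|c|.
Proof. by split => // x. Qed.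

Lemma bmeas_lin {d} {S : measurableType d} (f g : S -> R) (M M' c : R) :
  bmeas f M -> bmeas g M' -> bmeas (fun x => f x + c * g x) (M + `|c| * M').
Proof.
move=> [mf fM] [mg gM]; split; first by apply: measurable_funD => //; exact: measurable_funM.
by move=> x; rewrite (le_trans (ler_normD _ _))// lerD// normrM ler_wpM2l.
Qed.

Lemma bmeasM {d} {S : measurableType d} (f g : S -> R) (M M' : R) :
  bmeas f M -> bmeas g M' -> bmeas (fun x => f x * g x) (M * M').
Proof.
move=> [mf fM] [mg gM]; split; first exact: measurable_funM.
by move=> x; rewrite normrM ler_pM.
Qed.

Lemma bmeas_comp {d d'} {S : measurableType d} {T : measurableType d'}
    (f : S -> R) (M : R) (X : T -> S) :
  bmeas f M -> measurable_fun setT X -> bmeas (f \o X) M.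
Proof. by move=> [mf fM] mX; split; [exact: measurableT_comp|move=> x /=]. Qed.

(** No monotone continuity is asked for: the sup-norm bound suffices to pass from indicators to
    bounded measurable functions by uniform approximation. *)
Definition bfunctional {d} {S : measurableType d} (I : (S -> R) -> R) (C : R) :=
  (forall f M g M' c, bmeas f M -> bmeas g M' ->
    I (fun x => f x + c * g x) = I f + c * I g) /\
  (forall f M, bmeas f M -> `|I f| <= C * M).

Lemma count_levels (h r : R) (n : nat) : 0 < h -> 0 <= r -> r <= n%:R * h ->
  `|r - \sum_(k < n) h * (k.+1%:R * h <= r)%R%:R| <= h.
Proof.
move=> h0 r0 rn; rewrite ler_norml.
suff : 0 <= r - \sum_(k < n) h * (k.+1%:R * h <= r)%R%:R <= h.
  by move=> /andP[a ->]; rewrite andbT (le_trans _ a)// lerNl oppr0 ltW.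
elim: n rn => [|n IH] rn.
  rewrite big_ord0 subr0 r0 (le_trans rn)// mul0r; exact: ltW.
rewrite big_ord_recr/=; have [rn'|rn'] := leP r (n%:R * h).
  have -> : (n.+1%:R * h <= r) = false.
    by apply/negbTE; rewrite -ltNge (le_lt_trans rn')// ltr_pM2r// ltr_nat.
  by rewrite mulr0 addr0 IH.
have -> : \sum_(k < n) h * (k.+1%:R * h <= r)%R%:R = n%:R * h.
  transitivity (\sum_(k < n) h).
    apply: eq_bigr => k _.
    by rewrite (_ : (_ <= _) = true) ?mulr1// (le_trans _ (ltW rn'))// ler_pM2r// ler_nat.
  by rewrite sumr_const card_ord mulr_natl.
move: rn; rewrite -[n.+1]addn1 natrD.
move: rn'; move: (n%:R : R) => N rn' rn.
by have [c|c] := leP ((N + 1) * h) r; rewrite ?mulr1 ?mulr0; apply/andP; split; lra.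
Qed.

(* Layer-cake approximation of [f + M] by [\sum_k h * \1_[set x | k * h <= f x + M]]. *)
Lemma bfunctional_ext {d} {S : measurableType d} (I1 I2 : (S -> R) -> R) (C : R) :
  bfunctional I1 C -> bfunctional I2 C ->
  (forall B, measurable B -> I1 \1_B = I2 \1_B) ->
  forall f M, bmeas f M -> I1 f = I2 f.
Proof.
move=> [lin1 bd1] [lin2 bd2] I12 f M bf.
have ind0 : (\1_(set0 : set S) : S -> R) = fun=> 0.
  by apply/funext => x; rewrite indicE in_set0.
have indT : (\1_(setT : set S) : S -> R) = fun=> 1.
  by apply/funext => x; rewrite indicE in_setT.
have [_ fM] := bf.
have [M0|M0] := leP M 0.
  suff -> : f = \1_set0 by exact: I12.
  rewrite ind0; apply/funext => x; apply/eqP.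
  by rewrite -normr_le0 (le_trans (fM x)).
have C0 : 0 <= C.
  have := bd1 _ _ (bmeas_indic measurableT); rewrite mulr1; exact: le_trans.
pose h n : R := 2 * M / n.+1%:R.
have h0 n : 0 < h n by rewrite divr_gt0 ?mulr_gt0.
pose B n k : set S := [set x | k.+1%:R * h n <= f x + M].
have mB n k : measurable (B n k).
  rewrite (_ : B n k = setT `&` (fun x => f x + M) @^-1` `[k.+1%:R * h n, +oo[%classic).
    by apply: (measurable_funD bf.1 (measurable_cst M)) => //; exact: measurable_itv.
  by rewrite setTI; apply/seteqP; split => x /=; rewrite /B/= in_itv/= andbT.
pose L n m (x : S) : R := - M + \sum_(k < m) h n * \1_(B n k) x.
have bL n m : exists M', bmeas (L n m) M'.
  elim: m => [|m [M' IH]].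
    exists `|- M|; rewrite (_ : L n 0 = fun=> - M); first exact: bmeas_cst.
    by apply/funext => x; rewrite /L big_ord0 addr0.
  exists (M' + `|h n| * 1).
  rewrite (_ : L n m.+1 = fun x => L n m x + h n * \1_(B n m) x).
    by apply: bmeas_lin => //; exact: bmeas_indic.
  by apply/funext => x; rewrite /L big_ord_recr/= addrA.
have IL n m : I1 (L n m) = I2 (L n m).
  elim: m => [|m IH].
    have -> : L n 0 = fun x => \1_set0 x + (- M) * \1_setT x.
      by apply/funext => x; rewrite /L big_ord0 ind0 indT add0r mulr1 addr0.
    rewrite (lin1 _ 1 _ 1) ?(lin2 _ 1 _ 1) ?I12//; exact: bmeas_indic.
  have -> : L n m.+1 = fun x => L n m x + h n * \1_(B n m) x.
    by apply/funext => x; rewrite /L big_ord_recr/= addrA.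
  have [M' bLm] := bL n m.
  by rewrite (lin1 _ M' _ 1) ?(lin2 _ M' _ 1) ?IH ?I12//; exact: bmeas_indic.
(* The functionals agree on the layer-cake sum, and each moves by at most [C * h n] between that sum
   and [f]. *)
have dist n : `|I1 f - I2 f| <= 2 * C * h n.
  have [M' bLn] := bL n n.+1.
  have bfL : bmeas (fun x => f x + (-1) * L n n.+1 x) (h n).
    split; first exact: (bmeas_lin _ bf bLn).1.
    move=> x; rewrite mulN1r /L opprD opprK addrA.
    under eq_bigr do rewrite indicE.
    have := @count_levels (h n) (f x + M) n.+1 (h0 n).
    have -> : n.+1%:R * h n = 2 * M by rewrite /h mulrC divfK.
    move=> cl.
    rewrite (le_trans _ (cl _ _))//.
    - rewrite le_eqVlt; apply/orP; left; apply/eqP; congr `|_ - _|.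
      by apply: eq_bigr => k _; congr (_ * (nat_of_bool _)%:R); apply/idP/idP; rewrite inE.
    - by have := fM x; rewrite ler_norml => /andP[+ _]; rewrite -subr_ge0 opprK.
    - have := fM x; rewrite ler_norml => /andP[_ +]; lra.
  have := bd1 _ _ bfL; have := bd2 _ _ bfL.
  rewrite (lin1 _ M _ M')// (lin2 _ M _ M')// IL !mulN1r => e2 e1.
  have -> : I1 f - I2 f = (I1 f - I2 (L n n.+1)) - (I2 f - I2 (L n n.+1)) by ring.
  rewrite (le_trans (ler_normB _ _))//; lra.
have [//|ne] := eqVneq (I1 f) (I2 f).
have D0 : 0 < `|I1 f - I2 f| by rewrite normr_gt0 subr_eq0.
have C1 : 0 < 2 * C * (2 * M) + 1 by rewrite ltr_wpDl// mulr_ge0 ?mulr_ge0// ltW.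
have [n _ /(_ n (leqnn n))/=] := near_infty_natSinv_lt (PosNum (divr_gt0 D0 C1)).
rewrite ltr_pdivlMr//; have := dist n; rewrite /h.
have : 0 < n.+1%:R^-1 :> R by rewrite invr_gt0.
move: (n.+1%:R^-1 : R) D0 => r; lra.
Qed.

End bounded_measurable.

Section taylor_monomials.
Context {R : realType}.

Definition texp (n : nat) (t : R) : R := t ^+ n / n`!%:R.

Lemma texp_increment (t : R) (n : nat) : 0 <= t -> exists2 C : R, 0 <= C &
  forall s h : R, 0 <= s -> s <= t -> 0 <= h -> h <= 1 ->
    `|texp n.+1 (s + h) - texp n.+1 s - h * texp n s| <= C * h ^+ 2.
Proof.
move=> t0.
have [C C0 hC] : exists2 C : R, 0 <= C &
  forall s h : R, 0 <= s -> s <= t -> 0 <= h -> h <= 1 ->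
    `|(s + h) ^+ n.+1 - s ^+ n.+1 - n.+1%:R * h * s ^+ n| <= C * h ^+ 2.
  elim: n => [|n [C C0 IH]].
    exists 0 => // s h _ _ _ _.
    by rewrite !expr1 expr0 (_ : _ - _ = 0) ?normr0 ?mul0r//; ring.
  (* Multiplying the previous remainder by [s + h], at most [t + 1], leaves the extra term
     [n.+1%:R * s ^+ n * h ^+ 2]. *)
  exists ((t + 1) * C + n.+1%:R * t ^+ n).
    by rewrite addr_ge0 ?mulr_ge0 ?exprn_ge0 ?addr_ge0.
  move=> s h s0 st h0 h1.
  have -> : (s + h) ^+ n.+2 - s ^+ n.+2 - n.+2%:R * h * s ^+ n.+1 =
     (s + h) * ((s + h) ^+ n.+1 - s ^+ n.+1 - n.+1%:R * h * s ^+ n)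
     + n.+1%:R * s ^+ n * h ^+ 2.
    by rewrite -[n.+2%:R]natr1 !exprS; ring.
  rewrite (le_trans (ler_normD _ _))// [leRHS]mulrDl lerD//.
    rewrite normrM -[leRHS]mulrA ler_pM//; last exact: IH.
    by rewrite ger0_norm ?addr_ge0// lerD.
  rewrite ger0_norm ?mulr_ge0 ?exprn_ge0// ler_wpM2r ?exprn_ge0// ler_wpM2l//.
  by rewrite lerXn2r ?nnegrE.
exists (C / n.+1`!%:R); first by rewrite divr_ge0.
move=> s h s0 st h0 h1.
have -> : texp n.+1 (s + h) - texp n.+1 s - h * texp n s =
    ((s + h) ^+ n.+1 - s ^+ n.+1 - n.+1%:R * h * s ^+ n) / n.+1`!%:R.
  rewrite /texp !mulrBl; congr (_ - _).
  rewrite factS natrM invfM; field.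
  by rewrite nat1r !pnatr_eq0 /= -lt0n fact_gt0.
rewrite normrM normfV (ger0_norm (ler0n _ _)) [leRHS]mulrAC ler_wpM2r ?invr_ge0//.
exact: hC.
Qed.

(* A mean value inequality requiring only right increments. *)
Lemma bounded_increments (g K : R -> R) (t : R) : 0 <= t ->
  (forall e : R, 0 < e -> exists2 del : R, 0 < del & forall s h : R, 0 <= s -> s <= t ->
     0 < h -> h < del -> `|g (s + h) - g s| <= K (s + h) - K s + h * e) ->
  `|g t - g 0| <= K t - K 0.
Proof.
move=> t0 hg; have [->|tn0] := eqVneq t 0; first by rewrite !subrr normr0.
have {tn0} t0 : 0 < t by rewrite lt0r tn0.
apply/ler_addgt0Pl => e e0.
have [del del0 hdel] := hg _ (divr_gt0 e0 t0).
have [n _ /(_ n (leqnn n))/=] := near_infty_natSinv_lt (PosNum (divr_gt0 del0 t0)).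
rewrite ltr_pdivlMr// => ntd.
pose h := n.+1%:R^-1 * t.
have h0 : 0 < h by rewrite mulr_gt0.
have step m : (m <= n.+1)%N ->
   `|g (m%:R * h) - g 0| <= K (m%:R * h) - K 0 + m%:R * h * (e / t).
  elim: m => [|m IH] mn; first by rewrite !mul0r !subrr normr0 addr0.
  have -> : m.+1%:R * h = m%:R * h + h by rewrite -[m.+1]addn1 natrD mulrDl mul1r.
  have -> : g (m%:R * h + h) - g 0 = (g (m%:R * h + h) - g (m%:R * h)) + (g (m%:R * h) - g 0).
    by ring.
  rewrite (le_trans (ler_normD _ _))//.
  have mh0 : 0 <= m%:R * h by rewrite mulr_ge0// ltW.
  have mht : m%:R * h <= t.
    by rewrite /h mulrA ler_piMl ?(ltW t0)// ler_pdivrMr// mul1r ler_nat ltnW.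
  have := hdel _ _ mh0 mht h0 ntd; have := IH (ltnW mn).
  move=> a b; apply: (le_trans (lerD b a)).
  by rewrite le_eqVlt; apply/orP; left; apply/eqP; ring.
have := step n.+1 (leqnn _).
have -> : n.+1%:R * h = t by rewrite /h mulrA mulfV ?mul1r.
by rewrite mulrCA mulfV ?mulr1 ?gt_eqF// [e + _]addrC.
Qed.

End taylor_monomials.

(** * Transition operators and their Taylor expansion *)

Section semigroup.
Context {R : realType} {d} {S : measurableType d}.

Lemma bmeas_integrable (mu : {measure set S -> \bar R}) (f : S -> R) (M : R) :
  mu setT = 1%E -> bmeas f M -> mu.-integrable setT (EFin \o f).
Proof.
move=> mu1 [mf fM]; apply: measurable_bounded_integrable => //.
  by rewrite mu1 ltry.
exists M; split; first exact: num_real.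
by move=> y My x _; rewrite /= (le_trans (fM x))// ltW.
Qed.

Lemma Rintegral_prob_cst (mu : {measure set S -> \bar R}) (c : R) :
  mu setT = 1%E -> \int[mu]_x c = c.
Proof.
by move=> mu1; rewrite Rintegral_cst// mu1 mulr1.
Qed.

Lemma bfunctional_prob (mu : {measure set S -> \bar R}) :
  mu setT = 1%E -> bfunctional (fun f : S -> R => \int[mu]_x f x) 1.
Proof.
move=> mu1; split.
- move=> f M g M' c bf bg.
  have ig := bmeas_integrable mu1 bg.
  rewrite RintegralD//; [|exact: bmeas_integrable mu1 bf|].
    by rewrite RintegralZl.
  exact: (bmeas_integrable mu1 (bmeasM (bmeas_cst c) bg)).
- move=> f M bf; rewrite mul1r.
  have if_ := bmeas_integrable mu1 bf.
  rewrite (le_trans (le_normr_Rintegral _ if_))//.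
  rewrite -[leRHS](Rintegral_prob_cst M mu1).
  apply: le_Rintegral => //.
  + by move/integrable_norm : if_; apply.
  + exact: (bmeas_integrable mu1 (bmeas_cst M)).
  + by move=> x _; exact: bf.2.
Qed.

Lemma Rintegral_indic (mu : {measure set S -> \bar R}) (B : set S) : measurable B ->
  \int[mu]_x \1_B x = fine (mu B).
Proof. by move=> mB; rewrite /Rintegral integral_indic// setIT. Qed.

Definition qop (Q : R -> R.-pker S ~> S) (t : R) (f : S -> R) (x : S) : R :=
  \int[Q t x]_y f y.

Variables (E : set S) (Q : R -> R.-pker S ~> S).
Hypotheses (mE : measurable E) (sgQ : transition_semigroup E Q).

Lemma pker_fin_num (k : R.-pker S ~> S) y (B : set S) : measurable B ->
  k y B \is a fin_num.
Proof.
move=> mB; rewrite ge0_fin_numE ?measure_ge0//.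
have kT : k y setT = 1%E by exact: prob_kernel.
apply: (@le_lt_trans _ _ (k y setT)); last by rewrite kT ltry.
by apply: le_measure; rewrite ?inE.
Qed.

Lemma qop_lin t x (f g : S -> R) (M M' c : R) : bmeas f M -> bmeas g M' ->
  qop Q t (fun x => f x + c * g x) x = qop Q t f x + c * qop Q t g x.
Proof.
move=> bf bg; have [lin _] := bfunctional_prob (@prob_kernel _ _ _ _ _ (Q t) x).
exact: lin bf bg.
Qed.

Lemma qop_bound t x (f : S -> R) (M : R) : bmeas f M -> `|qop Q t f x| <= M.
Proof.
by move=> bf; have [_ /(_ _ _ bf)] := bfunctional_prob (@prob_kernel _ _ _ _ _ (Q t) x); rewrite mul1r.
Qed.

Lemma measurable_qop t (f : S -> R) (M : R) : bmeas f M ->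
  measurable_fun setT (qop Q t f).
Proof.
move=> bf.
(* Kernel integrals of nonnegative functions are measurable in the starting point; adding [M]
   reduces to that case. *)
have bfM := bmeas_lin 1 bf (bmeas_cst M).
have -> : qop Q t f = fun x => fine (\int[Q t x]_y (f y + 1 * M)%:E)%E - M.
  apply/funext => x.
  have := qop_lin t x 1 bf (bmeas_cst M); rewrite /qop (Rintegral_prob_cst _ (@prob_kernel _ _ _ _ _ _ _)).
  by rewrite mul1r => h; rewrite -[LHS](addrK M) -h.
apply: measurable_funB => //; apply: measurableT_comp => //.
apply: measurable_fun_integral_kernel.
- by move=> U mU; exact: measurable_kernel.
- move=> y; have := bf.2 y; rewrite lee_fin mul1r ler_norml => /andP[+ _]; lra.
- by apply/measurable_EFinP; exact: bfM.1.
Qed.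

Lemma bmeas_qop t (f : S -> R) (M : R) : bmeas f M -> bmeas (qop Q t f) M.
Proof. by move=> bf; split; [exact: measurable_qop bf|move=> x; exact: qop_bound]. Qed.

(** [has_generator] gives estimates on [E] only. They suffice because the kernel, started in [E],
    puts no mass outside [E]. *)
Lemma qop_boundE t x (f : S -> R) (M c : R) : 0 <= t -> E x -> bmeas f M ->
  (forall y, E y -> `|f y| <= c) -> `|qop Q t f x| <= c.
Proof.
move=> t0 Ex bf fc.
have c0 : 0 <= c by exact: le_trans (fc _ Ex).
have bE := @bmeas_indic R _ _ _ mE.
have QE : Q t x E = 1%E by have [+ _ _] := sgQ; exact.
have -> : qop Q t f x = qop Q t (fun y => f y * \1_E y) x.
  rewrite /qop; congr fine; apply: ae_eq_integral => //.
  - by apply/measurable_EFinP; exact: bf.1.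
  - by apply/measurable_EFinP; exact: (bmeasM bf bE).1.
  exists (~` E); split; first exact: measurableC.
    have QT : Q t x (E `|` ~` E) = 1%E by rewrite setUv; exact: prob_kernel.
    have : (Q t x (E `|` ~` E) = Q t x E + Q t x (~` E))%E.
      exact: measureU mE (measurableC mE) (setICr E).
    rewrite QT QE.
    by case: (Q t x (~` E)) => [q|//|//] [h]; congr EFin; lra.
  move=> y /= ny Ey; apply: ny => _; rewrite indicE mem_set// mulr1//.
apply: (@qop_bound _ _ _ c); split; first exact: (bmeasM bf bE).1.
move=> y; rewrite indicE; case: (boolP (y \in E)) => [|_].
  by rewrite inE mulr1; exact: fc.
by rewrite mulr0 normr0.
Qed.

Lemma qop0 (f : S -> R) (M : R) x : E x -> bmeas f M -> qop Q 0 f x = f x.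
Proof.
move=> Ex bf.
have H := @bfunctional_ext _ _ S (fun f => qop Q 0 f x) (fun f => f x) 1.
apply: (H _ _ _ f M bf).
- exact: (bfunctional_prob (@prob_kernel _ _ _ _ _ _ _)).
- by split=> // g M' bg; rewrite mul1r; exact: bg.2.
- move=> B mB; rewrite /qop Rintegral_indic//.
  by have [_ -> // _] := sgQ.
Qed.

(** Chapman-Kolmogorov is assumed for sets; both sides are bounded functionals of [f], so
    [bfunctional_ext] extends it. *)
Lemma qopD a b (f : S -> R) (M : R) x : 0 <= a -> 0 <= b -> E x -> bmeas f M ->
  qop Q (a + b) f x = qop Q a (qop Q b f) x.
Proof.
move=> a0 b0 Ex bf.
have H := @bfunctional_ext _ _ S (fun f => qop Q (a + b) f x)
  (fun f => qop Q a (qop Q b f) x) 1.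
apply: (H _ _ _ f M bf).
- exact: (bfunctional_prob (@prob_kernel _ _ _ _ _ _ _)).
- split=> [g M1 h M2 c bg bh|g M1 bg]; last first.
    by rewrite mul1r; apply: qop_bound; exact: bmeas_qop.
  rewrite -(@qop_lin a x _ _ M1 M2); [|exact: bmeas_qop..].
  by congr fine; apply: eq_integral => y _; rewrite (qop_lin _ _ _ bg bh).
- move=> B mB; rewrite [LHS]/qop Rintegral_indic//.
  have [_ _ ->//] := sgQ; congr fine; apply: eq_integral => y _.
  by rewrite /qop Rintegral_indic// fineK//; exact: pker_fin_num.
Qed.

End semigroup.

Section generator.
Context {R : realType} {d} {S : measurableType d}.
Variables (E : set S) (Q : R -> R.-pker S ~> S) (A : (S -> R) -> S -> R).
Hypotheses (mE : measurable E) (sgQ : transition_semigroup E Q).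
Hypothesis genQ : has_generator E Q A.
Hypothesis bA : forall f M, bmeas f M -> bmeas (A f) (2 * M).

(** The generator describes the semigroup near time 0; applying [qop Q s], a contraction, carries
    the estimate to every time with the same [del]. *)
Lemma qop_increment (f : S -> R) (M e : R) : bmeas f M -> 0 < e ->
  exists2 del : R, 0 < del & forall s h x, 0 <= s -> 0 < h -> h < del -> E x ->
    `|qop Q (s + h) f x - qop Q s f x - h * qop Q s (A f) x| <= h * e.
Proof.
move=> bf e0.
have [del /= del0 hdel] := genQ bf.1 (ex_intro _ M bf.2) e0.
exists del => // s h x s0 h0 hd Ex.
have bAf := bA bf.
have bQf := bmeas_qop Q h bf.
rewrite (qopD sgQ s0 (ltW h0) Ex bf).
pose g y := (qop Q h f y + (-1) * f y) + (- h) * A f y.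
have bg := bmeas_lin (- h) (bmeas_lin (-1) bQf bf) bAf.
have -> : qop Q s (qop Q h f) x - qop Q s f x - h * qop Q s (A f) x = qop Q s g x.
  rewrite /g (qop_lin _ _ _ _ (bmeas_lin (-1) bQf bf) bAf).
  by rewrite (qop_lin _ _ _ _ bQf bf); ring.
apply: (qop_boundE mE sgQ s0 Ex bg) => y Ey.
have hd' : ball (0 : R) del h by rewrite /ball/= sub0r normrN gtr0_norm.
have := hdel _ hd' h0 y Ey.
have -> : qop Q h f y + -1 * f y + - h * A f y =
    ((qop Q h f y - f y) / h - A f y) * h.
  by rewrite mulrBl divfK ?gt_eqF//; ring.
by move=> hle; rewrite normrM (gtr0_norm h0) [leLHS]mulrC ler_wpM2l// ltW.
Qed.

(** The first application of [A] is peeled off next to [f], which matches an induction whose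
    hypothesis is used at [A f]. *)
Fixpoint iterA (n : nat) (f : S -> R) : S -> R :=
  if n is n'.+1 then iterA n' (A f) else f.

(** The remainder for [f] grows at a rate equal to the remainder of one order less for [A f]. Since
    [A f] is bounded by [2 * M], that rate is at most the derivative of the claimed bound, and
    comparing right increments is enough. *)
Lemma qop_taylor (N : nat) (f : S -> R) (M t : R) x : bmeas f M -> 0 <= t -> E x ->
  `|qop Q t f x - \sum_(n < N) texp n t * iterA n f x| <= M * 2 ^+ N * texp N t.
Proof.
move=> bf t0 Ex; elim: N f M bf t t0 => [|N IH] f M bf t t0.
  rewrite big_ord0 subr0 /texp !expr0 fact0 invr1 !mulr1; exact: qop_bound.
pose P n0 s : R := \sum_(n < n0) texp n s * iterA n f x.
pose P' s : R := \sum_(n < N) texp n s * iterA n (A f) x.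
pose K s : R := M * 2 ^+ N.+1 * texp N.+1 s.
pose g s : R := qop Q s f x - P N.+1 s.
have g0 : g 0 = 0.
  rewrite /g (qop0 sgQ Ex bf) /P big_ord_recl /= /texp expr0 fact0 divr1 mul1r.
  by rewrite big1 ?addr0 ?subrr// => i _; rewrite /bump/= add1n expr0n/= !mul0r.
have K0 : K 0 = 0 by rewrite /K /texp expr0n/= mul0r mulr0.
have PC : exists2 C : R, 0 <= C & forall s h : R, 0 <= s -> s <= t -> 0 <= h -> h <= 1 ->
    `|P N.+1 (s + h) - P N.+1 s - h * P' s| <= C * h ^+ 2.
  rewrite /P'; elim: N {IH P' K g g0 K0} => [|n [C C0 hC]].
    exists 0 => // s h _ _ _ _; rewrite /P !big_ord1 big_ord0 /texp !expr0.
    by rewrite mulr0 subr0 subrr normr0 mul0r.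
  have [C' C'0 hC'] := texp_increment n t0.
  exists (C + C' * `|iterA n.+1 f x|); first by rewrite addr_ge0// mulr_ge0.
  move=> s h s0 st h0 h1.
  rewrite /P 2!(big_ord_recr n.+1)/= [X in h * X]big_ord_recr/=.
  rewrite -/(P n.+1 (s + h)) -/(P n.+1 s).
  set a := iterA n (A f) x.
  set p := \sum_(i < n) _.
  have -> : P n.+1 (s + h) + texp n.+1 (s + h) * a - (P n.+1 s + texp n.+1 s * a)
      - h * (p + texp n s * a) = (P n.+1 (s + h) - P n.+1 s - h * p) +
      (texp n.+1 (s + h) - texp n.+1 s - h * texp n s) * a by ring.
  rewrite (le_trans (ler_normD _ _))// [leRHS]mulrDl lerD//; first exact: hC.
  by rewrite normrM [leRHS]mulrAC ler_wpM2r//; exact: hC'.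
have [CK CK0 hCK] := texp_increment N t0.
have [CP CP0 hCP] := PC.
have M0 : 0 <= M by rewrite (le_trans _ (bf.2 x)).
have := @bounded_increments _ g K t t0.
rewrite g0 K0 !subr0; apply => e e0.
have e20 : 0 < e / 2 by rewrite divr_gt0.
have [del del0 hdel] := qop_increment bf e20.
pose C := CP + M * 2 ^+ N.+1 * CK.
have C0 : 0 <= C by rewrite addr_ge0// !mulr_ge0// exprn_ge0.
(* Half of [e] pays for the semigroup increment, the other half for the quadratic remainders of the
   polynomial and of the bound, gathered in [C]. *)
exists (Num.min del (Num.min 1 (e / 2 / (C + 1)))).
  by rewrite !lt_min del0 ltr01 divr_gt0// ltr_wpDl.
move=> s h s0 st h0; rewrite !lt_min => /and3P[hd h1 hC].
have a4 := hdel s h x s0 h0 hd Ex.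
have a3 := hCP s h s0 st (ltW h0) (ltW h1).
have a2 := hCK s h s0 st (ltW h0) (ltW h1).
have a1 := IH (A f) _ (bA bf) s s0; rewrite -/(P' s) in a1.
have hCe : C * h <= e / 2.
  have C10 : 0 < C + 1 by rewrite ltr_wpDl.
  by move: hC; rewrite ltr_pdivlMr// => hC; rewrite (le_trans _ (ltW hC))// mulrC ler_wpM2l ?lerDl// ltW.
have -> : g (s + h) - g s = (qop Q (s + h) f x - qop Q s f x - h * qop Q s (A f) x) -
    (P N.+1 (s + h) - P N.+1 s - h * P' s) + h * (qop Q s (A f) x - P' s).
  by rewrite /g; ring.
rewrite (le_trans (ler_normD _ _))// (le_trans (lerD (ler_normB _ _) (lexx _)))//.
rewrite (le_trans (lerD (lerD a4 a3) (lexx _)))//.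
pose B := M * 2 ^+ N.+1.
have B0 : 0 <= B by rewrite mulr_ge0// exprn_ge0.
have a1' : `|h * (qop Q s (A f) x - P' s)| <= h * (B * texp N s).
  rewrite normrM (gtr0_norm h0) ler_wpM2l ?(ltW h0)//.
  by rewrite (le_trans a1)// /B exprS mulrA [M * 2]mulrC.
rewrite (le_trans (lerD (lexx _) a1'))//.
have a2' : B * (h * texp N s - CK * h ^+ 2) <= B * (texp N.+1 (s + h) - texp N.+1 s).
  apply: ler_wpM2l => //; move: a2; rewrite ler_norml => /andP[+ _]; lra.
have a5 : h * (C * h) <= h * (e / 2) by rewrite ler_wpM2l// ltW.
rewrite /K -/B; move: a2' a5; rewrite /C -/B.
move: (texp N.+1 (s + h)) (texp N.+1 s) (texp N s) => u v w; lra.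
Qed.

End generator.

(** * Finite-dimensional distributions *)

Section markov_product.
Context {R : realType} {d d'} {Om : measurableType d} {S : measurableType d'}.
Variables (E : set S) (Q : R -> R.-pker S ~> S) (P : probability Om R).
Variable X : R -> Om -> S.
Hypotheses (mE : measurable E) (sgQ : transition_semigroup E Q).
Hypothesis mkX : markov_process E Q P X.

Definition past_gen (a : R) : set (set Om) :=
  [set H | exists (u : R) B,
         [/\ 0 <= u, u <= a, measurable B & H = X u @^-1` B] ].

(** Adapted functions are measurable functions on [Om] equipped with the past as its sigma-algebra,
    so results about [bmeas] apply to them unchanged. *)
Definition past_bmeas (a : R) (G : Om -> R) (M : R) : Prop :=
  @bmeas R _ (g_sigma_algebraType (past_gen a)) G M.

Lemma past_measurable a (H : set Om) : past X a H -> measurable H.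
Proof.
apply: smallest_sub; first exact: sigma_algebra_measurable.
move=> _ [u [B [u0 ua mB ->]]].
have [mX _ _] := mkX.
by rewrite -[X in measurable X]setTI; exact: mX.
Qed.

Lemma past_bmeas_bmeas a (G : Om -> R) M : past_bmeas a G M -> bmeas G M.
Proof.
move=> [mG GM]; split => // _ Y mY; apply: (@past_measurable a).
exact: mG.
Qed.

Lemma past_bmeas_le a b (G : Om -> R) M : a <= b ->
  past_bmeas a G M -> past_bmeas b G M.
Proof.
move=> ab [mG GM]; split => // _ Y mY.
have := mG measurableT Y mY.
apply: (@smallest_sub _ (sigma_algebra setT) (past_gen a) <<s past_gen b>>).
  exact: smallest_sigma_algebra.
move=> _ [u [B [u0 ua mB ->]]]; apply: sub_gen_smallest.
by exists u, B; split => //; exact: le_trans ab.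
Qed.

Lemma past_bmeas_comp a (f : S -> R) M : 0 <= a -> bmeas f M ->
  past_bmeas a (f \o X a) M.
Proof.
move=> a0 [mf fM]; split => [_ Y mY|w /=]; last exact: fM.
rewrite setTI; apply: sub_gen_smallest; exists a, (f @^-1` Y); split => //.
by rewrite -[X in measurable X]setTI; exact: mf.
Qed.

Lemma past_bmeasM a (G G' : Om -> R) M M' :
  past_bmeas a G M -> past_bmeas a G' M' -> past_bmeas a (fun w => G w * G' w) (M * M').
Proof. exact: bmeasM. Qed.

Lemma bmeas_proc a (f : S -> R) M : 0 <= a -> bmeas f M -> bmeas (f \o X a) M.
Proof. by move=> a0 bf; apply: bmeas_comp => //; have [+ _ _] := mkX; exact. Qed.

(** The Markov property is given for sets. [bfunctional_ext] is used twice: in [f] with [G] an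
    indicator, then in [G] on the sigma-algebra of the past. *)
Lemma markov_step (a b : R) (G : Om -> R) (f : S -> R) (M M' : R) :
  0 <= a -> 0 <= b -> past_bmeas a G M -> bmeas f M' ->
  \int[P]_w (G w * f (X (a + b) w)) = \int[P]_w (G w * qop Q b f (X a w)).
Proof.
move=> a0 b0 bG bf.
have ab0 : 0 <= a + b by rewrite addr_ge0.
have P1 : P setT = 1%E by exact: probability_setT.
have [linP bdP] := bfunctional_prob P1.
have wI (w : Om -> R) (Mw : R) : bmeas w Mw ->
    forall (g h : Om -> R) (Mg Mh c : R), bmeas g Mg -> bmeas h Mh ->
    \int[P]_x (w x * (g x + c * h x)) = \int[P]_x (w x * g x) + c * \int[P]_x (w x * h x).
  move=> bw g h Mg Mh c bg bh.
  rewrite -(linP _ _ _ _ c (bmeasM bw bg) (bmeasM bw bh)).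
  by apply: eq_Rintegral => x _; ring.
have HH (H : set Om) : past X a H ->
    \int[P]_w (\1_H w * f (X (a + b) w)) = \int[P]_w (\1_H w * qop Q b f (X a w)).
  move=> pH; have mH := past_measurable pH.
  have bH := @bmeas_indic R _ _ _ mH.
  have ext := @bfunctional_ext R _ S
    (fun f => \int[P]_w (\1_H w * f (X (a + b) w)))
    (fun f => \int[P]_w (\1_H w * qop Q b f (X a w))) 1.
  apply: (ext _ _ _ f M' bf).
  - split=> [g Mg h Mh c bg bh|g Mg bg].
      exact: (wI _ _ bH _ _ _ _ _ (bmeas_proc ab0 bg) (bmeas_proc ab0 bh)).
    rewrite mul1r -[Mg]mul1r -[leRHS]mul1r.
    exact: (bdP _ _ (bmeasM bH (bmeas_proc ab0 bg))).
  - split=> [g Mg h Mh c bg bh|g Mg bg].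
      rewrite -(wI _ _ bH _ _ _ _ _ (bmeas_proc a0 (bmeas_qop Q b bg)) (bmeas_proc a0 (bmeas_qop Q b bh))).
      by apply: eq_Rintegral => x _; rewrite (qop_lin _ _ _ _ bg bh).
    rewrite mul1r -[Mg]mul1r -[leRHS]mul1r.
    exact: (bdP _ _ (bmeasM bH (bmeas_proc a0 (bmeas_qop Q b bg)))).
  - move=> B mB.
    have [mX _ /(_ a b B H a0 b0 mB pH) mk] := mkX.
    have mXB : measurable (X (a + b) @^-1` B).
      by rewrite -[X in measurable X]setTI; exact: mX.
    have -> : \int[P]_w (\1_H w * \1_B (X (a + b) w)) =
        \int[P]_w (\1_(H `&` X (a + b) @^-1` B) w).
      by apply: eq_Rintegral => w _; rewrite indicI.
    rewrite Rintegral_indic//; last exact: measurableI.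
    transitivity (fine (\int[P]_(w in H) Q b (X a w) B)%E).
      exact: (congr1 fine mk).
    rewrite integral_mkcond; congr fine; apply: eq_integral => w _.
    rewrite patchE indicE; case: ifPn => wH; last by rewrite mul0r.
    rewrite mul1r /qop Rintegral_indic// fineK//; exact: pker_fin_num.
have bfab := bmeas_proc ab0 bf.
have bqf := bmeas_proc a0 (bmeas_qop Q b bf).
have toOm := @past_bmeas_bmeas a.
have ext := @bfunctional_ext R _ (g_sigma_algebraType (past_gen a))
    (fun G => \int[P]_w (G w * f (X (a + b) w)))
    (fun G => \int[P]_w (G w * qop Q b f (X a w))) M'.
apply: (ext _ _ _ G M bG).
- split=> [g Mg h Mh c /toOm bg /toOm bh|g Mg /toOm bg].
    rewrite -(linP _ _ _ _ c (bmeasM bg bfab) (bmeasM bh bfab)).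
    by apply: eq_Rintegral => x _ /=; ring.
  rewrite mulrC -[leRHS]mul1r; exact: (bdP _ _ (bmeasM bg bfab)).
- split=> [g Mg h Mh c /toOm bg /toOm bh|g Mg /toOm bg].
    rewrite -(linP _ _ _ _ c (bmeasM bg bqf) (bmeasM bh bqf)).
    by apply: eq_Rintegral => x _ /=; ring.
  rewrite mulrC -[leRHS]mul1r; exact: (bdP _ _ (bmeasM bg bqf)).
- by move=> H mH; exact: HH.
Qed.

(** Backward recursion for the expectation of a product of functions of the positions at the times
    [0, h, 2h, ...], given the starting point. *)
Fixpoint chainQ (h : R) (fs : seq (S -> R)) : S -> R :=
  if fs is f :: fs' then fun x => f x * qop Q h (chainQ h fs') x else fun=> 1.

Fixpoint path_prod (a h : R) (fs : seq (S -> R)) (w : Om) : R :=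
  if fs is f :: fs' then f (X a w) * path_prod (a + h) h fs' w else 1.

Definition bmeas1 (fs : seq (S -> R)) := forall f, List.In f fs -> bmeas f 1.

Lemma bmeas_chainQ h fs : bmeas1 fs -> bmeas (chainQ h fs) 1.
Proof.
elim: fs => [|f fs IH] bfs /=; first by have := @bmeas_cst R _ S 1; rewrite normr1.
rewrite -[1](mulr1 1); apply: bmeasM; first by apply: bfs; left.
by apply: bmeas_qop; apply: IH => g gfs; apply: bfs; right.
Qed.

Lemma bmeas_path_prod a h fs : 0 <= a -> 0 <= h -> bmeas1 fs ->
  bmeas (path_prod a h fs) 1.
Proof.
move=> + h0; elim: fs a => [|f fs IH] a a0 bfs /=.
  by have := @bmeas_cst R _ Om 1; rewrite normr1.
rewrite -[1](mulr1 1); apply: bmeasM.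
  by apply: bmeas_proc => //; apply: bfs; left.
by apply: IH; [rewrite addr_ge0|move=> g gfs; apply: bfs; right].
Qed.

(** [G] is arbitrary so that it can absorb the factors at earlier times as the induction moves along
    [fs]. *)
Lemma past_path_prod a h fs (G : Om -> R) M : 0 <= a -> 0 <= h ->
  past_bmeas a G M -> bmeas1 fs ->
  \int[P]_w (G w * path_prod a h fs w) = \int[P]_w (G w * chainQ h fs (X a w)).
Proof.
move=> + h0; elim: fs a G M => [//|f fs IH] a G M a0 bG bfs /=.
have bf : bmeas f 1 by apply: bfs; left.
have bfs' : bmeas1 fs by move=> g gfs; apply: bfs; right.
have bG' := past_bmeasM bG (past_bmeas_comp a0 bf).
under eq_Rintegral do rewrite mulrA.
have ah0 : 0 <= a + h by rewrite addr_ge0.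
have ah : a <= a + h by rewrite lerDl.
rewrite (IH _ _ _ ah0 (past_bmeas_le ah bG') bfs').
rewrite (markov_step a0 h0 bG' (bmeas_chainQ h bfs')).
by apply: eq_Rintegral => w _ /=; rewrite mulrA.
Qed.

Lemma path_prodE h fs x0 : 0 <= h -> bmeas1 fs -> {ae P, forall w, X 0 w = x0} ->
  \int[P]_w path_prod 0 h fs w = chainQ h fs x0.
Proof.
move=> h0 bfs X0.
have bone : past_bmeas 0 (fun=> 1) `|1| by exact: bmeas_cst.
have := past_path_prod (lexx 0) h0 bone bfs.
under eq_Rintegral do rewrite mul1r.
move=> ->.
have P1 : P setT = 1%E by exact: probability_setT.
rewrite -[RHS](Rintegral_prob_cst _ P1).
congr fine; apply: ae_eq_integral => //.
- apply/measurable_EFinP; under eq_fun do rewrite mul1r.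
  exact: (bmeas_proc (lexx 0) (bmeas_chainQ h bfs)).1.
- by apply: filterS X0 => w Xw _; rewrite mul1r Xw.
Qed.

End markov_product.

Section chain_limit.
Context {R : realType}.
Variables (s t : R).
Hypotheses (s0 : 0 < s) (t0 : 0 < t).

Lemma measurable_natnat (A : set (nat * nat)) : measurable A.
Proof.
have -> : A = \bigcup_n \bigcup_m
    (if (n, m) \in A then [set n] `*` [set m] else set0).
  apply/seteqP; split => [[n m] Anm|[n m] [i _ [j _]]].
    by exists n => //; exists m => //; rewrite mem_set.
  by case: ifPn => // /set_mem Aij [/= -> ->].
apply: bigcupT_measurable => n; apply: bigcupT_measurable => m.
by case: ifP => // _; exact: measurableX.
Qed.

Lemma bmeas_natnat (g : nat * nat -> R) (M : R) : (forall q, `|g q| <= M) -> bmeas g M.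
Proof. by move=> gM; split => // _ Y mY; exact: measurable_natnat. Qed.

Lemma bmeas_chain_gen (g : nat * nat -> R) (M : R) :
  bmeas g M -> bmeas (chain_gen s t g) (2 * M).
Proof. by move=> [_ gM]; apply: bmeas_natnat => q; exact: chain_gen_le. Qed.

Lemma bmeas_jump_gen (g : R * R -> R) (M : R) :
  bmeas g M -> bmeas (jump_gen s t g) (2 * M).
Proof.
move=> [mg gM]; split; first exact: measurable_jump_gen gM.
by move=> p; exact: jump_gen_le.
Qed.

Lemma cont_cvg_lin (g_ h_ : nat -> nat * nat -> R) (g h : R * R -> R) (c : R) :
  cont_cvg g_ g -> cont_cvg h_ h ->
  cont_cvg (fun K q => g_ K q + c * h_ K q) (fun p => g p + c * h p).
Proof.
move=> gg hh p qp e e0.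
have e20 : 0 < e / 2 by rewrite divr_gt0.
have ec0 : 0 < e / 2 / (`|c| + 1) by rewrite divr_gt0// ltr_wpDl.
have [d1 [K1 [d10 H1]]] := gg p qp _ e20.
have [d2 [K2 [d20 H2]]] := hh p qp _ ec0.
exists (Num.min d1 d2), (maxn K1 K2); split; first by rewrite lt_min d10.
move=> K q; rewrite geq_max !lt_min => /andP[k1 k2] /andP[a1 a2] /andP[b1 b2].
have := H1 K q k1 a1 b1; have := H2 K q k2 a2 b2 => h2 h1.
have -> : g_ K q + c * h_ K q - (g p + c * h p) = (g_ K q - g p) + c * (h_ K q - h p).
  by ring.
rewrite (le_trans (ler_normD _ _))// [leRHS](splitr e) lerD// normrM.
apply: (@le_trans _ _ ((`|c| + 1) * `|h_ K q - h p|)).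
  by rewrite ler_wpM2r// lerDl.
by rewrite mulrC -ler_pdivlMr// ltr_wpDl.
Qed.

Lemma cont_cvgM (g_ h_ : nat -> nat * nat -> R) (g h : R * R -> R) :
  (forall K q, `|g_ K q| <= 1) -> (forall p, `|h p| <= 1) ->
  cont_cvg g_ g -> cont_cvg h_ h ->
  cont_cvg (fun K q => g_ K q * h_ K q) (fun p => g p * h p).
Proof.
move=> g1 h1 gg hh p qp e e0.
have e20 : 0 < e / 2 by rewrite divr_gt0.
have [d1 [K1 [d10 H1]]] := gg p qp _ e20.
have [d2 [K2 [d20 H2]]] := hh p qp _ e20.
exists (Num.min d1 d2), (maxn K1 K2); split; first by rewrite lt_min d10.
move=> K q; rewrite geq_max !lt_min => /andP[k1 k2] /andP[a1 a2] /andP[b1 b2].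
have := H1 K q k1 a1 b1; have := H2 K q k2 a2 b2 => hh2 hh1.
have -> : g_ K q * h_ K q - g p * h p = g_ K q * (h_ K q - h p) + (g_ K q - g p) * h p.
  by ring.
rewrite (le_trans (ler_normD _ _))// [leRHS](splitr e) lerD// normrM.
  by rewrite (le_trans _ hh2)// ler_piMl.
by rewrite (le_trans _ hh1)// ler_piMr.
Qed.

Lemma cont_cvg_scale (f : R * R -> R) : continuous f ->
  cont_cvg (fun K q => f (scale_state K q)) f.
Proof.
move=> cf p _ e e0.
have /cvgrPdist_le /(_ _ e0) /nbhs_ballP[d /= d0 hd] := cf p.
exists d, 0%N; split => // K q _ q1 q2; rewrite distrC; apply: hd.
by split; rewrite /ball/= distrC.
Qed.

Lemma cont_cvg_iter (n : nat) (g_ : nat -> nat * nat -> R) (g : R * R -> R) (M : R) :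
  (forall K, bmeas (g_ K) M) -> bmeas g M -> cont_cvg g_ g ->
  cont_cvg (fun K => iterA (chain_gen s t) n (g_ K)) (iterA (jump_gen s t) n g).
Proof.
elim: n g_ g M => [//|n IH] g_ g M bg_ bg gg /=.
apply: (IH _ _ (2 * M)).
- by move=> K; exact: bmeas_chain_gen.
- exact: bmeas_jump_gen.
- by apply: (@chain_gen_cvg _ _ _ s0 t0 _ _ M) => //; [move=> K; exact: (bg_ K).2|exact: bg.1|exact: bg.2].
Qed.

Lemma measurable_quadrant : measurable (@quadrant R).
Proof.
have -> : @quadrant R = `[0, +oo[%classic `*` `[0, +oo[%classic.
  by apply/seteqP; split => -[x y]; rewrite /quadrant /= !in_itv/= !andbT.
by apply: measurableX; exact: measurable_itv.
Qed.

Variables (QK : nat -> R -> R.-pker (nat * nat)%type ~> (nat * nat)%type).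
Variables (Q : R -> R.-pker (R * R)%type ~> (R * R)%type).
Hypothesis sgK : forall K, transition_semigroup setT (QK K).
Hypothesis genK : forall K, has_generator setT (QK K) (chain_gen s t).
Hypothesis sgQ : transition_semigroup (@quadrant R) Q.
Hypothesis genQ : has_generator (@quadrant R) Q (jump_gen s t).

(** A multiple of the general term of the exponential series at [2 * x]. *)
Lemma cvg_pow_fact (M x : R) : M * 2 ^+ N * texp N x @[N --> \oo] --> 0.
Proof.
have -> : (fun N => M * 2 ^+ N * texp N x) = (fun N => M * exp_coeff (2 * x) N).
  by apply/funext => N; rewrite /texp /exp_coeff/= exprMn; ring.
rewrite -[X in _ --> X](mulr0 M); apply: cvgM; first exact: cvg_cst.
by apply: cvg_series_cvg_0; exact: is_cvg_series_exp_coeff.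
Qed.

(** All generators share the bound [2 * M], so one Taylor order [N] serves every [K] and the limit;
    the truncated sums converge by [cont_cvg_iter]. *)
Lemma cont_cvg_qop (h : R) (g_ : nat -> nat * nat -> R) (g : R * R -> R) (M : R) :
  0 <= h -> (forall K, bmeas (g_ K) M) -> bmeas g M -> cont_cvg g_ g ->
  cont_cvg (fun K => qop (QK K) h (g_ K)) (qop Q h g).
Proof.
move=> h0 bg_ bg gg p qp e e0.
have e30 : 0 < e / 3 by rewrite divr_gt0.
have [N _ /(_ N (leqnn N))] := (cvgrPdist_lt _ _).1 (cvg_pow_fact M h) _ e30.
rewrite sub0r normrN => hN.
have sumcvg : cont_cvg
    (fun K q => \sum_(n < N) texp n h * iterA (chain_gen s t) n (g_ K) q)
    (fun p => \sum_(n < N) texp n h * iterA (jump_gen s t) n g p).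
  elim: N {hN} => [|N IH].
    by move=> p' _ e' e'0; exists 1, 0%N; split => // K q _ _ _; rewrite !big_ord0 subrr normr0 ltW.
  have := cont_cvg_lin (texp N h) IH (cont_cvg_iter N bg_ bg gg).
  move=> H p' qp' e' e'0; have [d [K0 [d0 H']]] := H p' qp' e' e'0.
  exists d, K0; split => // K q k1 a b; rewrite !big_ord_recr/=; exact: H'.
have [d [K0 [d0 H]]] := sumcvg p qp _ e30.
exists d, K0; split => // K q k1 a b.
have a1 := H K q k1 a b.
have a2 := qop_taylor measurableT (sgK K) (genK K) bmeas_chain_gen N (bg_ K) h0 (I : setT q).
have a3 := qop_taylor measurable_quadrant sgQ genQ bmeas_jump_gen N bg h0 qp.
have hN' : M * 2 ^+ N * texp N h < e / 3 by rewrite (le_lt_trans _ hN)// ler_norm.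
set u := qop (QK K) h (g_ K) q in a2 *; set v := qop Q h g p in a3 *.
set u' := \sum_(n < N) _ in a1 a2; set v' := \sum_(n < N) _ in a1 a3.
have -> : u - v = (u - u') + (u' - v') - (v - v') by ring.
rewrite (le_trans (ler_normB _ _))// (le_trans (lerD (ler_normD _ _) (lexx _)))//.
lra.
Qed.

Lemma cont_cvg_chainQ (h : R) (fs : seq (R * R -> R)) : 0 <= h ->
  (forall f, List.In f fs -> continuous f /\ bmeas f 1) ->
  cont_cvg (fun K => chainQ (QK K) h (map (fun f q => f (scale_state K q)) fs))
           (chainQ Q h fs).
Proof.
move=> h0; elim: fs => [|f fs IH] hfs /=.
  by move=> p _ e e0; exists 1, 0%N; split => // K q _ _ _; rewrite subrr normr0 ltW.
have [cf bf] : continuous f /\ bmeas f 1 by apply: hfs; left.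
have hfs' g : List.In g fs -> continuous g /\ bmeas g 1 by move=> ?; apply: hfs; right.
have bK K : bmeas1 (map (fun f (q : nat * nat) => f (scale_state K q)) fs).
  move=> g /List.in_map_iff[g' [<- /hfs' [_ [_ g1]]]].
  by apply: bmeas_natnat => q.
have bfs : bmeas1 fs by move=> g /hfs'[].
have bQ := bmeas_chainQ Q h bfs.
have bQK K := bmeas_chainQ (QK K) h (bK K).
apply: cont_cvgM.
- by move=> K q; exact: bf.2.
- by move=> p; exact: qop_bound.
- exact: cont_cvg_scale.
- by apply: (@cont_cvg_qop _ _ _ 1) => //; exact: IH.
Qed.

End chain_limit.

(** * Time changes and step paths *)

Section time_changes.
Context {R : realType}.

Lemma time_change_id : time_change (id : R -> R).
Proof. by split => //; rewrite image_id. Qed.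

Lemma time_change_ge0 (lam : R -> R) t : time_change lam -> 0 <= t -> 0 <= lam t.
Proof.
move=> [_ im] t0; have : (lam @` `[0, +oo[%classic) (lam t).
  by exists t => //=; rewrite in_itv/= t0.
by rewrite im/= in_itv/= andbT.
Qed.

Lemma time_change_comp (lam lam' : R -> R) :
  time_change lam -> time_change lam' -> time_change (lam' \o lam).
Proof.
move=> tc tc'; have [mono im] := tc; have [mono' im'] := tc'; split.
  move=> x y; rewrite !in_itv/= !andbT => x0 y0 xy.
  apply: mono'; rewrite ?in_itv/= ?andbT ?time_change_ge0//.
  by apply: mono; rewrite ?in_itv/= ?andbT.
by rewrite -image_comp im im'.
Qed.

(* Identity up to [p], then linear from [[p, p + al]] onto [[p, p + be]], then a
   translation. *)
Definition stretch (p al be y : R) : R :=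
  if y <= p then y else if y <= p + al then p + (y - p) * (be / al) else y + (be - al).

Lemma stretch_time_change (p al be : R) : 0 <= p -> 0 < al -> 0 < be ->
  time_change (stretch p al be).
Proof.
move=> p0 al0 be0.
have r0 : 0 < be / al by rewrite divr_gt0.
have ral : al * (be / al) = be by rewrite mulrC divfK// gt_eqF.
split.
  move=> x y _ _ xy; rewrite /stretch.
  have [xp|px] := leP x p.
    have [yp|py] := leP y p => //.
    have [yq|qy] := leP y (p + al); last by lra.
    by rewrite (le_lt_trans xp)// ltrDl mulr_gt0// subr_gt0.
  have py : p < y by exact: lt_trans xy.
  rewrite (leNgt y) py/=.
  have [xq|qx] := leP x (p + al).
    have [yq|qy] := leP y (p + al).
      by rewrite ltrD2l ltr_pM2r// ltrD2r.
    have : (x - p) * (be / al) <= be.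
      by rewrite -[leRHS]ral ler_pM2r//; lra.
    by move: ((x - p) * _) => w; lra.
  by rewrite leNgt (lt_trans qx)//= ltrD2r.
apply/seteqP; split => [_ [x /= + <-]|y /=]; rewrite !in_itv/= !andbT.
  move=> x0; rewrite /stretch; have [//|px] := leP x p.
  have [xq|qx] := leP x (p + al); last by lra.
  by rewrite addr_ge0// mulr_ge0 ?(ltW r0)// subr_ge0 ltW.
move=> y0.
have [yp|py] := leP y p.
  by exists y; rewrite /= ?in_itv/= ?andbT// /stretch yp.
have [yq|qy] := leP y (p + be).
  exists (p + (y - p) * (al / be)).
    by rewrite /= in_itv/= andbT addr_ge0// mulr_ge0 ?divr_ge0 ?(ltW al0) ?(ltW be0)// subr_ge0 ltW.
  rewrite /stretch ifN; last by rewrite -ltNge ltrDl mulr_gt0 ?divr_gt0// subr_gt0.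
  rewrite ifT; last first.
    rewrite lerD2l mulrCA ger_pMr// ler_pdivrMr// mul1r; lra.
  have -> : p + (p + (y - p) * (al / be) - p) * (be / al) =
      p + (y - p) * ((al / be) * (be / al)) by ring.
  have -> : al / be * (be / al) = 1.
    by rewrite mulrA divfK ?gt_eqF// mulfV ?gt_eqF.
  by rewrite mulr1; lra.
exists (y - (be - al)).
  by rewrite /= in_itv/= andbT; lra.
rewrite /stretch ifN; last by rewrite -ltNge; lra.
by rewrite ifN; [lra|rewrite -ltNge; lra].
Qed.

(** Piecewise linear interpolation sending [a i] to [b i], built by composing one [stretch] per
    cell. *)
Lemma time_change_steps (N : nat) (a b : nat -> R) (c : R) :
  a 0%N = 0 -> b 0%N = 0 -> 0 <= c ->
  (forall i, (i < N)%N -> a i < a i.+1) -> (forall i, (i < N)%N -> b i < b i.+1) ->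
  (forall i, (i <= N)%N -> `|a i - b i| <= c) ->
  exists lam : R -> R, [/\ time_change lam,
    forall t, 0 <= t -> `|lam t - t| <= c &
    forall i t, (i < N)%N -> a i <= t -> t < a i.+1 -> b i <= lam t /\ lam t < b i.+1].
Proof.
move=> a0 b0 c0 ainc binc abc.
(* The induction needs two more clauses: [lam] is a translation beyond [a N], where the next stretch
   acts, and stays below [b N] before, where that stretch is the identity. *)
suff : exists lam : R -> R, [/\ time_change lam,
    forall t, 0 <= t -> `|lam t - t| <= c,
    forall i t, (i < N)%N -> a i <= t -> t < a i.+1 -> b i <= lam t /\ lam t < b i.+1,
    forall t, a N <= t -> lam t = b N + (t - a N) &
    forall t, 0 <= t -> t < a N -> lam t < b N].
  by move=> [lam [? ? ? _ _]]; exists lam.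
elim: N ainc binc abc => [|N IH] ainc binc abc.
  exists id; split => //.
  - exact: time_change_id.
  - by move=> t t0; rewrite subrr normr0.
  - by move=> t _; rewrite a0 b0; lra.
  - by move=> t t0; rewrite a0 ltNge t0.
have [|||lam [tc lc lst lN lN']] := IH.
- by move=> i iN; exact/ainc/ltnW.
- by move=> i iN; exact/binc/ltnW.
- by move=> i iN; apply: abc; rewrite (leq_trans iN).
have bge0 i : (i <= N.+1)%N -> 0 <= b i.
  elim: i => [|i IHi] iN; first by rewrite b0.
  by rewrite (le_trans (IHi (ltnW iN)))// ltW// binc.
have age0 i : (i <= N.+1)%N -> 0 <= a i.
  elim: i => [|i IHi] iN; first by rewrite a0.
  by rewrite (le_trans (IHi (ltnW iN)))// ltW// ainc.
pose al := a N.+1 - a N; pose be := b N.+1 - b N.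
have al0 : 0 < al by rewrite subr_gt0 ainc.
have be0 : 0 < be by rewrite subr_gt0 binc.
have r0 : 0 < be / al by rewrite divr_gt0.
have tcs := stretch_time_change (bge0 N (leqnSn N)) al0 be0.
pose mu := stretch (b N) al be.
have early t : 0 <= t -> t < a N -> mu (lam t) = lam t.
  by move=> t0 tN; rewrite /mu /stretch ltW// lN'.
have at_N t : a N <= t -> t < a N.+1 -> mu (lam t) = b N + (t - a N) * (be / al).
  move=> tN tN1; rewrite /mu /stretch lN//.
  have [h|h] := leP (b N + (t - a N)) (b N).
    have -> : t - a N = 0 by lra.
    by rewrite mul0r.
  rewrite ifT; last by rewrite /al; lra.
  by congr (_ + _ * _); lra.
have late t : a N.+1 <= t -> mu (lam t) = b N.+1 + (t - a N.+1).
  move=> tN1; have aN := ainc N (leqnn _).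
  rewrite /mu /stretch lN; last by lra.
  rewrite ifN; last by rewrite -ltNge; lra.
  have [h|h] := leP (b N + (t - a N)) (b N + al); last by rewrite /al /be; lra.
  have -> : t = a N.+1 by rewrite /al in h; lra.
  rewrite addrAC subrr add0r -/al mulrC divfK ?gt_eqF//.
  by rewrite /be; lra.
exists (mu \o lam); split => /=.
- exact: time_change_comp.
- move=> t t0; have [tN|tN] := ltP t (a N).
    by rewrite early//; exact: lc.
  have [tN1|tN1] := ltP t (a N.+1); last first.
    rewrite late//; have := abc _ (leqnn N.+1).
    by rewrite distrC; congr (`|_| <= _); lra.
  rewrite at_N//.
  have h1 := abc N (leqnSn N); have h2 := abc _ (leqnn N.+1).
  (* Inside a cell the displacement is a convex combination of those at its two ends, hence still at
     most [c]. *)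
  pose th := (t - a N) / al.
  have th0 : 0 <= th by apply: divr_ge0; [rewrite subr_ge0|exact: ltW].
  have th1 : th <= 1 by rewrite ler_pdivrMr// mul1r /al; lra.
  have -> : b N + (t - a N) * (be / al) - t =
      (1 - th) * (b N - a N) + th * (b N.+1 - a N.+1).
    have tE : t = a N + th * al by rewrite /th divfK ?gt_eqF//; lra.
    have -> : (t - a N) * (be / al) = th * be by rewrite /th; ring.
    by rewrite {1}tE /al /be; ring.
  clearbody th.
  rewrite (le_trans (ler_normD _ _))// !normrM (ger0_norm th0).
  rewrite (ger0_norm (_ : 0 <= 1 - th)); last by lra.
  rewrite distrC in h1; rewrite distrC in h2.
  have : (1 - th) * `|b N - a N| <= (1 - th) * c by rewrite ler_wpM2l//; lra.
  have : th * `|b N.+1 - a N.+1| <= th * c by rewrite ler_wpM2l.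
  by move: (_ * `|_|) ((1 - th) * `|_|) => u v; lra.
- move=> i t; rewrite ltnS leq_eqVlt => /predU1P[->|iN] ai tai.
    rewrite at_N// lerDl mulr_ge0 ?subr_ge0 ?(ltW r0)//; split => //.
    have : (t - a N) * (be / al) < be.
      by rewrite mulrA ltr_pdivrMr// mulrC ltr_pM2l// /al; lra.
    by rewrite /be; lra.
  have t0 : 0 <= t by rewrite (le_trans _ ai)// age0// (leq_trans (ltnW iN)).
  have mono j : (i.+1 + j <= N)%N -> a i.+1 <= a (i.+1 + j)%N.
    elim: j => [|j IHj] ij; first by rewrite addn0.
    rewrite addnS in ij *; rewrite (le_trans (IHj (ltnW ij)))// ltW// ainc//.
    exact: ltnW.
  have tN : t < a N.
    by rewrite (lt_le_trans tai)// -(subnKC iN) mono// subnKC.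
  by rewrite early//; exact: lst.
- exact: late.
- move=> t t0 tN1; have [tN|tN] := ltP t (a N).
    rewrite early// (lt_trans (lN' _ t0 tN))//; exact: binc.
  rewrite at_N//.
  have : (t - a N) * (be / al) < be.
    by rewrite mulrA ltr_pdivrMr// mulrC ltr_pM2l// /al; lra.
  by rewrite /be; lra.
Qed.

End time_changes.

Section step_paths.
Context {R : realType} {V : pseudoMetricType R}.

(** Right endpoints of finite partitions from 0 into half-open cells of oscillation below [e]. As an
    inductive predicate it extends by one cell without any count of cells. *)
Inductive osc_part (z : R -> V) (e : R) : R -> Prop :=
| osc_part0 : osc_part z e 0
| osc_partS a b : osc_part z e a -> a < b ->
    (forall u v, a <= u -> u < b -> a <= v -> v < b -> ball (z u) e (z v)) ->
    osc_part z e b.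

Lemma osc_part_ge0 (z : R -> V) (e b : R) : osc_part z e b -> 0 <= b.
Proof. by elim => // a b' _ a0 ab _; rewrite (le_trans a0)// ltW. Qed.

(** If the endpoints were bounded, their supremum would itself be an endpoint, by the left limit
    there; but right continuity carries a partition past any endpoint. *)
Lemma cadlag_osc_part (z : R -> V) (e T : R) : cadlag z -> 0 < e ->
  exists2 b, T < b & osc_part z e b.
Proof.
move=> [_ zr zl] e0; apply: contrapT => bad.
have e20 : 0 < e / 2 by rewrite divr_gt0.
have tri (x u v : V) : ball x (e / 2) u -> ball x (e / 2) v -> ball u e v.
  by move=> xu xv; apply: ball_splitr xu xv.
have step a : osc_part z e a -> exists2 b, a < b & osc_part z e b.
  move=> oa; have a0 := osc_part_ge0 oa.
  have /fcvg_ballP/(_ _ e20) [del /= del0 hdel] := zr a a0.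
  exists (a + del); first by rewrite ltrDl.
  apply: osc_partS oa _ _; first by rewrite ltrDl.
  have near u : a <= u -> u < a + del -> ball (z a) (e / 2) (z u).
    rewrite le_eqVlt => /predU1P[<- _|au uad]; first exact: ballxx.
    apply: hdel => //=; rewrite ltr_norml; apply/andP; split; lra.
  by move=> u v au ub av vb; apply: (tri (z a)); exact: near.
pose A : set R := [set b | osc_part z e b].
have supA : has_sup A.
  split; first by exists 0; exact: osc_part0.
  exists T => b Ab; rewrite leNgt; apply/negP => Tb; apply: bad.
  by exists b.
have nosup : ~ A (sup A).
  move=> /step[b sb Ab]; have := sup_upper_bound supA Ab.
  by rewrite leNgt sb.
have sup0 : 0 < sup A.
  rewrite lt_neqAle (sup_upper_bound supA (osc_part0 z e)) andbT.
  by apply/eqP => sup0; apply: nosup; rewrite -sup0; exact: osc_part0.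
have [l /fcvg_ballP/(_ _ e20) [del /= del0 hdel]] := zl _ sup0.
have [a Aa adel] := sup_adherent del0 supA.
have asup : a < sup A.
  rewrite lt_neqAle (sup_upper_bound supA Aa) andbT.
  by apply/eqP => aE; apply: nosup; rewrite -aE.
apply: nosup; apply: osc_partS Aa asup _ => u v au ub av vb.
by apply: (tri l); apply: hdel => //=; rewrite ltr_norml; apply/andP; split; lra.
Qed.

Lemma osc_part_seq (z : R -> V) (e T : R) : osc_part z e T ->
  exists (N : nat) (b : nat -> R), [/\ b 0%N = 0, b N = T,
    forall i, (i < N)%N -> b i < b i.+1 &
    forall i u v, (i < N)%N -> b i <= u -> u < b i.+1 -> b i <= v -> v < b i.+1 ->
      ball (z u) e (z v)].
Proof.
elim => [|a b _ [N [b_ [b0 bN binc bosc]]] ab osc].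
  by exists 0%N, (fun=> 0); split.
exists N.+1, (fun i => if (i <= N)%N then b_ i else b); split => //.
- by rewrite ltnn.
- move=> i; rewrite ltnS => iN; have [->|iN'] := eqVneq i N.
    by rewrite leqnn ltnn bN.
  have {}iN : (i < N)%N by rewrite ltn_neqAle iN'.
  by rewrite iN (ltnW iN); exact: binc.
- move=> i u v; rewrite ltnS => iN; have [->|iN'] := eqVneq i N.
    by rewrite leqnn ltnn bN; exact: osc.
  have {}iN : (i < N)%N by rewrite ltn_neqAle iN'.
  by rewrite iN (ltnW iN); exact: bosc.
Qed.

Lemma locate_step (a : nat -> R) (N : nat) (t : R) : a 0%N <= t -> t < a N ->
  exists i, [/\ (i < N)%N, a i <= t & t < a i.+1].
Proof.
move=> a0; elim: N => [|N IH] tN; first by rewrite ltNge a0 in tN.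
have [/IH[i [iN ? ?]]|aN] := ltP t (a N); last by exists N.
by exists i; split => //; exact: ltnW.
Qed.

Lemma natceil_ex (x : R) : 0 <= x -> exists c : nat, x <= c%:R /\ c%:R < x + 1.
Proof.
move=> x0; have := truncn_itv x0; rewrite -natr1 => /andP[c1 c2].
have [cx|cx] := eqVneq ((Num.truncn x)%:R) x.
  by exists (Num.truncn x); rewrite cx lexx ltrDl.
exists (Num.truncn x).+1; rewrite -natr1 ltrD2r lt_neqAle cx c1; split => //.
exact: ltW.
Qed.

(** [Num.truncn] is 0 on negative reals, which gives the constant extension to negative times
    required by [cadlag]. *)
Definition step_fun (n : nat) (v : nat -> V) (t : R) : V :=
  v (Num.truncn (t * n.+1%:R)).

Lemma step_cadlag (n : nat) (v : nat -> V) : cadlag (step_fun n v).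
Proof.
have n0 : 0 < n.+1%:R :> R by [].
split=> t t0; rewrite /step_fun.
- rewrite mul0r truncn0; congr v.
  apply/truncn0Pn; rewrite -ltNge; apply: (@lt_trans _ _ 0) => //.
  by rewrite pmulr_llt0.
- apply: cvg_near_cst; near=> u.
  have tu : t < u by near: u; exact: nbhs_right_gt.
  have := truncn_itv (mulr_ge0 t0 (ltW n0)) => /andP[h1 h2].
  congr v; apply: truncn_def; apply/andP; split.
    by rewrite (le_trans h1)// ler_pM2r// ltW.
  rewrite -ltr_pdivlMr//; near: u; apply: nbhs_right_lt.
  by rewrite ltr_pdivlMr// truncnS_gt.
(* Just left of [t] the index is the ceiling of [t * n.+1%:R] minus one, also when [t] is a grid
   point. *)
- have [c [c1 c2]] := natceil_ex (mulr_ge0 (ltW t0) (ltW n0)).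
  have c0 : (0 < c)%N.
    by rewrite -(ltr_nat R) (lt_le_trans _ c1)// mulr_gt0.
  exists (v c.-1); apply: cvg_near_cst; near=> u.
  have ut : u < t by near: u; exact: nbhs_left_lt.
  congr v; apply: truncn_def; rewrite prednK//; apply/andP; split; last first.
    by rewrite (lt_le_trans _ c1)// ltr_pM2r.
  rewrite -ler_pdivrMr//; near: u; apply: nbhs_left_ge.
  rewrite ltr_pdivrMr//; move: c2; rewrite -{1}(prednK c0) -natr1; lra.
Unshelve. all: by end_near.
Qed.

Definition step_path n v : cadlag_path R V := CadlagPath (step_cadlag n v).

(* The time change maps the oscillation partition [b] to its image rounded up to
   the grid; it moves each time by at most one mesh. *)
Lemma step_approx (z : R -> V) (e : R) (n N : nat) (b : nat -> R) (c : nat -> nat) :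
  b 0%N = 0 -> c 0%N = 0%N ->
  (forall i, (i < N)%N -> b i < b i.+1) -> (forall i, (i < N)%N -> (c i < c i.+1)%N) ->
  (forall i, (i <= N)%N -> b i * n.+1%:R <= (c i)%:R /\ (c i)%:R < b i * n.+1%:R + 1) ->
  (forall i u v, (i < N)%N -> b i <= u -> u < b i.+1 -> b i <= v -> v < b i.+1 ->
      ball (z u) e (z v)) ->
  let w := step_fun n (fun k => z (k%:R / n.+1%:R)) in
  (exists lam, [/\ time_change lam, forall t, 0 <= t -> `|lam t - t| <= n.+1%:R^-1 &
     forall t, 0 <= t -> t < (c N)%:R / n.+1%:R -> ball (w t) e (z (lam t))]) /\
  (exists lam, [/\ time_change lam, forall t, 0 <= t -> `|lam t - t| <= n.+1%:R^-1 &
     forall t, 0 <= t -> t < b N -> ball (z t) e (w (lam t))]).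
Proof.
move=> b0 c0 binc cinc bc osc w.
have n0 : 0 < n.+1%:R :> R by [].
have n0' : 0 <= n.+1%:R^-1 :> R by rewrite invr_ge0.
pose a i : R := (c i)%:R / n.+1%:R.
have a0 : a 0%N = 0 by rewrite /a c0 mul0r.
have ainc i : (i < N)%N -> a i < a i.+1.
  by move=> iN; rewrite /a ltr_pM2r ?invr_gt0// ltr_nat cinc.
have ab i : (i <= N)%N -> `|a i - b i| <= n.+1%:R^-1.
  move=> iN; have [h1 h2] := bc i iN.
  have -> : a i - b i = ((c i)%:R - b i * n.+1%:R) / n.+1%:R.
    by rewrite /a mulrBl mulfK ?gt_eqF.
  rewrite normrM (ger0_norm n0') ler_piMl// ger0_norm; lra.
have bge0 i : (i <= N)%N -> 0 <= b i.
  elim: i => [|i IHi] iN; first by rewrite b0.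
  by rewrite (le_trans (IHi (ltnW iN)))// ltW// binc.
(* As the [c i] are rounded up, an index [k] from [c i] to [c i.+1 - 1] has its sampling time
   between [b i] and [b i.+1], in the oscillation cell of [u]. *)
have wE i t u : (i < N)%N -> 0 <= t -> a i <= t -> t < a i.+1 -> b i <= u -> u < b i.+1 ->
    ball (w t) e (z u).
  move=> iN t0 ait tai bu ub; rewrite /w /step_fun.
  have := truncn_itv (mulr_ge0 t0 (ltW n0)).
  move: ait tai; rewrite /a ler_pdivrMr// ltr_pdivlMr//.
  set k := Num.truncn _ => h1 h2 /andP[h3 h4].
  have ck : (c i <= k)%N by rewrite -ltnS -(ltr_nat R) (le_lt_trans h1).
  have kc : (k < c i.+1)%N by rewrite -(ltr_nat R) (le_lt_trans h3).
  have [b1 b2] := bc i (ltnW iN); have [b3 b4] := bc _ iN.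
  apply: (osc i) => //.
    by rewrite ler_pdivlMr// (le_trans b1)// ler_nat.
  rewrite ltr_pdivrMr//; move: kc; rewrite -(ler_nat R) -natr1; lra.
split.
  have [lam [tc lamc lams]] := time_change_steps a0 b0 n0' ainc binc ab.
  exists lam; split => // t t0 tN.
  have [|i [iN ai ia]] := @locate_step a N t _ tN; first by rewrite a0.
  have [l1 l2] := lams i t iN ai ia.
  exact: wE ai ia l1 l2.
have [|lam [tc lamc lams]] := time_change_steps b0 a0 n0' binc ainc.
  by move=> i iN; rewrite distrC; exact: ab.
exists lam; split => // t t0 tN.
have [|i [iN bi ib]] := @locate_step b N t _ tN; first by rewrite b0.
have [l1 l2] := lams i t iN bi ib.
apply: ball_sym; apply: wE l1 l2 bi ib => //.
exact: time_change_ge0.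
Qed.

End step_paths.

(** * Skorokhod closeness of a path and its samples *)

Section skorokhod_approximation.
Context {R : realType} {V : pseudoMetricType R}.
Implicit Types x y w : cadlag_path R V.

(** The first time change can carry a time [t <= T] up to [T + e], so the second neighbourhood needs
    a longer horizon. *)
Lemma skorokhod_nbhd_trans (T T' e e' : R) x y w : T + e <= T' ->
  skorokhod_nbhd T e x y -> skorokhod_nbhd T' e' y w ->
  skorokhod_nbhd T (e + e') x w.
Proof.
move=> TT' [lam [tc lc lb]] [mu [tc' mc mb]].
exists (mu \o lam); split => [|t t0|t t0 tT] /=.
- exact: time_change_comp.
- have := lc t t0; have := mc (lam t) (time_change_ge0 tc t0).
  have -> : mu (lam t) - t = (mu (lam t) - lam t) + (lam t - t) by ring.
  by have := ler_normD (mu (lam t) - lam t) (lam t - t); lra.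
- apply: ball_triangle (lb t t0 tT) _; apply: mb; first exact: time_change_ge0.
  by have := lc t t0; rewrite ltr_norml => /andP[_]; lra.
Qed.

Lemma skorokhod_nbhd_step (T e : R) (n N : nat) (v v' : nat -> V) : 0 < e ->
  T * n.+1%:R < N.+1%:R -> (forall k, (k <= N)%N -> ball (v k) e (v' k)) ->
  skorokhod_nbhd T e (step_path n v) (step_path n v').
Proof.
move=> e0 TN vv'; exists id; split => [|t t0|t t0 tT].
- exact: time_change_id.
- by rewrite subrr normr0.
- apply: vv'; rewrite -ltnS truncn_lt_nat; last exact: mulr_ge0.
  by rewrite (le_lt_trans _ TN)// ler_pM2r.
Qed.

Definition sample n (z : R -> V) (k : nat) : V := z (k%:R / n.+1%:R).

Lemma min_gap (b : nat -> R) (N : nat) : (forall i, (i < N)%N -> b i < b i.+1) ->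
  exists2 d : R, 0 < d & forall i, (i < N)%N -> b i + d <= b i.+1.
Proof.
elim: N => [|N IH] binc; first by exists 1.
have [i iN|d d0 hd] := IH; first exact/binc/ltnW.
exists (Num.min d (b N.+1 - b N)).
  by rewrite lt_min d0 subr_gt0 binc.
move=> i; rewrite ltnS => iN; have [->|iN'] := eqVneq i N.
  by rewrite -lerBrDl ge_min lexx orbT.
have {}iN : (i < N)%N by rewrite ltn_neqAle iN'.
by rewrite -lerBrDl ge_min lerBrDl hd.
Qed.

(** Once the mesh is below the smallest gap of an oscillation partition, rounding its points up to
    the grid keeps them distinct. Both directions are stated because [skorokhod_nbhd] is not
    symmetric. *)
Lemma step_path_near (z : cadlag_path R V) (T e : R) : 0 < e ->
  \forall n \near \oo, skorokhod_nbhd T e z (step_path n (sample n z)) /\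
    skorokhod_nbhd T e (step_path n (sample n z)) z.
Proof.
move=> e0; have [B TB /osc_part_seq[N [b [b0 bN binc osc]]]] :=
  cadlag_osc_part T (path_cadlag z) e0.
have [d d0 hd] := min_gap binc.
have de0 : 0 < Num.min d e by rewrite lt_min d0.
near=> n.
have : n.+1%:R^-1 < Num.min d e by near: n; exact: near_infty_natSinv_lt (PosNum de0).
rewrite lt_min => /andP[nd ne].
have n0 : 0 < n.+1%:R :> R by [].
have bge0 i : (i <= N)%N -> 0 <= b i.
  elim: i => [|i IHi] iN; first by rewrite b0.
  by rewrite (le_trans (IHi (ltnW iN)))// ltW// binc.
have /choice[c hc] : forall i, exists c : nat, (i <= N)%N ->
    b i * n.+1%:R <= c%:R /\ c%:R < b i * n.+1%:R + 1.
  move=> i; have [iN|_] := leqP i N; last by exists 0%N.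
  by have [c hc] := natceil_ex (mulr_ge0 (bge0 i iN) (ltW n0)); exists c.
have c0 : c 0%N = 0%N.
  have [//|_] := hc 0%N; rewrite b0 mul0r add0r (ltr_nat R _ 1) ltnS leqn0.
  by move/eqP.
have cinc i : (i < N)%N -> (c i < c i.+1)%N.
  move=> iN; have [_ h1] := hc i (ltnW iN); have [h2 _] := hc _ iN.
  rewrite -(ltr_nat R) (lt_le_trans h1)// (le_trans _ h2)//.
  have := hd i iN; rewrite -(ler_pM2r n0) mulrDl; apply: le_trans.
  rewrite lerD2l -ler_pdivrMr// div1r; exact: ltW.
have [[lam [tc lc lb]] [mu [tc' mc mb]]] := step_approx b0 c0 binc cinc hc osc.
split; [exists mu|exists lam]; split => // t t0.
- exact: le_lt_trans (mc t t0) ne.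
- by move=> tT; apply: mb => //; rewrite bN; exact: le_lt_trans TB.
- exact: le_lt_trans (lc t t0) ne.
- move=> tT; apply: lb => //; rewrite ltr_pdivlMr//.
  have [h _] := hc N (leqnn _); rewrite (lt_le_trans _ h)// ltr_pM2r// bN.
  exact: le_lt_trans TB.
Unshelve. all: by end_near.
Qed.

End skorokhod_approximation.

Lemma cadlag_bounded {R : realType} (z : R -> R * R) (T : R) : cadlag z ->
  exists M : R, forall t, 0 <= t -> t <= T -> `|(z t).1| <= M /\ `|(z t).2| <= M.
Proof.
move=> cz; have [b Tb ob] := cadlag_osc_part T cz ltr01.
suff [M hM] : exists M : R, forall t, 0 <= t -> t < b ->
    `|(z t).1| <= M /\ `|(z t).2| <= M.
  by exists M => t t0 tT; apply: hM => //; exact: le_lt_trans Tb.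
elim: ob => [|a {}b {Tb} _ [M hM] ab osc].
  by exists 0 => t t0; rewrite ltNge t0.
exists (Num.max M (Num.max (`|(z a).1| + 1) (`|(z a).2| + 1))) => t t0 tb.
have [/(hM t t0)[h1 h2]|at_] := ltP t a; first by rewrite !le_max h1 h2.
have [/= b1 b2] := osc a t (lexx a) ab at_ tb.
by split; rewrite !le_max; apply/orP; right; apply/orP; [left|right];
  rewrite -lerBlDl (le_trans (lerB_dist _ _))// distrC ltW.
Qed.

(** * Paths with at most one change per cell *)

Section piecewise_constant.
Context {R : realType} {V : Type}.
Variable X : R -> V.
Hypothesis rcX : forall t : R, 0 <= t -> exists2 del : R, 0 < del &
  forall u, t <= u -> u < t + del -> X u = X t.

Definition two_changes (a b : R) : Prop := exists u v w : R,
  [/\ a <= u, u < v, v < w, w <= b & X u <> X v /\ X v <> X w].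

Lemma one_change (a b : R) : 0 <= a -> a < b -> ~ two_changes a b ->
  (forall u, a <= u -> u <= b -> X u = X a) \/
  exists sg, [/\ a < sg, sg <= b, forall u, a <= u -> u < sg -> X u = X a &
    forall u, sg <= u -> u <= b -> X u = X sg].
Proof.
move=> a0 ab two.
have [cst|] := pselect (forall u, a <= u -> u <= b -> X u = X a); first by left.
move=> /existsNP[u0 /not_implyP[au0 /not_implyP[u0b Xu0]]]; right.
pose C : set R := [set u | [/\ a <= u, u <= b & X u <> X a]].
have infC : has_inf C by split; [exists u0|exists a => u []].
have aC : a <= inf C by apply: lb_le_inf; [exists u0|move=> u []].
have lowC u : C u -> inf C <= u by move=> Cu; exact: (ge_inf infC.2).
have before u : a <= u -> u < inf C -> X u = X a.
  move=> au uC; apply: contrapT => Xu.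
  have ub : u <= b by have := lowC u0 (And3 au0 u0b Xu0); lra.
  by have := lowC u (And3 au ub Xu); rewrite leNgt uC.
have [del del0 hdel] := rcX (le_trans a0 aC).
have XC : X (inf C) <> X a.
  move=> XC; have [v [av vb Xv]] := inf_adherent del0 infC.
  move=> vC; have Cv := lowC v (And3 av vb Xv).
  by apply: Xv; rewrite -XC; exact: hdel.
have sb : inf C <= b by rewrite (le_trans (lowC _ (And3 au0 u0b Xu0))).
have as_ : a < inf C.
  by rewrite lt_neqAle aC andbT; apply/eqP => h; apply: XC; rewrite -h.
exists (inf C); split => // u su ub; apply: contrapT => Xu; apply: two.
exists a, (inf C), u; split => //; last by split; apply: nesym.
by rewrite lt_neqAle su andbT; apply/eqP => h; apply: Xu; rewrite h.
Qed.

Definition cells_ok (n m : nat) := forall k, (k < m)%N ->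
  ~ two_changes (k%:R / n.+1%:R) (k.+1%:R / n.+1%:R).

(** The partition data wanted by [step_approx], with constancy on the cells in place of small
    oscillation. *)
Definition jump_times (n N : nat) (b : nat -> R) (c : nat -> nat) : Prop :=
  [/\ b 0%N = 0, c 0%N = 0%N,
    forall i, (i < N)%N -> b i < b i.+1 /\ (c i < c i.+1)%N,
    forall i, (i <= N)%N -> b i * n.+1%:R <= (c i)%:R /\ (c i)%:R < b i * n.+1%:R + 1 &
    forall i u, (i < N)%N -> b i <= u -> u < b i.+1 -> X u = X (b i)].

Lemma jump_times_rcons n N b c b' c' : jump_times n N b c ->
  b N < b' -> (c N < c')%N -> b' * n.+1%:R <= c'%:R -> c'%:R < b' * n.+1%:R + 1 ->
  (forall u, b N <= u -> u < b' -> X u = X (b N)) ->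
  jump_times n N.+1 (fun i => if (i <= N)%N then b i else b')
                    (fun i => if (i <= N)%N then c i else c').
Proof.
move=> [b0 c0 inc bc cst] bb cc c1 c2 cst'; split => //.
- move=> i; rewrite ltnS => iN; rewrite iN; have [->|iN'] := eqVneq i N.
    by rewrite ltnn.
  by have -> : (i < N)%N; [rewrite ltn_neqAle iN'|apply: inc; rewrite ltn_neqAle iN'].
- by move=> i; have [iN _|//] := leqP i N; exact: bc.
- move=> i u; rewrite ltnS => iN; rewrite iN; have [->|iN'] := eqVneq i N.
    by rewrite ltnn; exact: cst'.
  by have -> : (i < N)%N; [rewrite ltn_neqAle iN'|apply: cst; rewrite ltn_neqAle iN'].
Qed.

(** The only possible change in cell [m] rounds up to [m.+1], beyond all earlier indices; this keeps
    [c] strictly increasing. *)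
Lemma jump_times_ex n m : cells_ok n m -> exists N b c,
  [/\ jump_times n N b c, (c N <= m)%N &
      forall u, b N <= u -> u <= m%:R / n.+1%:R -> X u = X (b N)].
Proof.
have n0 : 0 < n.+1%:R :> R by [].
elim: m => [|m IH] ok.
  exists 0%N, (fun=> 0), (fun=> 0%N); split => //.
    by split => // i _; rewrite mul0r add0r.
  by move=> u u0; rewrite mul0r => u0'; congr X; apply/eqP; rewrite eq_le u0' u0.
have [k km|N [b [c [jt cN cst]]]] := IH; first exact/ok/ltnW.
have [_ _ _ bc _] := jt; have [bc1 bc2] := bc N (leqnn N).
have bm : b N <= m%:R / n.+1%:R.
  by rewrite ler_pdivlMr// (le_trans bc1)// ler_nat.
have mm : m%:R / n.+1%:R < m.+1%:R / n.+1%:R :> R by rewrite ltr_pM2r ?invr_gt0// ltr_nat.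
have m0 : 0 <= m%:R / n.+1%:R :> R by rewrite divr_ge0.
have [same|[sg [msg sgm bef aft]]] := one_change m0 mm (ok m (ltnSn m)).
  exists N, b, c; split => //; first by rewrite (leq_trans cN).
  move=> u bu um; have [um'|mu] := leP u (m%:R / n.+1%:R); first exact: cst.
  by rewrite same ?(ltW mu)// cst.
exists N.+1, (fun i => if (i <= N)%N then b i else sg),
  (fun i => if (i <= N)%N then c i else m.+1); rewrite /= ltnn; split => //.
apply: jump_times_rcons => //.
- exact: le_lt_trans msg.
- by rewrite -ler_pdivlMr.
- by move: msg; rewrite ltr_pdivrMr// -natr1; lra.
- move=> u bu us; have [um|mu] := leP u (m%:R / n.+1%:R); first exact: cst.
  by rewrite bef ?(ltW mu)// cst.
Qed.

(** A fictitious last time at the end of the window makes the partition cover it entirely. *)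
Lemma jump_times_upto n m : cells_ok n m -> exists N b c,
  jump_times n N b c /\ c N = m.
Proof.
have n0 : 0 < n.+1%:R :> R by [].
move=> /jump_times_ex[N [b [c [jt cN cst]]]].
have [cm|cm] := eqVneq (c N) m; first by exists N, b, c.
have cm' : (c N < m)%N by rewrite ltn_neqAle cm.
exists N.+1, (fun i => if (i <= N)%N then b i else m%:R / n.+1%:R),
  (fun i => if (i <= N)%N then c i else m); rewrite /= ltnn; split => //.
have [_ _ _ bc _] := jt; have [bc1 bc2] := bc N (leqnn N).
apply: jump_times_rcons => //.
- by rewrite ltr_pdivlMr// (le_lt_trans bc1)// ltr_nat.
- by rewrite divfK ?gt_eqF.
- by rewrite divfK ?gt_eqF// ltrDl.
- by move=> u bu um; apply: cst => //; exact: ltW.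
Qed.

End piecewise_constant.

Lemma discrete_right_constant {R : realType} (X : cadlag_path R (nat * nat)%type) (t : R) :
  0 <= t -> exists2 del : R, 0 < del & forall u, t <= u -> u < t + del -> X u = X t.
Proof.
move=> t0; have [_ /(_ t t0) Xr _] := path_cadlag X.
have nX : nbhs (X t) [set X t].
  case: (X t) => k l; exists ([set k], [set l]) => /=.
    by split; exact: discrete_set1.
  by move=> [a b] /= [-> ->].
have [del /= del0 hdel] := Xr _ nX; exists del => // u.
rewrite le_eqVlt => /predU1P[<-//|tu] ud.
by apply: hdel => //=; rewrite ltr_norml; apply/andP; split; lra.
Qed.

(** The path is constant between jump times, so only the time displacement counts: the condition on
    [n] involves neither [K] nor the jump sizes, whence the uniformity in [K]. *)
Lemma rescale_near_sample {R : realType} (K : nat) (X : cadlag_path R (nat * nat)%type)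
    (T e : R) (n m : nat) :
  cells_ok X n m -> T * n.+1%:R < m%:R -> n.+1%:R^-1 < e ->
  skorokhod_nbhd T e (step_path n (sample n (rescale K X))) (rescale K X).
Proof.
move=> ok Tm ne; have n0 : 0 < n.+1%:R :> R by [].
have [N [b [c [[b0 c0 inc bc cst] cN]]]] :=
  jump_times_upto (@discrete_right_constant R X) ok.
have osc i u v : (i < N)%N -> b i <= u -> u < b i.+1 -> b i <= v -> v < b i.+1 ->
    ball (rescale K X u) e (rescale K X v).
  move=> iN bu ub bv vb; rewrite /= (cst i u)// (cst i v)//; apply: ballxx.
  by rewrite (lt_trans _ ne)// invr_gt0.
have [[lam [tc lc lb]] _] :=
  step_approx b0 c0 (fun i iN => (inc i iN).1) (fun i iN => (inc i iN).2) bc osc.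
exists lam; split => // t t0.
  exact: le_lt_trans (lc t t0) ne.
by move=> tT; apply: lb => //; rewrite cN ltr_pdivlMr// (le_lt_trans _ Tm)// ler_pM2r.
Qed.

Lemma measurable_neq {d} {T : measurableType d} (f g : T -> nat * nat) :
  (forall B, measurable (f @^-1` B)) -> (forall B, measurable (g @^-1` B)) ->
  measurable [set w | f w <> g w].
Proof.
move=> mf mg.
have -> : [set w | f w <> g w] = \bigcup_n (f @^-1` [set q | pickle q = n] `&`
    g @^-1` [set q | pickle q <> n]).
  apply/seteqP; split => [w /= fg|w [n _ [/= fn gn]] fg]; last by apply: gn; rewrite -fg.
  exists (pickle (f w)) => //; split => //= h; apply: fg.
  by apply: (pcan_inj pickleK); rewrite h.
by apply: bigcupT_measurable => n; exact: measurableI.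
Qed.

(** * Two changes of the chain within one cell *)

Section jump_probability.
Context {R : realType} {d} {Om : measurableType d}.
Variables (s t : R) (s0 : 0 < s) (t0 : 0 < t).
Variables (Q : R -> R.-pker (nat * nat)%type ~> (nat * nat)%type).
Hypothesis sgQ : transition_semigroup setT Q.
Hypothesis genQ : has_generator setT Q (chain_gen s t).
Variables (P : probability Om R) (X : R -> Om -> nat * nat).
Hypothesis mkX : markov_process setT Q P X.

Let mX (a : R) B : 0 <= a -> measurable (X a @^-1` B).
Proof.
move=> a0; have [mX _ _] := mkX.
by rewrite -[X in measurable X]setTI; apply: mX => //; exact: measurable_natnat.
Qed.

(** The Taylor bound of order 1 for the indicator of the complement of [q], whose zeroth term
    vanishes at [q]. *)
Lemma leave_prob (h : R) q : 0 <= h -> (Q h q (~` [set q]) <= (2 * h)%:E)%E.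
Proof.
move=> h0; have mB : measurable (~` [set q]) by exact: measurable_natnat.
have := qop_taylor measurableT sgQ genQ (bmeas_chain_gen s0 t0) 1
  (@bmeas_indic R _ _ _ mB) h0 (I : setT q).
rewrite big_ord1 /= indicE memNset; last by move=> /(_ erefl).
have -> : texp 1 h = h by rewrite /texp expr1 divr1.
rewrite mulr0 subr0 /qop Rintegral_indic// expr1 mul1r.
rewrite ger0_norm ?fine_ge0// => hle.
by rewrite -[leLHS]fineK ?lee_fin//; exact: pker_fin_num.
Qed.

Let past_pre (a u : R) B : 0 <= u -> u <= a -> past X a (X u @^-1` B).
Proof.
move=> u0 ua; apply: sub_gen_smallest; exists u, B; split => //.
exact: measurable_natnat.
Qed.

Lemma past_pickle (a : R) H n : 0 <= a -> past X a H ->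
  past X a (H `&` X a @^-1` [set q | pickle q = n]).
Proof.
move=> a0 pH.
exact: (@measurableI _ (g_sigma_algebraType (past_gen X a)) _ _ pH (past_pre _ a0 (lexx a))).
Qed.

Lemma past_change (a u v : R) : 0 <= u -> u <= a -> 0 <= v -> v <= a ->
  past X a [set w | X u w <> X v w].
Proof.
move=> u0 ua v0 va.
exact: (@measurable_neq _ (g_sigma_algebraType (past_gen X a)) _ _
  (fun B => past_pre B u0 ua) (fun B => past_pre B v0 va)).
Qed.

(** Splitting [H] by the countably many values of [X a] reduces to [leave_prob] through the Markov
    property. The event [H] is kept so that the estimate can be iterated. *)
Lemma jump_prob (a h : R) (H : set Om) : 0 <= a -> 0 <= h -> past X a H ->
  (P (H `&` [set w | X a w <> X (a + h) w]) <= (2 * h)%:E * P H)%E.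
Proof.
move=> a0 h0 pH; have ah0 : 0 <= a + h by exact: addr_ge0.
pose F n := H `&` X a @^-1` [set q | pickle q = n].
pose B n : set (nat * nat) := ~` [set q | pickle q = n].
have pF n : past X a (F n) by exact: past_pickle.
have mF n : measurable (F n) by exact: (past_measurable mkX (pF n)).
have trF (G : nat -> set Om) : trivIset setT (fun n => F n `&` G n).
  by apply/trivIsetP => i j _ _ /eqP ij; rewrite -subset0 => w /= [[[_ /= wi] _] [[_ /= wj] _]];
    apply: ij; rewrite -wi -wj.
have mFB n : measurable (F n `&` X (a + h) @^-1` B n) by apply: measurableI => //; exact: mX.
have -> : H `&` [set w | X a w <> X (a + h) w] =
    \bigcup_n (F n `&` X (a + h) @^-1` B n).
  apply/seteqP; split => [w [Hw /= Xw]|w [n _ [[Hw /= wn] /= wB]]].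
    exists (pickle (X a w)) => //; split => //= h'; apply: Xw.
    by apply: (pcan_inj pickleK); rewrite h'.
  by split => // h'; apply: wB; rewrite -h'.
have HE : H = \bigcup_n (F n `&` setT).
  apply/seteqP; split => [w Hw|w [n _ [[]]]//].
  by exists (pickle (X a w)).
have PU (G : nat -> set Om) : (forall n, measurable (F n `&` G n)) ->
    P (\bigcup_n (F n `&` G n)) = (\sum_(0 <= n <oo) P (F n `&` G n))%E.
  move=> mFG; rewrite measure_bigcup//; apply: congr_lim; apply/funext => k.
  by apply: eq_bigl => i; rewrite in_setT.
have PH : P H = (\sum_(0 <= n <oo) P (F n))%E.
  rewrite [in LHS]HE PU => [|n]; last by rewrite setIT.
  by apply: congr_lim; apply/funext => k; apply: eq_bigr => i _; rewrite setIT.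
rewrite PU// PH -nneseriesZl//.
apply: lee_nneseries => // n _.
have [_ _ /(_ a h (B n) (F n) a0 h0 (measurable_natnat _) (pF n)) mk] := mkX.
have -> : P (F n `&` X (a + h) @^-1` B n) = (\int[P]_(w in F n) Q h (X a w) (B n))%E.
  exact: mk.
rewrite -integral_cst//; apply: ge0_le_integral => //.
- have mQ : measurable_fun setT (fun q => Q h q (B n)).
    by move=> _ Y _; exact: measurable_natnat.
  apply/measurable_funTS; apply: (measurableT_comp mQ); have [+ _ _] := mkX; exact.
- move=> w [_ /= wn].
  have -> : B n = ~` [set X a w].
    apply/seteqP; split => q /= qn h'; apply: qn; first by rewrite h'.
    by apply: (pcan_inj pickleK); rewrite h'.
  exact: leave_prob.
Qed.

Lemma two_jumps_prob (a b h : R) : 0 <= a -> 0 <= h -> a + h <= b ->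
  (P ([set w | X a w <> X (a + h)%R w] `&` [set w | X b w <> X (b + h)%R w])
    <= ((2 * h) ^+ 2)%:E)%E.
Proof.
move=> a0 h0 ab; have ah0 : 0 <= a + h by exact: addr_ge0.
have b0 : 0 <= b by exact: le_trans ab.
have pT : past X a setT.
  exact: (@measurableT _ (g_sigma_algebraType (past_gen X a))).
have P1 : P setT = 1%E by exact: probability_setT.
have := jump_prob a0 h0 pT; rewrite setTI P1 mule1 => le1.
have pA : past X b [set w | X a w <> X (a + h)%R w].
  by apply: past_change => //; rewrite (le_trans _ ab)// lerDl.
apply: (le_trans (jump_prob b0 h0 pA)).
by rewrite expr2 [leRHS]EFinM lee_wpmul2l// lee_fin mulr_ge0.
Qed.

(* Changes across two distinct steps of the subdivision of [[a, a + h]] into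
   [M + 1] steps; each has probability at most [2 * h / M.+1]. *)
Definition grid_changes (a h : R) (M : nat) : set Om :=
  \bigcup_(j' in `I_M.+1) \bigcup_(j in `I_j')
   ([set w | X (a + j%:R * (h / M.+1%:R)) w <>
             X (a + j%:R * (h / M.+1%:R) + h / M.+1%:R) w] `&`
    [set w | X (a + j'%:R * (h / M.+1%:R)) w <>
             X (a + j'%:R * (h / M.+1%:R) + h / M.+1%:R) w]).

Lemma measurable_grid_changes (a h : R) M : 0 <= a -> 0 <= h ->
  measurable (grid_changes a h M).
Proof.
move=> a0 h0; have d0 : 0 <= h / M.+1%:R by rewrite divr_ge0.
apply: fin_bigcup_measurable => // j' _; apply: fin_bigcup_measurable => // j _.
by apply: measurableI; apply: measurable_neq => B; apply: mX;
  rewrite ?addr_ge0 ?mulr_ge0.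
Qed.

(** There are at most [M.+1 ^ 2] pairs of steps, so the factors [M.+1] cancel and the bound is free
    of [M]. *)
Lemma grid_changes_prob (a h : R) M : 0 <= a -> 0 <= h ->
  (P (grid_changes a h M) <= (4 * h ^+ 2)%:E)%E.
Proof.
move=> a0 h0; have d0 : 0 <= h / M.+1%:R by rewrite divr_ge0.
have m2 j j' : measurable ([set w | X (a + j%:R * (h / M.+1%:R)) w <>
             X (a + j%:R * (h / M.+1%:R) + h / M.+1%:R) w] `&`
    [set w | X (a + j'%:R * (h / M.+1%:R)) w <>
             X (a + j'%:R * (h / M.+1%:R) + h / M.+1%:R) w]).
  by apply: measurableI; apply: measurable_neq => B; apply: mX;
    rewrite ?addr_ge0 ?mulr_ge0.
have sub n (A : nat -> set Om) (c : R) : (forall i, (i < n)%N -> measurable (A i)) ->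
    (forall i, (i < n)%N -> (P (A i) <= c%:E)%E) ->
    (P (\bigcup_(i in `I_n) A i) <= (n%:R * c)%:E)%E.
  move=> mA Ac; rewrite bigcup_mkord.
  elim: n mA Ac => [|n IH] mA Ac; first by rewrite big_ord0 measure0 mul0r.
  rewrite big_ord_recr/= -natr1 mulrDl mul1r EFinD.
  apply: (le_trans (measureU2 _ _ _)).
  - by apply: bigsetU_measurable => i _; apply: mA; rewrite (ltn_trans (ltn_ord i)).
  - exact: mA.
  - apply: leeD; last exact: Ac.
    by apply: IH => i iN; [apply: mA|apply: Ac]; exact: ltnW.
pose del := h / M.+1%:R.
have le1 j' : (j' < M.+1)%N -> (P (\bigcup_(j in `I_j')
   ([set w | X (a + j%:R * del) w <> X (a + j%:R * del + del) w] `&`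
    [set w | X (a + j'%:R * del) w <> X (a + j'%:R * del + del) w]))
    <= (M.+1%:R * (2 * del) ^+ 2)%:E)%E.
  move=> jM; apply: (@le_trans _ _ (j'%:R * (2 * del) ^+ 2)%:E); last first.
    by rewrite lee_fin ler_wpM2r ?exprn_ge0 ?mulr_ge0// ler_nat ltnW.
  apply: sub => j jj'; first exact: m2.
  apply: two_jumps_prob => //; first by rewrite addr_ge0// mulr_ge0.
  rewrite -addrA lerD2l -[X in _ + X]mul1r -mulrDl ler_wpM2r//.
  by rewrite natr1 ler_nat.
apply: (le_trans (sub M.+1 _ _ _ le1)).
  by move=> j' _; apply: fin_bigcup_measurable => // j _; exact: m2.
rewrite lee_fin le_eqVlt; apply/orP; left; apply/eqP.
have -> : h = M.+1%:R * del by rewrite /del mulrC divfK.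
by ring.
Qed.

(* The lower limit over all subdivisions contains the paths with two changes in
   the cell, by right continuity, and keeps the bound of each subdivision. *)
Definition bad_cell (a h : R) : set Om :=
  \bigcup_n \bigcap_(M in [set M | (n <= M)%N]) grid_changes a h M.

Lemma measurable_bad_cell (a h : R) : 0 <= a -> 0 <= h -> measurable (bad_cell a h).
Proof.
move=> a0 h0; apply: bigcupT_measurable => n; apply: bigcap_measurable.
  by exists n => /=.
by move=> M _; exact: measurable_grid_changes.
Qed.

(** The tail intersections increase to [bad_cell], and each lies in the grid event of its first
    index; continuity from below concludes. *)
Lemma bad_cell_prob (a h : R) : 0 <= a -> 0 <= h -> (P (bad_cell a h) <= (4 * h ^+ 2)%:E)%E.
Proof.
move=> a0 h0; pose G n := \bigcap_(M in [set M | (n <= M)%N]) grid_changes a h M.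
have mG n : measurable (G n).
  apply: bigcap_measurable; first by exists n => /=.
  by move=> M _; exact: measurable_grid_changes.
have ndG : nondecreasing_seq G.
  move=> i j ij; apply/subsetPset => w Gw M /= jM; apply: Gw => /=.
  exact: leq_trans jM.
have cG := nondecreasing_cvg_mu (mu := P) mG (bigcupT_measurable _ mG) ndG.
have -> : P (bad_cell a h) = limn (P \o G) by rewrite (cvg_lim _ cG).
apply: lime_le; first by apply/cvg_ex; eexists; exact: cG.
apply: nearW => n; apply: le_trans (grid_changes_prob n a0 h0).
apply: le_measure; rewrite ?inE//; first exact: measurable_grid_changes.
by move=> w /(_ n); apply => /=.
Qed.

End jump_probability.

Section bad_cells.
Context {R : realType}.

Lemma change_between {V : Type} (y : nat -> V) (i i' : nat) : y i <> y i' -> (i <= i')%N ->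
  exists j, [/\ (i <= j)%N, (j < i')%N & y j <> y j.+1].
Proof.
move=> yi ii'; apply: contrapT => no; apply: yi.
suff H k : (i + k <= i')%N -> y i = y (i + k)%N by rewrite -(subnKC ii') -H ?subnKC.
elim: k => [|k IH]; first by rewrite addn0.
rewrite addnS => ik; rewrite IH ?(ltnW ik)//; apply: contrapT => h.
by apply: no; exists (i + k)%N; split => //; rewrite leq_addr.
Qed.

(** Rounding [u < v < w] up to a fine grid preserves the three values, by right continuity, and the
    order; a step with a change then lies between the first two grid points and another between the
    last two. *)
Lemma two_changes_grid {V : Type} (X : R -> V) (a h : R) :
  (forall t : R, 0 <= t -> exists2 del : R, 0 < del &
    forall u, t <= u -> u < t + del -> X u = X t) ->
  0 <= a -> 0 < h -> two_changes X a (a + h) ->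
  \forall M \near \oo, exists j' j, [/\ (j' < M.+1)%N, (j < j')%N,
   X (a + j%:R * (h / M.+1%:R)) <> X (a + j%:R * (h / M.+1%:R) + h / M.+1%:R) &
   X (a + j'%:R * (h / M.+1%:R)) <> X (a + j'%:R * (h / M.+1%:R) + h / M.+1%:R)].
Proof.
move=> rc a0 h0 [u [v [w [au uv vw wb [Xuv Xvw]]]]].
have [d1 d10 h1] := rc u (le_trans a0 au).
have [d2 d20 h2] := rc v (le_trans a0 (le_trans au (ltW uv))).
have [d3 d30 h3] := rc w (le_trans a0 (le_trans au (ltW (lt_trans uv vw)))).
pose del := Num.min (Num.min d1 d2) (Num.min d3 (Num.min (v - u) (w - v))).
have del0 : 0 < del / h by rewrite divr_gt0// !lt_min d10 d20 d30 !subr_gt0 uv.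
near=> M.
have : M.+1%:R^-1 < del / h by near: M; exact: near_infty_natSinv_lt (PosNum del0).
rewrite ltr_pdivlMr// mulrC !lt_min => /andP[/andP[l1 l2] /and3P[l3 l4 l5]].
have M0 : 0 < M.+1%:R :> R by [].
pose e := h / M.+1%:R; have e0 : 0 < e by rewrite divr_gt0.
rewrite -/e in l1 l2 l3 l4 l5 *.
have hE : M.+1%:R * e = h by rewrite mulrC divfK// gt_eqF.
have grid t : a <= t -> t <= a + h -> exists i : nat,
    [/\ (i <= M.+1)%N, t <= a + i%:R * e & a + i%:R * e < t + e].
  move=> at_ tb; have [|i [i1 i2]] := @natceil_ex R ((t - a) / e).
    by rewrite divr_ge0 ?subr_ge0// ltW.
  have i2' : i%:R * e < t - a + e.
    by move: i2; rewrite -(ltr_pM2r e0) mulrDl mul1r divfK ?gt_eqF.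
  exists i; split; [|by move: i1; rewrite ler_pdivrMr//; lra|lra].
  rewrite -ltnS -(ltr_nat R) -(ltr_pM2r e0) -natr1 mulrDl mul1r hE; lra.
have [||i1 [_ p1 q1]] := grid u; [by []|lra|].
have [||i2 [_ p2 q2]] := grid v; [lra|lra|].
have [||i3 [iM p3 q3]] := grid w; [lra|by []|].
pose y i := X (a + i%:R * e).
have y1 : y i1 = X u by apply: h1 => //; lra.
have y2 : y i2 = X v by apply: h2 => //; lra.
have y3 : y i3 = X w by apply: h3 => //; lra.
have le12 : (i1 <= i2)%N by rewrite -(ler_nat R) -(ler_pM2r e0); lra.
have le23 : (i2 <= i3)%N by rewrite -(ler_nat R) -(ler_pM2r e0); lra.
have [j [_ ji2 yj]] : exists j, [/\ (i1 <= j)%N, (j < i2)%N & y j <> y j.+1].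
  by apply: change_between => //; rewrite y1 y2.
have [j' [ij' ji3 yj']] : exists j, [/\ (i2 <= j)%N, (j < i3)%N & y j <> y j.+1].
  by apply: change_between => //; rewrite y2 y3.
exists j', j; split.
- exact: leq_trans iM.
- exact: leq_trans ij'.
- by move: yj; rewrite /y -natr1 mulrDl mul1r addrA.
- by move: yj'; rewrite /y -natr1 mulrDl mul1r addrA.
Unshelve. all: by end_near.
Qed.

Variables (s t : R) (s0 : 0 < s) (t0 : 0 < t).
Context {d} {Om : measurableType d} (P : probability Om R).
Variable X : Om -> cadlag_path R (nat * nat)%type.
Variables (Q : R -> R.-pker (nat * nat)%type ~> (nat * nat)%type).
Hypothesis sgQ : transition_semigroup setT Q.
Hypothesis genQ : has_generator setT Q (chain_gen s t).
Hypothesis mkX : markov_process setT Q P (fun r w => X w r).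

Definition bad_cells (n m : nat) : set Om :=
  \bigcup_(k in `I_m) bad_cell (fun r w => X w r) (k%:R / n.+1%:R) n.+1%:R^-1.

Lemma cells_ok_bad n m w : ~ bad_cells n m w -> cells_ok (X w) n m.
Proof.
move=> nb k km two; apply: nb; exists k => //.
have n0 : 0 < n.+1%:R^-1 :> R by rewrite invr_gt0.
have k0 : 0 <= k%:R / n.+1%:R :> R by rewrite divr_ge0.
have [|M0 _ hM] := @two_changes_grid _ (X w) (k%:R / n.+1%:R) (n.+1%:R^-1)
   (@discrete_right_constant R (X w)) k0 n0.
  by have -> : k%:R / n.+1%:R + n.+1%:R^-1 = k.+1%:R / n.+1%:R :> R
    by rewrite -[k.+1%:R]natr1 mulrDl mul1r.
exists M0 => // M /= MM; have [j' [j [? ? ? ?]]] := hM M MM.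
by exists j' => //; exists j.
Qed.

Lemma measurable_bad_cells n m : measurable (bad_cells n m).
Proof.
apply: fin_bigcup_measurable => // k _.
by apply: (measurable_bad_cell mkX); rewrite ?divr_ge0 ?invr_ge0.
Qed.

Lemma bad_cells_prob n m : (P (bad_cells n m) <= (m%:R * (4 / n.+1%:R ^+ 2))%:E)%E.
Proof.
have n0 : 0 <= n.+1%:R^-1 :> R by rewrite invr_ge0.
rewrite /bad_cells bigcup_mkord; elim: m => [|m IH].
  by rewrite big_ord0 measure0 mul0r.
have m0 k : 0 <= k%:R / n.+1%:R :> R by rewrite divr_ge0.
rewrite big_ord_recr/= -[m.+1%:R]natr1 [(m%:R + 1) * _]mulrDl mul1r EFinD.
apply: (le_trans (measureU2 _ _ _)).
- by apply: bigsetU_measurable => i _; apply: (measurable_bad_cell mkX).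
- exact: (measurable_bad_cell mkX).
- apply: leeD => //; have := bad_cell_prob s0 t0 sgQ genQ mkX (m0 m) n0.
  by rewrite exprVn.
Qed.

End bad_cells.

(** * Lower limits and Fatou *)

Section lower_limits.
Context {R : realType}.
Implicit Types u : (\bar R)^nat.
Local Open Scope ereal_scope.

Lemma limn_einf_near_gt u a : a < limn_einf u -> \forall n \near \oo, a < u n.
Proof.
rewrite /limn_einf -/(limf_einf u \oo) limf_einfE => /ereal_sup_gt[_ [V nV <-] aV].
near=> n; apply: (lt_le_trans aV); apply: ereal_inf_lbound; exists n => //.
by near: n.
Unshelve. all: by end_near. Qed.

Lemma limn_einf_ge u a : (\forall n \near \oo, a <= u n) -> a <= limn_einf u.
Proof.
move=> au; rewrite /limn_einf -/(limf_einf u \oo) limf_einfE.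
apply: (@le_trans _ _ (ereal_inf [set u x | x in [set n | a <= u n]])).
  by apply: le_ereal_inf_tmp => _ [n /= an <-].
by apply: ereal_sup_ubound; exists [set n | a <= u n].
Qed.

Lemma limn_einf_le u b : (\forall n \near \oo, u n <= b) -> limn_einf u <= b.
Proof.
move=> ub; rewrite /limn_einf -/(limf_einf u \oo) limf_einfE.
apply: ge_ereal_sup => _ [V nV <-].
have [n [Vn un]] : exists n, V n /\ u n <= b.
  by have [n] := @filter_ex _ \oo _ _ (filterI nV ub); exists n.
by apply: le_trans un; apply: ereal_inf_lbound; exists n.
Qed.

Lemma measurable_limn_einf d (T : measurableType d) (f : nat -> T -> \bar R) :
  (forall n, measurable_fun setT (f n)) ->
  measurable_fun setT (fun x => limn_einf (f ^~ x)).
Proof.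
move=> mf; have ml : measurable_fun setT (fun x => limn_esup (fun n => - f n x)).
  by apply: measurable_fun_limn_esup => n; exact: (measurableT_comp (@oppe_measurable R setT) (mf n)).
exact: (measurableT_comp (@oppe_measurable R setT) ml).
Qed.

End lower_limits.

Section double_fatou.
Context {R : realType} {d} {T : measurableType d} (P : probability T R).
Variables (h : nat -> nat -> T -> R) (f : T -> R).
Hypothesis mh : forall j i, measurable_fun setT (h j i).
Hypothesis h0 : forall j i w, 0 <= h j i w.
Hypothesis h_le : forall w j, \forall i \near \oo, h j i w <= f w.
Hypothesis h_ge : forall w (e : R), 0 < e ->
  \forall j \near \oo, \forall i \near \oo, f w - e <= h j i w.

Let g j w := limn_einf (fun i => (h j i w)%:E).

Lemma double_limn_einf w : limn_einf (g ^~ w) = (f w)%:E.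
Proof.
apply/eqP; rewrite eq_le; apply/andP; split.
  apply: limn_einf_le; apply: nearW => j; apply: limn_einf_le.
  by apply: filterS (h_le w j) => i; rewrite lee_fin.
apply/lee_subgt0Pr => e e0; rewrite -EFinB.
apply: limn_einf_ge; apply: filterS (h_ge w e0) => j hj; apply: limn_einf_ge.
by apply: filterS hj => i; rewrite lee_fin.
Qed.

(** Measurability of [f] is a conclusion here: this is how functionals of paths become measurable
    along a process. *)
Lemma double_limn_einf_measurable : measurable_fun setT f.
Proof.
apply/measurable_EFinP; have -> : EFin \o f = fun w => limn_einf (g ^~ w).
  by apply/funext => w; rewrite double_limn_einf.
apply: measurable_limn_einf => j; apply: measurable_limn_einf => i.
exact/measurable_EFinP.
Qed.

(** Fatou in [j], then in [i] for the chosen [j], each time extracting an index from a strict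
    inequality on a lower limit. *)
Lemma double_fatou a : (a < \int[P]_w (f w)%:E)%E ->
  exists j, \forall i \near \oo, (a < \int[P]_w (h j i w)%:E)%E.
Proof.
move=> af.
have mg j : measurable_fun setT (g j).
  by apply: measurable_limn_einf => i; exact/measurable_EFinP.
have g0 j w : (0 <= g j w)%E.
  by apply: limn_einf_ge; apply: nearW => i; rewrite lee_fin.
have : (a < limn_einf (fun j => \int[P]_w g j w))%E.
  apply: (lt_le_trans af).
  have -> : (\int[P]_w (f w)%:E = \int[P]_w limn_einf (g ^~ w))%E.
    by apply: eq_integral => w _; rewrite double_limn_einf.
  exact: fatou.
move=> /limn_einf_near_gt[j _ /(_ j (leqnn j))] /= aj; exists j.
apply: limn_einf_near_gt; apply: (lt_le_trans aj).
apply: fatou => //.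
- by move=> i; exact/measurable_EFinP.
- by move=> i w _; rewrite lee_fin.
Qed.

End double_fatou.

(** * The envelope functional *)

Section hats.
Context {R : realType}.

Definition clamp (r : R) : R := Num.max 0 (Num.min 1 r).

Lemma clampP (r : R) :
  [\/ r <= 0 /\ clamp r = 0, 0 <= r /\ r <= 1 /\ clamp r = r | 1 <= r /\ clamp r = 1].
Proof.
rewrite /clamp; have [r1|r1] := leP 1 r.
  by apply: Or33; split => //; rewrite max_r.
have [r0|r0] := leP r 0; first by apply: Or31.
by apply: Or32; split; [exact: ltW|split => //; exact: ltW].
Qed.

Lemma clamp_ge0 r : 0 <= clamp r.
Proof. by have [[? ->]|[? [? ->]]|[? ->]] := clampP r. Qed.

Lemma clamp_le1 r : clamp r <= 1.
Proof. by have [[? ->]|[? [? ->]]|[? ->]] := clampP r. Qed.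

Lemma clamp_continuous : continuous clamp.
Proof.
move=> r; apply: (@continuous_max R R (fun=> 0) (fun r => Num.min 1 r)).
  exact: cvg_cst.
by apply: (@continuous_min R R (fun=> 1) id); [exact: cvg_cst|exact: cvg_id].
Qed.

Variable del : R.
Hypothesis del0 : 0 < del.

(* Tent of half-width [del] centred at [a * del]. *)
Definition hat (a : nat) (r : R) : R :=
  clamp (r / del - a%:R + 1) - clamp (r / del - a%:R).

Lemma hat_ge0 a r : 0 <= hat a r.
Proof.
rewrite subr_ge0; set y := r / del - a%:R.
by have [[? ->]|[? [? ->]]|[? ->]] := clampP y;
  have [[? ->]|[? [? ->]]|[? ->]] := clampP (y + 1); lra.
Qed.

Lemma hat_le1 a r : hat a r <= 1.
Proof. by rewrite /hat; have := clamp_ge0 (r / del - a%:R); have := clamp_le1 (r / del - a%:R + 1); lra. Qed.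

Lemma hat_near a r : hat a r != 0 -> `|r - a%:R * del| < del.
Proof.
move=> h; have -> : r - a%:R * del = (r / del - a%:R) * del.
  by rewrite mulrBl divfK ?gt_eqF.
rewrite normrM (gtr0_norm del0) -[ltRHS]mul1r ltr_pM2r// ltNge; apply: contra h.
rewrite /hat => h; apply/eqP; move: h; set y := r / del - a%:R.
by rewrite ler_normr => /orP[] h; have [[? ->]|[? [? ->]]|[? ->]] := clampP y;
  have [[? ->]|[? [? ->]]|[? ->]] := clampP (y + 1); lra.
Qed.

Lemma hat_continuous a : continuous (hat a).
Proof.
have ca (c : R) : continuous (fun r : R => clamp (r / del + c)).
  move=> r; apply: (@continuous_comp _ _ _ (fun r : R => r / del + c) clamp);
    last exact: clamp_continuous.
  by apply: cvgD; [apply: cvgMl; exact: cvg_id|exact: cvg_cst].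
move=> r; apply: cvgB; last exact: ca.
under eq_fun do rewrite -addrA; rewrite -addrA; exact: ca.
Qed.

(** The differences of clamps telescope; the first term left over is 1 for [0 <= r], the second is 0
    up to the last centre. *)
Lemma sum_hat N r : \sum_(a < N) hat a r = clamp (r / del + 1) - clamp (r / del - N%:R + 1).
Proof.
elim: N => [|N IH]; first by rewrite big_ord0 subr0 subrr.
rewrite big_ord_recr/= IH /hat.
have -> : r / del - N.+1%:R + 1 = r / del - N%:R by rewrite -natr1; ring.
by ring.
Qed.

Lemma sum_hat_le1 N r : \sum_(a < N) hat a r <= 1.
Proof.
rewrite sum_hat; have := clamp_le1 (r / del + 1).
by have := clamp_ge0 (r / del - N%:R + 1); lra.
Qed.

Lemma sum_hat1 N r : 0 <= r -> r / del <= N%:R -> \sum_(a < N.+1) hat a r = 1.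
Proof.
move=> r0 rN; have y0 : 0 <= r / del by rewrite divr_ge0// ltW.
rewrite sum_hat.
have -> : r / del - N.+1%:R + 1 = r / del - N%:R by rewrite -natr1; ring.
set y := r / del in rN y0 *.
by have [[? ->]|[? [? ->]]|[? ->]] := clampP (y + 1);
  have [[? ->]|[? [? ->]]|[? ->]] := clampP (y - N%:R); lra.
Qed.

Definition hat2 (a : nat * nat) (p : R * R) : R := hat a.1 p.1 * hat a.2 p.2.

Lemma hat2_ge0 a p : 0 <= hat2 a p.
Proof. by rewrite mulr_ge0 ?hat_ge0. Qed.

Lemma bmeas_hat2 a : bmeas (hat2 a) 1.
Proof.
have mh b : measurable_fun setT (hat b).
  by apply: continuous_measurable_fun; exact: hat_continuous.
split => [|p].
  by apply: measurable_funM; apply: measurableT_comp (mh _) _.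
by rewrite ger0_norm ?hat2_ge0// mulr_ile1 ?hat_ge0 ?hat_le1.
Qed.

Lemma hat2_continuous a : continuous (hat2 a).
Proof.
move=> p; apply: (@cvgM _ _ _ _ (fun p : R * R => hat a.1 p.1) (fun p => hat a.2 p.2)).
  by apply: (@continuous_comp _ _ _ fst (hat a.1)); [exact: cvg_fst|exact: hat_continuous].
by apply: (@continuous_comp _ _ _ snd (hat a.2)); [exact: cvg_snd|exact: hat_continuous].
Qed.

Lemma sum_hat2 N p :
  \sum_(g : 'I_N * 'I_N) hat2 (val g.1, val g.2) p =
  (\sum_(a < N) hat a p.1) * (\sum_(a < N) hat a p.2).
Proof.
rewrite big_distrlr/= pair_bigA/=; exact: eq_bigr.
Qed.

End hats.

Section envelope.
Context {R : realType}.
Variables (F : cadlag_path R (R * R)%type -> R) (j i : nat).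
Hypothesis F0 : forall z, 0 <= F z.

Let mesh : R := j.+1%:R^-1.
(** The sampling times [k / (i + 1)] with [k <= N] cover [[0, j + 1]], and the [B] centres
    [a / (j + 1)] on each axis cover [[0, i]]. *)
Let N := (j.+1 * i.+1)%N.
Let B := (i * j.+1).+1.

Let mesh0 : 0 < mesh. Proof. by rewrite invr_gt0. Qed.
Let mesh1 : mesh <= 1. Proof. by rewrite invf_le1// ler1n. Qed.

Definition grid_code := {ffun 'I_N.+1 -> 'I_B * 'I_B}.

(** For [k > N], [inord] falls back to the index 0. Such [k] belong to times beyond the horizon
    [j.+1] at which step paths are compared. *)
Definition center (f : grid_code) (k : nat) : R * R :=
  ((f (inord k)).1%:R * mesh, (f (inord k)).2%:R * mesh).

Definition center_hat (f : grid_code) (k : nat) : R * R -> R :=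
  hat2 mesh (val (f (inord k)).1, val (f (inord k)).2).

Definition coef (f : grid_code) : R :=
  inf [set F y | y in skorokhod_nbhd j.+1%:R (2 * mesh) (step_path i (center f))].

Definition weight (z : R -> R * R) (f : grid_code) : R :=
  \prod_(k < N.+1) center_hat f k (z (k%:R / i.+1%:R)).

(* Radius [2 * mesh] in [coef]: one mesh for the positions (a nonzero weight puts
   the samples within one mesh of the centers), one for the step approximation. *)
Definition envelope (z : R -> R * R) : R := \sum_f coef f * weight z f.

Lemma weight_ge0 z f : 0 <= weight z f.
Proof. by apply: prodr_ge0 => k _; exact: hat2_ge0. Qed.

Lemma sum_weight z : \sum_f weight z f = \prod_(k < N.+1)
  ((\sum_(a < B) hat mesh a (z (k%:R / i.+1%:R)).1) *
   (\sum_(a < B) hat mesh a (z (k%:R / i.+1%:R)).2)).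
Proof.
under [RHS]eq_bigr do rewrite -sum_hat2.
rewrite bigA_distr_bigA/=; apply: eq_bigr => f _.
by apply: eq_bigr => k _; rewrite /center_hat inord_val.
Qed.

Lemma sum_weight_le1 z : \sum_f weight z f <= 1.
Proof.
rewrite sum_weight; apply: prodr_ile1 => k _; apply/andP; split.
  by apply: mulr_ge0; apply: sumr_ge0 => a _; exact: hat_ge0.
by rewrite mulr_ile1 ?sum_hat_le1//; apply: sumr_ge0 => a _; exact: hat_ge0.
Qed.

Lemma sum_weight1 z : (forall t : R, 0 <= t -> quadrant (z t)) ->
  (forall t : R, 0 <= t -> t <= j.+1%:R -> (z t).1 <= i%:R /\ (z t).2 <= i%:R) ->
  \sum_f weight z f = 1.
Proof.
move=> zq zi; rewrite sum_weight big1// => k _.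
have k0 : 0 <= k%:R / i.+1%:R :> R by rewrite divr_ge0.
have [q1 q2] := zq _ k0.
have [|le1 le2] := zi _ k0.
  by rewrite ler_pdivrMr// -natrM ler_nat -ltnS.
by rewrite !sum_hat1 ?mulr1// ler_pdivrMr// ?natrM -mulrA mulfV ?mulr1.
Qed.

Lemma weight_near z f k : weight z f != 0 -> (k <= N)%N ->
  ball (center f k) mesh (sample i z k).
Proof.
move=> wf kN; have kN' : (k < N.+1)%N by [].
move: wf; rewrite /weight (bigD1 (Ordinal kN'))//= mulf_eq0 negb_or => /andP[+ _].
rewrite /center_hat /hat2 mulf_eq0 negb_or /= => /andP[/(hat_near mesh0) h1 /(hat_near mesh0) h2].
by split; rewrite /ball/= distrC.
Qed.

Lemma coef_set_lb (f : grid_code) : has_lbound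
  [set F y | y in skorokhod_nbhd j.+1%:R (2 * mesh) (step_path i (center f))].
Proof. by exists 0 => _ [y _ <-]. Qed.

Lemma coef_set_nonempty (f : grid_code) :
  [set F y | y in skorokhod_nbhd j.+1%:R (2 * mesh) (step_path i (center f))] !=set0.
Proof.
exists (F (step_path i (center f))), (step_path i (center f)) => //.
have m0 : 0 < 2 * mesh by rewrite mulr_gt0.
apply: (@skorokhod_nbhd_step _ _ _ _ i N) => //.
  by rewrite -natrM ltr_nat.
by move=> k _; exact: ballxx.
Qed.

Lemma coef_ge0 f : 0 <= coef f.
Proof. by apply: lb_le_inf; [exact: coef_set_nonempty|move=> _ [y _ <-]]. Qed.

Lemma envelope_ge0 z : 0 <= envelope z.
Proof. by apply: sumr_ge0 => f _; rewrite mulr_ge0 ?coef_ge0 ?weight_ge0. Qed.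

(** If [f] has a nonzero weight, [z] lies within two meshes of the step path of the centres, so it
    competes in the infimum defining [coef f]. The additional unit of horizon allows for the time
    change between the two approximations. *)
Lemma envelope_le (z : cadlag_path R (R * R)%type) :
  skorokhod_nbhd (j.+1%:R + 1) mesh (step_path i (sample i z)) z ->
  envelope z <= F z.
Proof.
move=> near; apply: (@le_trans _ _ (\sum_f F z * weight z f)); last first.
  by rewrite -mulr_sumr ler_piMr// sum_weight_le1.
apply: ler_sum => f _; have [->|wf] := eqVneq (weight z f) 0; first by rewrite !mulr0.
rewrite ler_wpM2r ?weight_ge0//; apply: ge_inf; first exact: coef_set_lb.
exists z => //; rewrite mulrDl mul1r.
apply: skorokhod_nbhd_trans near; first by rewrite lerD2l.
apply: (@skorokhod_nbhd_step _ _ _ _ i N) => //; first by rewrite -natrM ltr_nat.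
by move=> k kN; exact: weight_near.
Qed.

(** From [z] to its samples, to the centres, to a competitor [y] of the infimum: radii [mesh],
    [mesh] and [2 * mesh]. The horizon decreases from [j + 1] to [j - 1] to absorb the first two
    time changes. *)
Lemma envelope_ge (z : cadlag_path R (R * R)%type) (a : R) :
  (forall t : R, 0 <= t -> quadrant (z t)) ->
  (forall t : R, 0 <= t -> t <= j.+1%:R -> (z t).1 <= i%:R /\ (z t).2 <= i%:R) ->
  skorokhod_nbhd j.+1%:R mesh z (step_path i (sample i z)) ->
  (forall y, skorokhod_nbhd (j%:R - 1) (4 * mesh) z y -> a <= F y) ->
  a <= envelope z.
Proof.
move=> zq zi near Fa; have jE : j.+1%:R = j%:R + 1 :> R by rewrite natr1.
have room (r : R) : r <= 1 -> j%:R - 1 + (r + r) <= j.+1%:R by rewrite jE; lra.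
have room1 (r : R) : 0 < r -> j%:R - 1 + r <= j%:R - 1 + (r + r) by lra.
have <- : \sum_f a * weight z f = a by rewrite -mulr_sumr sum_weight1// mulr1.
apply: ler_sum => f _; have [->|wf] := eqVneq (weight z f) 0; first by rewrite !mulr0.
rewrite ler_wpM2r ?weight_ge0//.
apply: lb_le_inf; first exact: coef_set_nonempty.
move=> _ [y fy <-]; apply: Fa.
have -> : 4 * mesh = mesh + mesh + 2 * mesh by ring.
apply: skorokhod_nbhd_trans fy; last first.
  apply: (@skorokhod_nbhd_trans _ _ _ j.+1%:R _ _ _ (step_path i (sample i z))); last first.
  - apply: (@skorokhod_nbhd_step _ _ _ _ i N) => //; first by rewrite -natrM ltr_nat.
    by move=> k kN; apply: ball_sym; exact: weight_near.
  - by apply: skorokhod_nbhdS near; rewrite // jE; lra.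
  - exact: le_trans (room1 _ mesh0) (room _ mesh1).
exact: room.
Qed.

End envelope.

Lemma In_map_ex (A B : Type) (f : A -> B) (r : seq A) (b : B) :
  List.In b (map f r) -> exists2 a, List.In a r & f a = b.
Proof.
elim: r => [//|a r IH] /= [<-|/IH[a' ra' <-]]; first by exists a; [left|].
by exists a'; [right|].
Qed.

Section envelope_expectation.
Context {R : realType}.

Lemma EFin_Rintegral_bmeas {d} {T : measurableType d} (P : probability T R) (f : T -> R)
    (M : R) : bmeas f M -> (\int[P]_w f w)%:E = (\int[P]_w (f w)%:E)%E.
Proof.
move=> bf; have P1 : P setT = 1%E by exact: probability_setT.
by rewrite /Rintegral fineK//; apply: integrable_fin_num => //; exact: bmeas_integrable P1 bf.
Qed.

Lemma bmeas_sum {d} {T : measurableType d} (I : Type) (r : seq I) (c : I -> R)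
    (g : I -> T -> R) : (forall i, bmeas (g i) 1) ->
  exists M, bmeas (fun w => \sum_(i <- r) c i * g i w) M.
Proof.
move=> bg; elim: r => [|a r [M IH]].
  by exists (`|0 : R|); under eq_fun do rewrite big_nil; exact: bmeas_cst.
by eexists; under eq_fun do rewrite big_cons addrC; exact: bmeas_lin IH (bg a).
Qed.

Lemma Rintegral_sum_bmeas {d} {T : measurableType d} (P : probability T R) (I : Type)
    (r : seq I) (c : I -> R) (g : I -> T -> R) : (forall i, bmeas (g i) 1) ->
  \int[P]_w (\sum_(i <- r) c i * g i w) = \sum_(i <- r) c i * \int[P]_w g i w.
Proof.
move=> bg; have P1 : P setT = 1%E by exact: probability_setT.
have [linP _] := bfunctional_prob P1.
elim: r => [|a r IH].
  rewrite big_nil -[RHS](Rintegral_prob_cst 0 P1).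
  by apply: eq_Rintegral => w _; rewrite big_nil.
rewrite big_cons -IH addrC; have [M bM] := bmeas_sum r c bg.
rewrite -(linP _ _ _ _ (c a) bM (bg a)).
by apply: eq_Rintegral => w _; rewrite big_cons addrC.
Qed.

Lemma path_prod_big {d d'} {Om : measurableType d} {S : measurableType d'}
    (X : R -> Om -> S) (a h : R) (fs : seq (S -> R)) w :
  path_prod X a h fs w = \prod_(k < size fs) nth (fun=> 1) fs k (X (a + k%:R * h) w).
Proof.
elim: fs a => [|f fs IH] a /=; first by rewrite big_ord0.
rewrite big_ord_recl/= mul0r addr0; congr (_ * _); rewrite IH.
by apply: eq_bigr => k _ /=; rewrite add0n /bump /= natrD mulrDl mul1r addrA.
Qed.

Definition center_hats (j i : nat) (f : grid_code j i) : seq (R * R -> R) :=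
  mkseq (center_hat f) (j.+1 * i.+1).+1.

Lemma center_hats_spec j i (f : grid_code j i) g : List.In g (center_hats f) ->
  continuous g /\ bmeas g 1.
Proof.
move=> hg; have [k _ <-] := In_map_ex hg.
by split; [exact: hat2_continuous|apply: bmeas_hat2; rewrite invr_gt0].
Qed.

Lemma weight_path_prod {d} {Om : measurableType d} (Z : R -> Om -> R * R) j i
    (f : grid_code j i) w :
  weight (fun r => Z r w) f = path_prod Z 0 i.+1%:R^-1 (center_hats f) w.
Proof.
rewrite path_prod_big size_mkseq; apply: eq_bigr => k _.
by rewrite nth_mkseq// add0r.
Qed.

Lemma weight_path_prod_rescale {d} {Om : measurableType d} (X : R -> Om -> nat * nat)
    K j i (f : grid_code j i) w :
  weight (fun r => scale_state K (X r w)) f =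
  path_prod X 0 i.+1%:R^-1 (map (fun g q => g (scale_state K q)) (center_hats f)) w.
Proof.
rewrite path_prod_big size_map size_mkseq; apply: eq_bigr => k _.
by rewrite (nth_map (fun=> 1)) ?size_mkseq// nth_mkseq// add0r.
Qed.

Variables (F : cadlag_path R (R * R)%type -> R) (s t x y : R).
Hypotheses (s0 : 0 < s) (t0 : 0 < t) (x0 : 0 <= x) (y0 : 0 <= y).

Lemma envelope_markov {d} {Om : measurableType d} (P : probability Om R)
    (E : set (R * R)) (Q : R -> R.-pker (R * R)%type ~> (R * R)%type)
    (Z : Om -> cadlag_path R (R * R)%type) z0 j i :
  markov_process E Q P (fun r w => Z w r) ->
  {ae P, forall w, Z w 0 = z0} ->
  (exists M, bmeas (fun w => envelope F j i (Z w)) M) /\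
  \int[P]_w envelope F j i (Z w) =
    \sum_(f : grid_code j i) coef F f * chainQ Q i.+1%:R^-1 (center_hats f) z0.
Proof.
move=> mk Z0; have h0 : 0 <= i.+1%:R^-1 :> R by rewrite invr_ge0.
have bf (f : grid_code j i) : bmeas1 (center_hats f) by move=> g /center_hats_spec[].
have bw (f : grid_code j i) : bmeas (fun w => weight (Z w) f) 1.
  have -> : (fun w => weight (Z w) f) = path_prod (fun r w => Z w r) 0 i.+1%:R^-1 (center_hats f).
    by apply/funext => w; rewrite -weight_path_prod.
  exact: (bmeas_path_prod mk).
split; first exact: bmeas_sum.
rewrite /envelope Rintegral_sum_bmeas//; apply: eq_bigr => f _; congr (_ * _).
rewrite -(path_prodE mk h0 (bf f) Z0).
by apply: eq_Rintegral => w _; rewrite -weight_path_prod.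
Qed.

Lemma envelope_chain {d} {Om : measurableType d} (P : probability Om R)
    (Q : R -> R.-pker (nat * nat)%type ~> (nat * nat)%type)
    (X : Om -> cadlag_path R (nat * nat)%type) q0 K j i :
  markov_process setT Q P (fun r w => X w r) ->
  {ae P, forall w, X w 0 = q0} ->
  (exists M, bmeas (fun w => envelope F j i (rescale K (X w))) M) /\
  \int[P]_w envelope F j i (rescale K (X w)) =
    \sum_(f : grid_code j i) coef F f * chainQ Q i.+1%:R^-1
      (map (fun g q => g (scale_state K q)) (center_hats f)) q0.
Proof.
move=> mk X0; have h0 : 0 <= i.+1%:R^-1 :> R by rewrite invr_ge0.
have bf (f : grid_code j i) :
    bmeas1 (map (fun g q => g (scale_state K q)) (center_hats f)).
  move=> g hg; have [g' /center_hats_spec [_ [_ g1]] <-] := In_map_ex hg.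
  by apply: bmeas_natnat => q.
have bw (f : grid_code j i) : bmeas (fun w => weight (rescale K (X w)) f) 1.
  have -> : (fun w => weight (rescale K (X w)) f) =
      path_prod (fun r w => X w r) 0 i.+1%:R^-1
        (map (fun g q => g (scale_state K q)) (center_hats f)).
    by apply/funext => w; rewrite -weight_path_prod_rescale.
  exact: (bmeas_path_prod mk).
split; first exact: bmeas_sum.
rewrite /envelope Rintegral_sum_bmeas//; apply: eq_bigr => f _; congr (_ * _).
rewrite -(path_prodE mk h0 (bf f) X0).
by apply: eq_Rintegral => w _; rewrite -weight_path_prod_rescale.
Qed.

Lemma cvg_sum_seq (I : Type) (r : seq I) (u : I -> nat -> R) (l : I -> R) :
  (forall i, u i K @[K --> \oo] --> l i) ->
  \sum_(i <- r) u i K @[K --> \oo] --> \sum_(i <- r) l i.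
Proof.
move=> ul; elim: r => [|a r IH].
  by under eq_fun do rewrite big_nil; rewrite big_nil; exact: cvg_cst.
under eq_fun do rewrite big_cons; rewrite big_cons; exact: cvgD.
Qed.

Lemma cvg_chain_sum (n m : nat -> nat)
    (QK : nat -> R -> R.-pker (nat * nat)%type ~> (nat * nat)%type)
    (Q : R -> R.-pker (R * R)%type ~> (R * R)%type) j i :
  (n K)%:R / K%:R @[K --> \oo] --> x ->
  (m K)%:R / K%:R @[K --> \oo] --> y ->
  (forall K, transition_semigroup setT (QK K)) ->
  (forall K, has_generator setT (QK K) (chain_gen s t)) ->
  transition_semigroup (@quadrant R) Q ->
  has_generator (@quadrant R) Q (jump_gen s t) ->
  \sum_(f : grid_code j i) coef F f * chainQ (QK K) i.+1%:R^-1
      (map (fun g q => g (scale_state K q)) (center_hats f)) (n K, m K) @[K --> \oo] -->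
  \sum_(f : grid_code j i) coef F f * chainQ Q i.+1%:R^-1 (center_hats f) (x, y).
Proof.
move=> hn hm sgK genK sgQ genQ; have h0 : 0 <= i.+1%:R^-1 :> R by rewrite invr_ge0.
apply: cvg_sum_seq => f; apply: cvgM; first exact: cvg_cst.
have := cont_cvg_chainQ s0 t0 sgK genK sgQ genQ h0 (@center_hats_spec j i f).
move=> /(_ (x, y)) cc; apply/cvgrPdist_le => e e0.
have [del [K0 [del0 H]]] := cc (conj x0 y0) e e0.
near=> K; rewrite distrC; apply: H => /=.
- by near: K; exact: nbhs_infty_ge.
- by rewrite distrC; near: K; exact: (cvgrPdist_lt _ _).1 hn _ del0.
- by rewrite distrC; near: K; exact: (cvgrPdist_lt _ _).1 hm _ del0.
Unshelve. all: by end_near.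
Qed.

End envelope_expectation.

(** * Weak convergence *)

Section weak_limit.
Context {R : realType}.
Implicit Types F : cadlag_path R (R * R)%type -> R.

Lemma continuous_nbhd F (z : cadlag_path R (R * R)%type) (e : R) : continuous F -> 0 < e ->
  exists T d : R, 0 < d /\ forall y, skorokhod_nbhd T d z y -> F z - e < F y.
Proof.
move=> cF e0; have /cvgrPdist_lt/(_ _ e0) := cF z.
move=> [U [oU Uz] hU]; have [T [d [d0 Td]]] := oU z Uz.
exists T, d; split => // y /Td /hU /=.
by rewrite ltr_norml => /andP[_]; lra.
Qed.

Lemma envelope_near_le F (z : cadlag_path R (R * R)%type) j : (forall z, 0 <= F z) ->
  \forall i \near \oo, envelope F j i z <= F z.
Proof.
move=> F0; have m0 : 0 < j.+1%:R^-1 :> R by rewrite invr_gt0.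
by apply: filterS (step_path_near z (j.+1%:R + 1) m0) => i [_]; exact: envelope_le.
Qed.

(** The limits cannot be merged: [i] must exceed a bound of the path on [[0, j + 1]] and resolve its
    oscillations, while [j] depends only on the continuity of [F] at [z]. *)
Lemma envelope_near_ge F (z : cadlag_path R (R * R)%type) (e : R) :
  (forall z, 0 <= F z) -> continuous F -> (forall t : R, 0 <= t -> quadrant (z t)) ->
  0 < e -> \forall j \near \oo, \forall i \near \oo, F z - e <= envelope F j i z.
Proof.
move=> F0 cF zq e0; have [T [d [d0 Td]]] := continuous_nbhd z cF e0.
have d40 : 0 < d / 4 by rewrite divr_gt0.
near=> j; have m0 : 0 < j.+1%:R^-1 :> R by rewrite invr_gt0.
have [M hM] := cadlag_bounded j.+1%:R (path_cadlag z).
have near_z := step_path_near z j.+1%:R m0.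
near=> i; have [near_i _] : skorokhod_nbhd j.+1%:R j.+1%:R^-1 z (step_path i (sample i z)) /\
    skorokhod_nbhd j.+1%:R j.+1%:R^-1 (step_path i (sample i z)) z by near: i.
have Mi : M <= i%:R by near: i; exact: nbhs_infty_ger.
apply: envelope_ge => //.
- move=> t t0 tj; have [h1 h2] := hM t t0 tj.
  by split; apply: le_trans Mi; [exact: le_trans (ler_norm _) h1|exact: le_trans (ler_norm _) h2].
- move=> y zy; apply/ltW/Td; apply: skorokhod_nbhdS zy.
    by rewrite lerBrDr; near: j; exact: nbhs_infty_ger.
  have : j.+1%:R^-1 < d / 4 by near: j; exact: near_infty_natSinv_lt (PosNum d40).
  by rewrite ltr_pdivlMr// mulrC => /ltW.
Unshelve. all: by end_near.
Qed.

Lemma envelope_le_bound F (M : R) (z : R -> R * R) j i : (forall z, 0 <= F z) ->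
  (forall z, F z <= M) -> envelope F j i z <= M.
Proof.
move=> F0 FM; have M0 : 0 <= M by apply: le_trans (F0 (step_path 0 (fun=> 0))) (FM _).
apply: (@le_trans _ _ (\sum_(f : grid_code j i) M * weight z f)); last first.
  by rewrite -mulr_sumr ler_piMr// sum_weight_le1.
apply: ler_sum => f _; rewrite ler_wpM2r ?weight_ge0//.
have [c [y fy _]] := coef_set_nonempty F f.
apply: (le_trans _ (FM y)); apply: ge_inf; first exact: coef_set_lb.
by exists y.
Qed.

Lemma bmeas_path_functional {d} {Om : measurableType d}
    (Z : Om -> cadlag_path R (R * R)%type) F (M : R) :
  (forall z, 0 <= F z) -> (forall z, F z <= M) -> continuous F ->
  (forall w (t : R), 0 <= t -> quadrant (Z w t)) ->
  (forall j i, measurable_fun setT (fun w => envelope F j i (Z w))) ->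
  bmeas (fun w => F (Z w)) M.
Proof.
move=> F0 FM cF Zq mH; split; last by move=> w; rewrite ger0_norm.
apply: (double_limn_einf_measurable (h := fun j i w => envelope F j i (Z w))) => //.
- by move=> w j; exact: envelope_near_le.
- by move=> w e e0; exact: (envelope_near_ge F0 cF (Zq w) e0).
Qed.

(** [envelope_le] applies off the bad cells, and on them the envelope is at most [M]. *)
Lemma chain_bad_bound F (M s t : R) {d} {Om : measurableType d} (P : probability Om R)
    (Q : R -> R.-pker (nat * nat)%type ~> (nat * nat)%type)
    (X : Om -> cadlag_path R (nat * nat)%type) K j i :
  0 < s -> 0 < t ->
  (forall z, 0 <= F z) -> (forall z, F z <= M) ->
  transition_semigroup setT Q -> has_generator setT Q (chain_gen s t) ->
  markov_process setT Q P (fun r w => X w r) ->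
  bmeas (fun w => F (rescale K (X w))) M ->
  (exists M', bmeas (fun w => envelope F j i (rescale K (X w))) M') ->
  i.+1%:R^-1 < j.+1%:R^-1 :> R ->
  \int[P]_w envelope F j i (rescale K (X w)) <=
  \int[P]_w F (rescale K (X w)) + M * ((j.+3 * 4)%:R / i.+1%:R).
Proof.
move=> s0 t0 F0 FM sgQ genQ mk bF [M' bH] ij.
have P1 : P setT = 1%E by exact: probability_setT.
have M0 : 0 <= M by apply: le_trans (F0 (step_path 0 (fun=> 0))) (FM _).
have [linP _] := bfunctional_prob P1.
(* A window of length [j + 3], strictly longer than the horizon [j + 2] of [envelope_le]. *)
pose bad := bad_cells X i (j.+3 * i.+1).
have mbad : measurable bad by exact: (measurable_bad_cells mk).
have bbad := @bmeas_indic R _ _ _ mbad.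
apply: (@le_trans _ _ (\int[P]_w (F (rescale K (X w)) + M * \1_bad w))).
  apply: le_Rintegral => //.
  - exact: bmeas_integrable P1 bH.
  - exact: bmeas_integrable P1 (bmeas_lin M bF bbad).
  - move=> w _; rewrite indicE; have [wb|wb] := boolP (w \in bad).
      by rewrite mulr1 (le_trans (envelope_le_bound _ _ _ F0 FM))// lerDr.
    rewrite mulr0 addr0; apply: envelope_le => //.
    apply: (@rescale_near_sample _ _ _ _ _ _ (j.+3 * i.+1)) => //.
      by apply: (cells_ok_bad); move/negP: wb => wb h; apply: wb; rewrite inE.
    by rewrite natrM ltr_pM2r// natr1 ltr_nat.
rewrite (linP _ _ _ _ M bF bbad) lerD2l ler_wpM2l// Rintegral_indic//.
have := bad_cells_prob s0 t0 sgQ genQ mk i (j.+3 * i.+1).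
have -> : (j.+3 * i.+1)%:R * (4 / i.+1%:R ^+ 2) = (j.+3 * 4)%:R / i.+1%:R :> R.
  have : i.+1%:R != 0 :> R by [].
  by rewrite !natrM; move: (i.+1%:R : R) (j.+3%:R : R) => u v u0; field.
move=> h; rewrite -lee_fin fineK//.
by rewrite ge0_fin_numE// (le_lt_trans h)// ltry.
Qed.

(** Half of the liminf inequality in threshold form: [j] and [i] are chosen on the limit process,
    and [K] grows only afterwards, with the envelope fixed. The measurability conclusions are
    returned along with it. *)
Lemma lower_limit F (M s t x y : R)
    (n m : nat -> nat) (dK : nat -> measure_display)
    (OmK : forall K : nat, measurableType (dK K))
    (PK : forall K : nat, probability (OmK K) R)
    (NK : forall K : nat, OmK K -> cadlag_path R (nat * nat)%type)
    (d : measure_display) (Om : measurableType d) (P : probability Om R)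
    (Z : Om -> cadlag_path R (R * R)%type) (a : R) :
  0 < s -> 0 < t -> 0 <= x -> 0 <= y ->
  (n K)%:R / K%:R @[K --> \oo] --> x -> (m K)%:R / K%:R @[K --> \oo] --> y ->
  (forall K : nat, markov_with_generator [set: nat * nat] (chain_gen s t) (PK K)
         (fun r w => NK K w r) (n K, m K)) ->
  markov_with_generator (@quadrant R) (jump_gen s t) P (fun r w => Z w r) (x, y) ->
  (forall z, 0 <= F z) -> (forall z, F z <= M) -> continuous F ->
  [/\ forall K, bmeas (fun w => F (rescale K (NK K w))) M,
      bmeas (fun w => F (Z w)) M &
      a < \int[P]_w F (Z w) ->
      \forall K \near \oo, a < \int[PK K]_w F (rescale K (NK K w))].
Proof.
move=> s0 t0 x0 y0 hn hm hNK [[Q [sgQ genQ mkZ]] Z0] F0 FM cF.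
have M0 : 0 <= M by apply: le_trans (F0 (step_path 0 (fun=> 0))) (FM _).
have /choice[QK hQK] : forall K, exists Q : R -> R.-pker (nat * nat)%type ~> (nat * nat)%type,
    [/\ transition_semigroup setT Q, has_generator setT Q (chain_gen s t)
       & markov_process setT Q (PK K) (fun r w => NK K w r)].
  by move=> K; have [[QK ?] _] := hNK K; exists QK.
have NK0 K : {ae PK K, forall w, NK K w 0 = (n K, m K)} by have [] := hNK K.
have sgK K : transition_semigroup setT (QK K) by have [] := hQK K.
have genK K : has_generator setT (QK K) (chain_gen s t) by have [] := hQK K.
have mkK K : markov_process setT (QK K) (PK K) (fun r w => NK K w r) by have [] := hQK K.
have [bHK EHK] : (forall K j i, exists M',
      bmeas (fun w => envelope F j i (rescale K (NK K w))) M') /\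
    (forall K j i, \int[PK K]_w envelope F j i (rescale K (NK K w)) =
       \sum_f coef F f * chainQ (QK K) i.+1%:R^-1
      (map (fun g q => g (scale_state K q)) (@center_hats R j i f)) (n K, m K)).
  by split=> K j i; have [] := envelope_chain F K j i (mkK K) (NK0 K).
have [bHZ EHZ] : (forall j i, exists M', bmeas (fun w => envelope F j i (Z w)) M') /\
    (forall j i, \int[P]_w envelope F j i (Z w) =
       \sum_f coef F f * chainQ Q i.+1%:R^-1 (@center_hats R j i f) (x, y)).
  by split=> j i; have [] := envelope_markov F j i mkZ Z0.
have bFK K : bmeas (fun w => F (rescale K (NK K w))) M.
  apply: bmeas_path_functional => //.
    by move=> w r r0; split; rewrite /= divr_ge0.
  by move=> j i; have [M' []] := bHK K j i.
have Zq w (r : R) : 0 <= r -> quadrant (Z w r).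
  by move=> r0; have [_ /(_ r w r0) Zq _] := mkZ; exact: Zq.
have bFZ : bmeas (fun w => F (Z w)) M.
  by apply: bmeas_path_functional => // j i; have [M' []] := bHZ j i.
split => // aZ.
(* Fatou and the convergence in [K] keep the envelope expectations above the midpoint [b]; the gap
   [b - a] then pays for the bad cells. *)
pose b := (a + \int[P]_w F (Z w)) / 2.
have ab : a < b by rewrite /b; lra.
have bZ : (b%:E < \int[P]_w (F (Z w))%:E)%E.
  by rewrite -(EFin_Rintegral_bmeas P bFZ) lte_fin /b; lra.
have [||||j hj] := double_fatou (h := fun j i w => envelope F j i (Z w)) _ _ _ _ bZ.
- by move=> j i; have [M' []] := bHZ j i.
- by move=> j i w; exact: envelope_ge0.
- by move=> w j; exact: envelope_near_le.
- by move=> w e e0; exact: (envelope_near_ge F0 cF (Zq w) e0).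
(* The summand 1 covers the case [M = 0]. *)
have C0 : 0 < (b - a) / (M * (j.+3 * 4)%:R + 1).
  by rewrite divr_gt0 ?subr_gt0// ltr_wpDl// mulr_ge0.
have m0 : 0 < j.+1%:R^-1 :> R by rewrite invr_gt0.
have [i [ij iC bi]] : exists i, [/\ i.+1%:R^-1 < j.+1%:R^-1 :> R,
   i.+1%:R^-1 < (b - a) / (M * (j.+3 * 4)%:R + 1) &
   (b%:E < \int[P]_w (envelope F j i (Z w))%:E)%E].
  have [i [[? ?] ?]] := @filter_ex _ \oo _ _ (filterI (filterI
    (near_infty_natSinv_lt (PosNum m0)) (near_infty_natSinv_lt (PosNum C0))) hj).
  by exists i.
have {}bi : b < \int[P]_w envelope F j i (Z w).
  by have [M' bH] := bHZ j i; rewrite -lte_fin (EFin_Rintegral_bmeas P bH).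
have cvgH : \int[PK K]_w envelope F j i (rescale K (NK K w)) @[K --> \oo] -->
    \int[P]_w envelope F j i (Z w).
  rewrite EHZ; under eq_fun do rewrite EHK.
  exact: (@cvg_chain_sum R F s t x y s0 t0 x0 y0 n m QK Q j i hn hm sgK genK sgQ genQ).
have small : M * ((j.+3 * 4)%:R / i.+1%:R) <= b - a.
  move: iC; rewrite ltr_pdivlMr; last by rewrite ltr_wpDl// mulr_ge0.
  have : 0 < i.+1%:R^-1 :> R by rewrite invr_gt0.
  by move: (i.+1%:R^-1 : R) ((j.+3 * 4)%:R : R) => u v; lra.
near=> K.
have bK : b < \int[PK K]_w envelope F j i (rescale K (NK K w)).
  near: K; exact: (cvgr_gt _ cvgH).
have transfer (u v E G r : R) : v < E -> r <= v - u -> E <= G + r -> u < G by lra.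
apply: transfer bK small _.
exact: (chain_bad_bound s0 t0 F0 FM (sgK K) (genK K) (mkK K) (bFK K) (bHK K j i) ij).
Unshelve. all: by end_near.
Qed.

End weak_limit.

Theorem theorem5p1 (R : realType) (s t x y : R)
    (hs : 0 < s) (ht : 0 < t) (hx : 0 <= x) (hy : 0 <= y)
    (n m : nat -> nat)
    (hn : (n K)%:R / K%:R @[K --> \oo] --> x)
    (hm : (m K)%:R / K%:R @[K --> \oo] --> y)
    (dK : nat -> measure_display) (OmK : forall K : nat, measurableType (dK K))
    (PK : forall K : nat, probability (OmK K) R)
    (NK : forall K : nat, OmK K -> cadlag_path R (nat * nat)%type)
    (hNK : forall K : nat,
       markov_with_generator [set: nat * nat] (chain_gen s t) (PK K)
         (fun r w => NK K w r) (n K, m K))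
    (d : measure_display) (Om : measurableType d) (P : probability Om R)
    (Z : Om -> cadlag_path R (R * R)%type)
    (hZ : markov_with_generator (@quadrant R) (jump_gen s t) P
            (fun r w => Z w r) (x, y)) :
  cvg_in_distribution PK (fun K w => rescale K (NK K w)) P Z.
Proof.
move=> F cF [M FM]; rewrite unlock.
pose F1 z := F z + M; pose F2 z := M - F z.
have F10 z : 0 <= F1 z by have := FM z; rewrite ler_norml /F1 => /andP[]; lra.
have F20 z : 0 <= F2 z by have := FM z; rewrite ler_norml /F2 => /andP[]; lra.
have F1M z : F1 z <= 2 * M by have := FM z; rewrite ler_norml /F1 => /andP[]; lra.
have F2M z : F2 z <= 2 * M by have := FM z; rewrite ler_norml /F2 => /andP[]; lra.
have cF1 : continuous F1 by move=> z; exact: (cvgD (cF z) (cvg_cst M)).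
have cF2 : continuous F2 by move=> z; exact: (cvgB (cvg_cst M) (cF z)).
have lim1 a := lower_limit a hs ht hx hy hn hm hNK hZ F10 F1M cF1.
have lim2 a := lower_limit a hs ht hx hy hn hm hNK hZ F20 F2M cF2.
(* Only measurability and bounds are taken here; they do not depend on the threshold. *)
have [b1K b1 _] := lim1 0.
have shift d' (T : measurableType d') (Y : T -> cadlag_path R (R * R)%type) :
    bmeas (fun w => F1 (Y w)) (2 * M) -> bmeas (fun w => F (Y w)) M.
  move=> [mF1 _]; split; last by move=> w.
  have -> : (fun w => F (Y w)) = (fun w => F1 (Y w) - M).
    by apply/funext => w; rewrite /F1 addrK.
  exact: measurable_funB.
have EF1 d' (T : measurableType d') (P' : probability T R)
    (Y : T -> cadlag_path R (R * R)%type) : bmeas (fun w => F (Y w)) M ->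
    \int[P']_w F1 (Y w) = \int[P']_w F (Y w) + M /\
    \int[P']_w F2 (Y w) = M - \int[P']_w F (Y w).
  move=> bF; have P1 : P' setT = 1%E by exact: probability_setT.
  have [linP _] := bfunctional_prob P1.
  have bM := @bmeas_cst R _ T M.
  have <- : \int[P']_w (fun=> M : R) w = M by exact: Rintegral_prob_cst.
  split.
    rewrite -[X in _ + X]mul1r -(linP _ _ _ _ 1 bF bM).
    by apply: eq_Rintegral => w _; rewrite mul1r.
  rewrite -mulN1r -(linP _ _ _ _ (-1) bM bF).
  by apply: eq_Rintegral => w _; rewrite mulN1r.
have bF := shift _ _ _ b1; have bFK K := shift _ _ _ (b1K K).
rewrite /comp; under eq_fun do rewrite -(EFin_Rintegral_bmeas _ (bFK _)).
rewrite -(EFin_Rintegral_bmeas _ bF); apply: cvg_EFin; first by apply: nearW.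
apply/cvgrPdist_lt => e e0.
(* Thresholds lowered by [e] below the two limit expectations become the two sides of the estimate
   on the distance. *)
have [_ _ near1] := lim1 (\int[P]_w F (Z w) + M - e).
have [_ _ near2] := lim2 (M - \int[P]_w F (Z w) - e).
have [E1 E2] := EF1 _ _ P Z bF.
have {}near1 := near1 ltac:(by rewrite E1 ltrBlDr ltrDl).
have {}near2 := near2 ltac:(by rewrite E2 ltrBlDr ltrDl).
near=> K; have [EK1 EK2] := EF1 _ _ (PK K) _ (bFK K).
have n1 : \int[P]_w F (Z w) + M - e < \int[PK K]_w F1 (rescale K (NK K w)) by near: K.
have n2 : M - \int[P]_w F (Z w) - e < \int[PK K]_w F2 (rescale K (NK K w)) by near: K.
rewrite EK1 in n1; rewrite EK2 in n2.
move: n1 n2; rewrite /= ltr_norml; move: (\int[P]_w _) (\int[PK K]_w _) => u v n1 n2.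
by apply/andP; split; lra.
Unshelve. all: by end_near.
Qed.
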